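(* Let $F_{\mathrm{mod}}$ be a toy model map in $\mathcal I(\bar\varepsilon)$. Suppose that $$\sup_{w\in\overline{\operatorname{Per}}_{F_{\mathrm{mod}}}}\frac{\|D_1(w)\|}{m(A_1(w))}\le\frac12 .$$ Then there exists a locally invariant $C^1$ single surface $Q$ which contains $\overline{\operatorname{Per}}_{F_{\mathrm{mod}}}$. The surface $Q$ meets the strong stable manifold $W^{ss}(w)$ transversally and in a unique point at each $w\in\overline{\operatorname{Per}}_{F_{\mathrm{mod}}}$.
   Context: Fix an integer $m\ge1$. Let $B=I^x\times I^y\times I^{\mathbf z}\subset\mathbb R^{m+2}$ be a hypercube centred at the origin, $I^{\mathbf z}=[-c,c]^m$, $\mathbf I^v=I^y\times I^{\mathbf z}$; $w=(x,y,\mathbf z)$. A Hénon-like map is $F:B\to\mathbb R^{m+2}$, $F(w)=(f(x)-\varepsilon(w),x,\boldsymbol\delta(w))$, $f:I^x\to I^x$ unimodal. Standing assumptions: $F$ is analytic, an orientation preserving diffeomorphism onto its image; $f$ has a unique non-flat critical point; $\|\varepsilon\|,\|\boldsymbol\delta\|$ sufficiently small; $F$ has exactly two fixed points, $\beta_0$ with only positive eigenvalues and $\beta_1$ with both positive and negative eigenvalues; the product of any two eigenvalues at a fixed point has absolute value $<1$. $F$ is renormalizable if $W^u(\beta_0)\cap W^s(\beta_1)$ is the orbit of a single point. With $H(w)=(f(x)-\varepsilon(w),y,\mathbf z-\boldsymbol\delta(y,f^{-1}(y),\mathbf 0))$ ($f^{-1}$ the inverse branch of $f$ with values near the critical value)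 and $\Lambda(x,y,\mathbf z)=(sx,sy,s\mathbf z)$, where $s:V\to I^x$ is the orientation reversing affine rescaling of the minimal closed interval $V$ with $V\times\mathbf I^v$ invariant under $HF^2H^{-1}$, the renormalization is $RF=\Lambda HF^2H^{-1}\Lambda^{-1}$. $\mathcal I(\bar\varepsilon)$: infinitely renormalizable Hénon-like maps with $\max\{\|\varepsilon\|,\|\boldsymbol\delta\|\}\le\bar\varepsilon$, $\bar\varepsilon$ sufficiently small. A toy model map is a Hénon-like map with $\partial_{z_i}\varepsilon\equiv0$ for all $i$: $F_{\mathrm{mod}}(w)=(f(x)-\varepsilon(x,y),x,\boldsymbol\delta(w))$. Put $F_{2d}=\pi_{xy}\circ F_{\mathrm{mod}}$, i.e. $F_{2d}(x,y)=(f(x)-\varepsilon(x,y),x)$ (also a diffeomorphism onto its image). Then $DF_{\mathrm{mod}}(w)=\begin{pmatrix}A_1(w)&\mathbf 0\\C_1(w)&D_1(w)\end{pmatrix}$ with $A_1(w)=DF_{2d}(x,y)$, $C_1(w)=(\partial_x\boldsymbol\delta\ \partial_y\boldsymbol\delta)(w)$, $D_1(w)=\partial_{\mathbf z}\boldsymbol\delta(w)=(\partial_{z_j}\delta^i(w))$. $\|\cdot\|$ is the operator norm and $m(A)=\|A^{-1}\|^{-1}$. $\operatorname{Per}_F$ is the set of periodic points, $\overline{\operatorname{Per}}_F$ its closure. A $C^r$ submanifold $Q$ containing a compact invariant set $\Gamma$ is locally invariant under $F$ if there is a neighbourhood $U$ of $\Gamma$ in $Q$ with $F(U)\subset Q$.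 A surface is a two-dimensional submanifold. $W^{ss}(w)$ is the strong stable manifold at $w$, tangent to the uniformly contracted $m$-dimensional subbundle $E^{ss}$ of the dominated splitting $E^{ss}\oplus E^{pu}$ over $\overline{\operatorname{Per}}_{F_{\mathrm{mod}}}$ ($E^{ss}$ is the $\mathbf z$-direction $\{\mathbf 0\}\times\mathbb R^m$, on which $DF_{\mathrm{mod}}$ acts as $D_1$). *)

(* Defs.v *)
From HB Require Import structures.
From mathcomp Require Import all_boot all_order all_algebra.
From mathcomp Require Import complex.
From mathcomp Require Import all_classical all_reals all_analysis.

Set Implicit Arguments.
Unset Strict Implicit.
Unset Printing Implicit Defensive.

Import Order.TTheory GRing.Theory Num.Theory.
Import numFieldNormedType.Exports.

Local Open Scope classical_set_scope.
Local Open Scope ring_scope.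

(* Points of R^(m+2) are row vectors of type 'rV_(2 + m): the left block is
   (x, y), the right block is z. *)

Section LinearAlgebra.
Variable R : realType.

(* Euclidean norm; the norm of the library on matrices is the max norm. *)
Definition enorm k n (v : 'M[R]_(k, n)) : R :=
  Num.sqrt (\sum_i \sum_j v i j ^+ 2).

Definition opnorm k n (A : 'M[R]_(k, n)) : R :=
  sup [set enorm (A *m v) | v in [set v : 'cV[R]_n | enorm v <= 1]].

(* m(A) *)
Definition conorm n (A : 'M[R]_n) : R := (opnorm (invmx A))^-1.

(* [jacobian] acts on row vectors from the right; the transpose is the usual
   matrix (d g_i / d x_j)_(i, j). *)
Definition Dmx n k (g : 'rV[R]_n -> 'rV[R]_k) (w : 'rV[R]_n) : 'M[R]_(k, n) :=
  (jacobian g w)^T.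

(* Complex eigenvalues of a real matrix. In R[i], [0 < z] (resp. [z < 0]) means
   that z is real and positive (resp. negative). *)
Definition cpoly n (A : 'M[R]_n) : {poly R[i]} :=
  map_poly (real_complex R) (char_poly A).

Definition eigenvalueC n (A : 'M[R]_n) (z : R[i]) : Prop := root (cpoly A) z.

(* The product of any two eigenvalues, counted with multiplicity, has modulus
   less than 1. *)
Definition pairwise_dissipative n (A : 'M[R]_n) : Prop :=
  forall s : seq R[i], cpoly A = \prod_(z <- s) ('X - z%:P) ->
  forall i j, (i < j < size s)%N -> `|s`_i * s`_j| < 1.

End LinearAlgebra.

Section Calculus.
Variable R : realType.

(* The homogeneous part of degree k of the power series with coefficients
   a_alpha; the multi-indices alpha with |alpha| = k take values <= k. *)
Definition homog_part n (a : forall k, {ffun 'I_n -> 'I_k.+1} -> R)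
    (k : nat) (v : 'rV[R]_n) : R :=
  \sum_(alpha : {ffun 'I_n -> 'I_k.+1} | (\sum_i alpha i == k)%N)
    a k alpha * \prod_i v 0 i ^+ alpha i.

(* Real analyticity: an absolutely convergent power series on a polydisc. *)
Definition analytic_at n (g : 'rV[R]_n -> R) (p : 'rV[R]_n) : Prop :=
  exists r : R, 0 < r /\
  exists a : forall k, {ffun 'I_n -> 'I_k.+1} -> R,
    cvgn (series (fun k => homog_part (fun k alpha => `|a k alpha|) k
                             (const_mx r)))
    /\ forall v : 'rV[R]_n, `|v| < r ->
         series (fun k => homog_part a k v) @ \oo --> g (p + v).

(* A function on a closed set is represented by a total function: analyticity
   (or C^1 smoothness) at all points of the set refers to full neighbourhoods
   of these points. *)
Definition analytic_on n k (D : set 'rV[R]_n) (g : 'rV[R]_n -> 'rV[R]_k) :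
    Prop :=
  forall w, D w -> forall i, analytic_at (fun v => g v 0 i) w.

Definition C1_on n k (D : set 'rV[R]_n) (g : 'rV[R]_n -> 'rV[R]_k) : Prop :=
  forall w, D w ->
    (\forall v \near w, differentiable g v) /\ {for w, continuous (jacobian g)}.

Definition C1_norm n k (D : set 'rV[R]_n) (g : 'rV[R]_n -> 'rV[R]_k) : \bar R :=
  ereal_sup [set (Num.max (enorm (g w)) (opnorm (Dmx g w)))%:E | w in D].

Definition diffeo_onto_image n (D : set 'rV[R]_n) (F : 'rV[R]_n -> 'rV[R]_n) :
    Prop :=
  C1_on D F /\
  exists G, C1_on (F @` D) G /\ forall w, D w -> G (F w) = w.

(* Embedded k-dimensional C^1 submanifold (without boundary) of R^(k + l):
   locally straightened to R^k x {0} by a C^1 diffeomorphism between open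
   sets. *)
Definition C1_submanifold k l (Q : set 'rV[R]_(k + l)) : Prop :=
  forall q, Q q ->
  exists (O : set 'rV[R]_(k + l)) (Phi : 'rV[R]_(k + l) -> 'rV[R]_(k + l)),
    [/\ open O, O q, open (Phi @` O), diffeo_onto_image O Phi &
        forall w, O w -> (Q w <-> rsubmx (Phi w) = 0)].

(* Velocities at w of curves in S through w. *)
Definition tangent_space n (S : set 'rV[R]_n) (w : 'rV[R]_n) : set 'rV[R]_n :=
  [set v | exists gamma : R -> 'rV[R]_n,
     [/\ gamma 0 = w, (\forall t \near (0 : R), S (gamma t)) &
         is_derive (0 : R) (1 : R) gamma v]].

Definition transverse_at n (S T : set 'rV[R]_n) (w : 'rV[R]_n) : Prop :=
  forall v, exists s t,
    [/\ tangent_space S w s, tangent_space T w t & v = s + t].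

End Calculus.

(* A map F : D -> R^n, where D need not be invariant: only orbits that stay
   in D are considered. *)
Section Dynamics.
Variables (R : realType) (n : nat).
Variables (D : set 'rV[R]_n) (F : 'rV[R]_n -> 'rV[R]_n).

Definition periodic_points : set 'rV[R]_n :=
  [set w | exists k, [/\ (0 < k)%N, iter k F w = w &
                         forall i, D (iter i F w)]].

Definition full_orbit (p : 'rV[R]_n) : set 'rV[R]_n :=
  [set w | exists k,
     (iter k F p = w /\ forall i, (i <= k)%N -> D (iter i F p)) \/
     (iter k F w = p /\ forall i, (i <= k)%N -> D (iter i F w))].

Definition stable_set (b : 'rV[R]_n) : set 'rV[R]_n :=
  [set w | (forall k, D (iter k F w)) /\ (fun k => iter k F w) @ \oo --> b].

Definition unstable_set (b : 'rV[R]_n) : set 'rV[R]_n :=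
  [set w | exists u : nat -> 'rV[R]_n,
     [/\ u 0%N = w, (forall k, D (u k)), (forall k, F (u k.+1) = u k) &
         u @ \oo --> b]].

Definition fixed_pair (b0 b1 : 'rV[R]_n) : Prop :=
  [/\ b0 != b1,
      [set w | D w /\ F w = w] = [set b0; b1],
      (forall z, eigenvalueC (Dmx F b0) z -> 0 < z),
      (exists z, eigenvalueC (Dmx F b1) z /\ 0 < z) /\
      (exists z, eigenvalueC (Dmx F b1) z /\ z < 0) &
      pairwise_dissipative (Dmx F b0) /\ pairwise_dissipative (Dmx F b1)].

Definition renormalizable : Prop :=
  exists b0 b1 p,
    [/\ fixed_pair b0 b1, D p &
        unstable_set b0 `&` stable_set b1 = full_orbit p].

Definition locally_invariant (K Q : set 'rV[R]_n) : Prop :=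
  exists O, [/\ open O, K `<=` O `&` Q & F @` (O `&` Q) `<=` Q].

End Dynamics.

Section Unimodal.
Variables (R : realType) (a b : R) (f : R -> R).

Definition unimodal_at (k : R) : Prop :=
  [/\ a < k < b,
      {in `[a, b], forall x, f x \in `[a, b]} &
      ({in `[a, k] &, {homo f : x y / x < y}} /\
       {in `[k, b] &, {homo f : x y / x < y >-> y < x}}) \/
      ({in `[a, k] &, {homo f : x y / x < y >-> y < x}} /\
       {in `[k, b] &, {homo f : x y / x < y}})].

(* Analytic unimodal self-map of [a, b] with a unique critical point, which is
   non-flat. *)
Definition unimodal : Prop :=
  {in `[a, b], forall x,
     analytic_at (fun u : 'rV[R]_1 => f (u 0 0)) (const_mx x)} /\
  exists k, [/\ unimodal_at k,
      {in `[a, b], forall x, derive1 f x = 0 <-> x = k} &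
      exists j, (2 <= j)%N /\ derive1n j f k != 0].

Definition crit : R := xget 0 [set k | a < k < b /\ derive1 f k = 0].

(* The monotonicity interval of f containing the critical value. *)
Definition value_side : set R :=
  [set x | x \in `[a, b] /\ 0 < (x - crit) * (f crit - crit)].

(* The inverse branch of f with values near the critical value. *)
Definition inv_branch (y : R) : R := xget 0 [set x | value_side x /\ f x = y].

End Unimodal.

Section HenonLike.
Variables (R : realType) (m : nat).

Local Notation pnt := 'rV[R]_(2 + m).

Definition row2 (x y : R) : 'rV[R]_2 := \row_i (if i == 0 then x else y).

Definition pt (x y : R) (z : 'rV[R]_m) : pnt := row_mx (row2 x y) z.

Definition pxy (w : pnt) : 'rV[R]_2 := lsubmx w.
Definition px (w : pnt) : R := pxy w 0 0.
Definition py (w : pnt) : R := pxy w 0 1.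
Definition pz (w : pnt) : 'rV[R]_m := rsubmx w.

Record henon := Henon {
  hf : R -> R;
  heps : pnt -> R;
  hdelta : pnt -> 'rV[R]_m }.

Definition hmap (h : henon) (w : pnt) : pnt :=
  pt (hf h (px w) - heps h w) (px w) (hdelta h w).

(* [a, b] x [a, b] x [-c, c]^m *)
Definition box (c a b : R) : set pnt :=
  [set w | [/\ px w \in `[a, b], py w \in `[a, b] &
               forall i, pz w 0 i \in `[- c, c]]].

(* B *)
Definition cube (c : R) : set pnt := box c (- c) c.

Definition eps_delta_norm (D : set pnt) (h : henon) : \bar R :=
  maxe (C1_norm D (fun w => (heps h w)%:M : 'rV[R]_1)) (C1_norm D (hdelta h)).

(* Hénon-like maps on [a, b] x [a, b] x [-c, c]^m; [eta] is the bound in the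
   requirement that eps and delta be sufficiently small. *)
Definition henon_like (c a b eta : R) (h : henon) : Prop :=
  let D := box c a b in
  [/\ unimodal a b (hf h),
      analytic_on D (hmap h),
      diffeo_onto_image D (hmap h) /\
        (forall w, D w -> 0 < \det (Dmx (hmap h) w)),
      (eps_delta_norm D h <= eta%:E)%E &
      exists b0 b1, fixed_pair D (hmap h) b0 b1].

Section Renormalization.
Variables (c a b : R) (h : henon).

Let D := box c a b.
Let F := hmap h.

Definition Hdom : set pnt :=
  [set w | [/\ D w, value_side a b (hf h) (px w) &
               (hf h @` value_side a b (hf h)) (py w)]].

Definition Hmap (w : pnt) : pnt :=
  pt (hf h (px w) - heps h w) (py w)
     (pz w - hdelta h (pt (py w) (inv_branch a b (hf h) (py w)) 0)).

(* The graph of the partially defined map H o F^2 o H^-1. *)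
Definition pre_renorm (w w' : pnt) : Prop :=
  exists u, [/\ Hdom u, Hmap u = w, D (F u), Hdom (F (F u)) &
                Hmap (F (F u)) = w'].

(* [p, q] x I^v *)
Definition slab (p q : R) : set pnt :=
  [set w | [/\ px w \in `[p, q], py w \in `[- c, c] &
               forall i, pz w 0 i \in `[- c, c]]].

(* Invariance concerns the points where H o F^2 o H^-1 is defined: the inverse
   branch of f need not be defined on all of I^y. *)
Definition slab_invariant (p q : R) : Prop :=
  forall w w', slab p q w -> pre_renorm w w' -> slab p q w'.

(* V = [p, q]. The interval must contain the critical point of f, so that f^-1
   takes [p, q] to the neighbourhood of the critical value. *)
Definition minimal_interval (p q : R) : Prop :=
  [/\ p < q, crit a b (hf h) \in `[p, q], slab_invariant p q &
      forall p' q', p' < q' -> crit a b (hf h) \in `[p', q'] ->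
        slab_invariant p' q' -> p' <= p /\ q <= q'].

(* The orientation reversing affine bijection s : [p, q] -> [-c, c]. *)
Definition rescale (p q x : R) : R := c - (2 * c / (q - p)) * (x - p).

(* On the z-coordinates s acts by its linear part, which keeps delta small
   under renormalization. *)
Definition Lambda (p q : R) (w : pnt) : pnt :=
  pt (rescale p q (px w)) (rescale p q (py w)) (- (2 * c / (q - p)) *: pz w).

(* [h1], on [a1, b1] x [a1, b1] x [-c, c]^m, is the renormalization of [h]. *)
Definition is_renormalization (a1 b1 : R) (h1 : henon) : Prop :=
  exists p q, minimal_interval p q /\
  forall w, box c a1 b1 (Lambda p q w) ->
    (exists w', pre_renorm w w') /\
    (forall w', pre_renorm w w' -> hmap h1 (Lambda p q w) = Lambda p q w').

End Renormalization.

(* The renormalizations R^n F are defined on boxes containing B that may be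
   larger than B: since V is minimal, the fixed point beta_0 of R^n F, which
   corresponds to beta_1 of R^(n-1) F, may lie outside B if n >= 1. *)
Definition infinitely_renormalizable (c eta : R) (h : henon) : Prop :=
  exists (a b : nat -> R) (H : nat -> henon),
    [/\ a 0%N = - c, b 0%N = c, H 0%N = h,
        (forall n, a n <= - c /\ c <= b n) &
        forall n, [/\ henon_like c (a n) (b n) eta (H n),
                      renormalizable (box c (a n) (b n)) (hmap (H n)) &
                      is_renormalization c (a n) (b n) (H n)
                        (a n.+1) (b n.+1) (H n.+1)]].

(* I(ebar) *)
Definition I_class (c eta ebar : R) (h : henon) : Prop :=
  infinitely_renormalizable c eta h /\
  (eps_delta_norm (cube c) h <= ebar%:E)%E.

Definition toy_model (c : R) (h : henon) : Prop :=
  forall w, cube c w -> forall i : 'I_m,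
    'D_(row_mx 0 (delta_mx 0 i) : pnt) (heps h : pnt -> R^o) w = 0.

Definition perbar (c : R) (h : henon) : set pnt :=
  closure (periodic_points (cube c) (hmap h)).

(* F_2d; eps does not depend on z for a toy model map. *)
Definition map2d (h : henon) (v : 'rV[R]_2) : 'rV[R]_2 :=
  row2 (hf h (v 0 0) - heps h (row_mx v 0)) (v 0 0).

Definition A1 (h : henon) (w : pnt) : 'M[R]_2 := Dmx (map2d h) (pxy w).

Definition D1 (h : henon) (w : pnt) : 'M[R]_m :=
  Dmx (fun z => hdelta h (row_mx (pxy w) z)) (pz w).

(* The strong stable manifold of w: the points whose forward orbit approaches
   that of w exponentially faster than the slowest rate allowed by the bundle
   E^pu. E^pu is complementary to E^ss = {0} x R^m, so DF acts on it as A1 under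
   the projection to the (x, y)-plane. *)
Definition Wss (c : R) (h : henon) (w : pnt) : set pnt :=
  [set w' | (forall n, cube c (iter n (hmap h) w')) /\
     exists C lam : R, 0 < lam < 1 /\
     forall n, enorm (iter n (hmap h) w' - iter n (hmap h) w) <=
       C * lam ^+ n * \prod_(i < n) conorm (A1 h (iter i (hmap h) w))].

End HenonLike.

(* Main.v *)
(** For a toy model the planar map P = F_2d is injective with invertible
    derivative near the square, and F is the skew product
    (v, z) |-> (P v, delta (v, z)).  An invariant graph z = phi v solves
    phi u = delta (P^-1 u, phi (P^-1 u)).  A bump function equal to 1 near the
    projection of K, the closure of the periodic points, turns this graph
    transform into an operator on functions defined on all of R^2.  It is a
    contraction because the z-derivative of delta is small, and the derivatives
    of its iterates converge because |D_1| |A_1^-1| <= 1/2 on K, hence <= 3/4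
    near K.  As the domination is only known on K, the transform is applied
    twice: first to find a C^1 section close to K, then, with a smaller cut-off,
    to functions close to that section.  Distances to the graph contract along
    backward orbits, so the graph of the limit contains K.

    A point whose orbit approaches the one of w faster than the products of
    m(A_1) has the same planar projection as w, so that W^ss(w) meets the graph
    only in w; and W^ss(w) contains a disc in the z-direction, which is
    transverse to the graph.

    K may touch the boundary of the cube.  This is where analyticity is needed:
    it carries smoothness, and the independence of epsilon from z, to a
    neighborhood of the cube. *)

(* Two norms are used. The cube is a ball of the max norm, in which increments are easy to estimate,
   but there a product of matrices costs a dimensional factor. The contraction of the derivatives is
   therefore measured in the operator norm, where the quotient 3/4 survives composition.

   The derivative of [delta] enters only through its continuity. So the derivatives of the iterates
   obey a recursion with contraction 3/4 and an error that tends to zero without a rate; uniform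
   convergence of the iterates has to come first, and C^1 convergence is deduced from it.

   That [m(A_1) <= 1] on the cube matters for the unique intersection with [W^ss(w)]: the products
   of the [m(A_1)] then stay bounded, an orbit in [W^ss(w)] really approaches that of [w], and the
   planar map may be linearized along it.

   The planar inverse is built by hand: the second coordinate of [P] is [x], so inverting [P] is a
   one-dimensional problem in [y]. *)
Require Import Defs.
From HB Require Import structures.
From mathcomp Require Import all_boot all_order all_algebra.
From mathcomp Require Import all_classical all_reals all_analysis.
From mathcomp Require Import ring lra.

Set Implicit Arguments.
Unset Strict Implicit.
Unset Printing Implicit Defensive.

Import Order.TTheory GRing.Theory Num.Theory.
Import numFieldNormedType.Exports.

Local Open Scope classical_set_scope.
Local Open Scope ring_scope.

(** * Matrix norms *)

Section MatrixNorms.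
Variable R : realType.

Lemma mx_norm_le_entries k n (A : 'M[R]_(k, n)) e :
  0 <= e -> (forall i j, `|A i j| <= e) -> `|A| <= e.
Proof.
move=> e0 Ae; rewrite [leLHS]/Num.norm /= mx_normrE.
by apply/bigmax_leP; split => //= -[i j] _ /=.
Qed.

Lemma le_mx_norm k n (A : 'M[R]_(k, n)) i j : `|A i j| <= `|A|.
Proof.
rewrite [leRHS]/Num.norm /= mx_normrE.
by apply/bigmax_geP; right => /=; exists (i, j).
Qed.

Lemma mx_norm_mulmx k n l (A : 'M[R]_(k, n)) (B : 'M[R]_(n, l)) :
  `|A *m B| <= n%:R * (`|A| * `|B|).
Proof.
apply: mx_norm_le_entries => [|i j]; first by rewrite !mulr_ge0.
rewrite mxE (le_trans (ler_norm_sum _ _ _))//.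
apply: (@le_trans _ _ (\sum_(p < n) (`|A| * `|B|))).
  by apply: ler_sum => p _; rewrite normrM ler_pM ?le_mx_norm.
by rewrite sumr_const card_ord mulr_natl.
Qed.

Lemma mx_norm_row_mx k n l (A : 'M[R]_(k, n)) (B : 'M[R]_(k, l)) :
  `|row_mx A B| = Num.max `|A| `|B|.
Proof.
apply/eqP; rewrite eq_le; apply/andP; split.
  apply: mx_norm_le_entries => [|i j]; first by rewrite le_max normr_ge0.
  rewrite mxE; case: (fintype.split j) => s.
    by rewrite le_max le_mx_norm.
  by rewrite le_max le_mx_norm orbT.
rewrite ge_max; apply/andP; split; apply: mx_norm_le_entries => // i j.
  by rewrite -(row_mxEl A B) le_mx_norm.
by rewrite -(row_mxEr A B) le_mx_norm.
Qed.

Lemma mx_norm_lsubmx k n l (A : 'M[R]_(k, n + l)) : `|lsubmx A| <= `|A|.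
Proof. by rewrite -{2}[A]hsubmxK mx_norm_row_mx le_max lexx. Qed.

Lemma mx_norm_rsubmx k n l (A : 'M[R]_(k, n + l)) : `|rsubmx A| <= `|A|.
Proof. by rewrite -{2}[A]hsubmxK mx_norm_row_mx le_max lexx orbT. Qed.

Lemma enorm_ge0 k n (A : 'M[R]_(k, n)) : 0 <= enorm A.
Proof. exact: sqrtr_ge0. Qed.

Lemma enormsq_ge0 k n (A : 'M[R]_(k, n)) : 0 <= \sum_i \sum_j A i j ^+ 2.
Proof. by apply: sumr_ge0 => i _; apply: sumr_ge0 => j _; rewrite sqr_ge0. Qed.

Lemma enorm_sqr k n (A : 'M[R]_(k, n)) :
  enorm A ^+ 2 = \sum_i \sum_j A i j ^+ 2.
Proof. by rewrite sqr_sqrtr// enormsq_ge0. Qed.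

Lemma mx_norm_le_enorm k n (A : 'M[R]_(k, n)) : `|A| <= enorm A.
Proof.
apply: mx_norm_le_entries => [|i j]; first exact: enorm_ge0.
rewrite -(ler_pXn2r (n := 2))// ?nnegrE ?enorm_ge0//.
rewrite enorm_sqr real_normK ?num_real// (bigD1 i)//= (bigD1 j)//=.
rewrite -addrA lerDl addr_ge0//; first by apply: sumr_ge0 => ? _; rewrite sqr_ge0.
by apply: sumr_ge0 => ? _; apply: sumr_ge0 => ? _; rewrite sqr_ge0.
Qed.

Lemma enorm_le_mx_norm k n (A : 'M[R]_(k, n)) : enorm A <= (k * n)%:R * `|A|.
Proof.
rewrite -(ler_pXn2r (n := 2))// ?nnegrE ?enorm_ge0 ?mulr_ge0//.
rewrite enorm_sqr.
apply: (@le_trans _ _ (\sum_(i < k) \sum_(j < n) `|A| ^+ 2)).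
  apply: ler_sum => i _; apply: ler_sum => j _.
  by rewrite -[_ ^+ 2]real_normK ?num_real// lerXn2r ?nnegrE ?le_mx_norm.
rewrite !sumr_const !card_ord -mulrnA exprMn -[leLHS]mulr_natl mulnC.
rewrite ler_wpM2r ?sqr_ge0// -natrX ler_nat.
by case: (k * n)%N => // p; rewrite -[X in (X <= _)%N]muln1 leq_mul.
Qed.

Lemma enorm0 k n : enorm (0 : 'M[R]_(k, n)) = 0.
Proof.
apply/eqP; rewrite eq_le enorm_ge0 andbT.
by apply: le_trans (enorm_le_mx_norm _) _; rewrite normr0 mulr0.
Qed.

Lemma enorm_tr k n (A : 'M[R]_(k, n)) : enorm A^T = enorm A.
Proof.
congr Num.sqrt; rewrite exchange_big.
by apply: eq_bigr => i _; apply: eq_bigr => j _; rewrite mxE.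
Qed.

Lemma enormZ k n (a : R) (A : 'M[R]_(k, n)) : enorm (a *: A) = `|a| * enorm A.
Proof.
rewrite /enorm -sqrtr_sqr -sqrtrM ?sqr_ge0//; congr Num.sqrt.
rewrite mulr_sumr; apply: eq_bigr => i _; rewrite mulr_sumr.
by apply: eq_bigr => j _; rewrite mxE exprMn.
Qed.

Lemma enorm_eq0 k n (A : 'M[R]_(k, n)) : enorm A = 0 -> A = 0.
Proof.
by move=> A0; apply/eqP; rewrite -normr_le0 -A0 mx_norm_le_enorm.
Qed.

(** Cauchy-Schwarz: the quadratic [A * t ^+ 2 - 2 * C * t + B] is a sum of squares, and its value at
    [t = C / A] is [(A * B - C ^+ 2) / A]. *)
Lemma sqr_sum_mul_le (I : finType) (a b : I -> R) :
  (\sum_i a i * b i) ^+ 2 <= (\sum_i a i ^+ 2) * (\sum_i b i ^+ 2).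
Proof.
set A := \sum_i a i ^+ 2; set B := \sum_i b i ^+ 2; set C := \sum_i a i * b i.
have A0 : 0 <= A by apply: sumr_ge0 => i _; rewrite sqr_ge0.
have q t : 0 <= A * t ^+ 2 - 2 * C * t + B.
  suff -> : A * t ^+ 2 - 2 * C * t + B = \sum_i (a i * t - b i) ^+ 2.
    by apply: sumr_ge0 => i _; rewrite sqr_ge0.
  rewrite /A /B /C (mulr_sumr _ _ _ 2) !mulr_suml -sumrB -big_split /=.
  by apply: eq_bigr => i _; ring.
have [A_eq0|A_neq0] := eqVneq A 0.
  have C0 : C = 0.
    rewrite /C big1// => i _.
    have /eqP := A_eq0; rewrite psumr_eq0 => [/allP/(_ i)|? _]; last exact: sqr_ge0.
    by rewrite mem_index_enum => /(_ isT)/= ; rewrite sqrf_eq0 => /eqP ->; rewrite mul0r.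
  by rewrite C0 A_eq0 expr0n mul0r.
have A_gt0 : 0 < A by rewrite lt_def A_neq0.
have := q (C / A).
have -> : A * (C / A) ^+ 2 - 2 * C * (C / A) + B = (A * B - C ^+ 2) / A by field.
by rewrite pmulr_lge0 ?invr_gt0// subr_ge0.
Qed.

Lemma ler_enormD k n (A B : 'M[R]_(k, n)) : enorm (A + B) <= enorm A + enorm B.
Proof.
rewrite -(ler_pXn2r (n := 2))// ?nnegrE ?addr_ge0 ?enorm_ge0//.
rewrite sqrrD !enorm_sqr !pair_big/=.
set a := \sum_p A _ _ ^+ 2; set b := \sum_p B _ _ ^+ 2.
have -> : \sum_(p : 'I_k * 'I_n) (A + B) p.1 p.2 ^+ 2 =
    a + (\sum_p A p.1 p.2 * B p.1 p.2) *+ 2 + b.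
  by rewrite -sumrMnl -!big_split/=; apply: eq_bigr => p _; rewrite mxE sqrrD.
rewrite lerD2r lerD2l lerMn2r /=.
apply: le_trans (ler_norm _) _.
rewrite -(ler_pXn2r (n := 2))// ?nnegrE ?mulr_ge0 ?enorm_ge0//.
rewrite real_normK ?num_real// exprMn !enorm_sqr !pair_big/=.
exact: (sqr_sum_mul_le (fun p => A p.1 p.2) (fun p => B p.1 p.2)).
Qed.

Lemma enorm_mulmx k n l (A : 'M[R]_(k, n)) (B : 'M[R]_(n, l)) :
  enorm (A *m B) <= enorm A * enorm B.
Proof.
rewrite -(ler_pXn2r (n := 2))// ?nnegrE ?mulr_ge0 ?enorm_ge0//.
rewrite exprMn !enorm_sqr [X in _ <= _ * X]exchange_big /= mulr_suml.
apply: ler_sum => i _; rewrite mulr_sumr; apply: ler_sum => j _.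
by rewrite mxE sqr_sum_mul_le.
Qed.

Definition opset k n (A : 'M[R]_(k, n)) : set R :=
  [set enorm (A *m v) | v in [set v : 'cV[R]_n | enorm v <= 1]].

Lemma opset_has_sup k n (A : 'M[R]_(k, n)) : has_sup (opset A).
Proof.
split; first by exists (enorm (A *m (0 : 'cV_n))), (0 : 'cV_n) => //=; rewrite enorm0.
exists (enorm A) => _ [v /= v1 <-]; apply: le_trans (enorm_mulmx _ _) _.
by rewrite ler_piMr ?enorm_ge0.
Qed.

Lemma opnorm_ge0 k n (A : 'M[R]_(k, n)) : 0 <= opnorm A.
Proof.
have := sup_upper_bound (opset_has_sup A).
move=> /(_ (enorm (A *m (0 : 'cV_n)))); rewrite mulmx0 enorm0; apply.
by exists 0; rewrite /= ?mulmx0 enorm0.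
Qed.

Lemma enorm_mul_opnorm k n (A : 'M[R]_(k, n)) (v : 'cV[R]_n) :
  enorm (A *m v) <= opnorm A * enorm v.
Proof.
have [v0|v0] := eqVneq (enorm v) 0.
  by rewrite (enorm_eq0 v0) mulmx0 !enorm0 mulr0.
have vp : 0 < enorm v by rewrite lt_def v0 enorm_ge0.
rewrite -ler_pdivrMr//.
have -> : enorm (A *m v) / enorm v = enorm (A *m ((enorm v)^-1 *: v)).
  by rewrite -scalemxAr enormZ ger0_norm ?invr_ge0 ?enorm_ge0// mulrC.
apply: (sup_upper_bound (opset_has_sup A)).
exists ((enorm v)^-1 *: v) => //=.
by rewrite enormZ ger0_norm ?invr_ge0 ?enorm_ge0// mulVf.
Qed.

Lemma opnorm_le k n (A : 'M[R]_(k, n)) a :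
  0 <= a -> (forall v : 'cV[R]_n, enorm (A *m v) <= a * enorm v) -> opnorm A <= a.
Proof.
move=> a0 Aa; apply: ge_sup; first by have [] := opset_has_sup A.
by move=> _ [v /= v1 <-]; rewrite (le_trans (Aa v))// ler_piMr.
Qed.

Lemma opnorm_le_enorm k n (A : 'M[R]_(k, n)) : opnorm A <= enorm A.
Proof. by apply: opnorm_le => [|v]; [exact: enorm_ge0|exact: enorm_mulmx]. Qed.

Lemma opnorm_le_mx_norm k n (A : 'M[R]_(k, n)) : opnorm A <= (k * n)%:R * `|A|.
Proof. exact: le_trans (opnorm_le_enorm _) (enorm_le_mx_norm _). Qed.

Lemma opnormM k n l (A : 'M[R]_(k, n)) (B : 'M[R]_(n, l)) :
  opnorm (A *m B) <= opnorm A * opnorm B.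
Proof.
apply: opnorm_le => [|v]; first by rewrite mulr_ge0 ?opnorm_ge0.
rewrite -mulmxA (le_trans (enorm_mul_opnorm _ _))// -mulrA.
by rewrite ler_wpM2l ?opnorm_ge0 ?enorm_mul_opnorm.
Qed.

Lemma ler_opnormD k n (A B : 'M[R]_(k, n)) : opnorm (A + B) <= opnorm A + opnorm B.
Proof.
apply: opnorm_le => [|v]; first by rewrite addr_ge0 ?opnorm_ge0.
by rewrite mulmxDl (le_trans (ler_enormD _ _))// mulrDl lerD ?enorm_mul_opnorm.
Qed.

Lemma enormN k n (A : 'M[R]_(k, n)) : enorm (- A) = enorm A.
Proof. by rewrite -scaleN1r enormZ normrN1 mul1r. Qed.

Lemma opnormZ k n a (A : 'M[R]_(k, n)) : opnorm (a *: A) <= `|a| * opnorm A.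
Proof.
apply: opnorm_le => [|v]; first by rewrite mulr_ge0 ?opnorm_ge0.
by rewrite -scalemxAl enormZ -mulrA ler_wpM2l// enorm_mul_opnorm.
Qed.

Lemma entry_le_opnorm k n (A : 'M[R]_(k, n)) i j : `|A i j| <= opnorm A.
Proof.
have -> : A i j = (A *m (delta_mx j 0 : 'cV_n)) i 0 by rewrite -colE mxE.
rewrite (le_trans (le_mx_norm _ _ _))// (le_trans (mx_norm_le_enorm _))//.
rewrite (le_trans (enorm_mul_opnorm _ _))// ler_piMr ?opnorm_ge0//.
rewrite -(ler_pXn2r (n := 2))// ?nnegrE ?enorm_ge0//.
rewrite enorm_sqr expr1n (bigD1 j)//= !big_ord1 mxE !eqxx expr1n.
rewrite big1 ?addr0// => p /negbTE pj.
by rewrite big_ord1 mxE pj expr0n.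
Qed.

Lemma mx_norm_le_opnorm k n (A : 'M[R]_(k, n)) : `|A| <= opnorm A.
Proof.
by apply: mx_norm_le_entries => [|i j]; [exact: opnorm_ge0|exact: entry_le_opnorm].
Qed.

Lemma opnorm_dist k n (A B : 'M[R]_(k, n)) :
  `|opnorm A - opnorm B| <= (k * n)%:R * `|A - B|.
Proof.
wlog AB : A B / opnorm B <= opnorm A.
  move=> H; have [/H//|/ltW/H] := leP (opnorm B) (opnorm A).
  by rewrite distrC (distrC B).
rewrite ger0_norm ?subr_ge0// lerBlDr.
rewrite -{1}[A](subrK B) (le_trans (ler_opnormD _ _))// lerD2r.
exact: opnorm_le_mx_norm.
Qed.

(* [invmx] is the identity on singular matrices, hence the hypothesis. *)
Lemma conorm_mul n (A : 'M[R]_n) (v : 'cV[R]_n) :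
  A \in unitmx -> conorm A * enorm v <= enorm (A *m v).
Proof.
move=> Au; rewrite /conorm.
have : enorm (invmx A *m (A *m v)) <= opnorm (invmx A) * enorm (A *m v).
  exact: enorm_mul_opnorm.
(* The norm of the inverse vanishes only in dimension 0; the convention [0^-1 = 0] then makes the
   bound trivial. *)
rewrite mulKmx//; have [->|o0] := eqVneq (opnorm (invmx A)) 0.
  by rewrite mul0r invr0 mul0r enorm_ge0.
by rewrite -ler_pdivrMl// lt_def o0 opnorm_ge0.
Qed.

End MatrixNorms.

(** * Jacobians and C^1 maps *)

Section HasJacobian.
Variable R : realType.

Lemma near_dist_lt (V : normedModType R) (v : V) e :
  0 < e -> \forall u \near v, `|u - v| < e.
Proof. by move=> e0; apply/nbhs_normP; exists e => // u /=; rewrite distrC. Qed.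

Lemma near_distP (V : normedModType R) (v : V) (P : V -> Prop) :
  (\forall u \near v, P u) <-> exists2 e, 0 < e & forall u, `|u - v| < e -> P u.
Proof.
split=> [/nbhs_normP[e e0 H]|[e e0 H]].
  by exists e => // u uv; apply: H; rewrite /= distrC.
by apply: filterS (near_dist_lt v e0).
Qed.

Lemma near_imp2 (V : normedModType R) (v : V) (P Q S : V -> Prop) :
  (\forall u \near v, P u) -> (\forall u \near v, Q u) ->
  (forall u, P u -> Q u -> S u) -> \forall u \near v, S u.
Proof. by move=> Pv Qv PQS; apply: filterS2 Pv Qv. Qed.

Lemma near_imp3 (V : normedModType R) (v : V) (P Q S T : V -> Prop) :
  (\forall u \near v, P u) -> (\forall u \near v, Q u) -> (\forall u \near v, S u) ->
  (forall u, P u -> Q u -> S u -> T u) -> \forall u \near v, T u.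
Proof. by move=> Pv Qv Sv PQST; apply: filterS3 Pv Qv Sv. Qed.

Lemma continuous_distP (V W : normedModType R) (f : V -> W) (v : V) :
  {for v, continuous f} <->
  forall e, 0 < e -> exists2 d, 0 < d & forall u, `|u - v| < d -> `|f u - f v| <= e.
Proof.
split=> [/cvgrPdist_le H e e0|H].
  have /near_distP[d d0 D] := H e e0.
  by exists d => // u uv; rewrite distrC; apply: D.
apply/cvgrPdist_le => e e0; have [d d0 D] := H e e0.
by apply/near_distP; exists d => // u uv; rewrite distrC; apply: D.
Qed.

(* Row vectors: the increment multiplies the matrix from the left, as in
   [jacobian]. *)
Definition has_jac n k (f : 'rV[R]_n -> 'rV[R]_k) (v : 'rV[R]_n) (M : 'M[R]_(n, k)) :=
  forall e, 0 < e -> \forall u \near v, `|f u - f v - (u - v) *m M| <= e * `|u - v|.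

Lemma continuous_linear_rV n k (M : 'M[R]_(n, k)) : continuous (mulmxr M : 'rV[R]_n -> 'rV[R]_k).
Proof.
move=> v; apply/continuous_distP => e e0.
have C0 : 0 < n%:R * `|M| + 1 by rewrite ltr_wpDl// mulr_ge0.
exists (e / (n%:R * `|M| + 1)) => [|u uv].
  by rewrite divr_gt0.
rewrite /= -mulmxBl (le_trans (mx_norm_mulmx _ _))//.
rewrite mulrCA (le_trans (ler_wpM2r _ (ltW uv))) ?mulr_ge0//.
rewrite mulrAC ler_pdivrMr// ler_wpM2l ?(ltW e0)//.
by rewrite lerDl.
Qed.

(** The bridge from the epsilon form of the derivative, used throughout, to [differentiable] and
    [jacobian], in which the submanifolds and diffeomorphisms of the theorem are stated. *)
Lemma has_jac_diff n k (f : 'rV[R]_n -> 'rV[R]_k) v M :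
  has_jac f v M -> differentiable f v /\ jacobian f v = M.
Proof.
move=> fM.
have cM := @continuous_linear_rV n k M.
have E : f \o shift v = cst (f v) + mulmxr M +o_ (0 : 'rV[R]_n) id.
  apply/eqaddoP => e e0.
  have /near_distP[d d0 H] := fM e e0.
  apply: (proj2 (near_distP (0 : 'rV[R]_n) _)); exists d => // h; rewrite subr0 => hd.
  have := H (h + v); rewrite addrK => /(_ hd).
  by rewrite !fctE /= opprD addrA.
have dE : 'd f v = mulmxr M :> (_ -> _) := diff_unique cM E.
split; first by apply/diff_locallyP; rewrite dE; split.
apply/row_matrixP => i; rewrite /jacobian !rowE mul_rV_lin1.
by rewrite -[LHS]/('d f v (delta_mx 0 i)) dE.
Qed.

Lemma cvg_entriesP T (F : set_system T) {FF : Filter F} k n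
    (A : T -> 'M[R]_(k, n)) (a : 'M[R]_(k, n)) :
  A @ F --> a <-> forall i j, (fun x => A x i j) @ F --> a i j.
Proof.
split=> [Aa i j|Aa].
  exact: (cvg_comp A (fun M : 'M[R]_(k, n) => M i j) Aa
    (@coord_continuous R k n i j a)).
apply/cvgrPdist_le => e e0.
have H (p : 'I_k * 'I_n) : \forall x \near F, `|a p.1 p.2 - A x p.1 p.2| <= e.
  by case: p => i j; have /cvgrPdist_le := Aa i j; apply.
have HF := @filter_forall _ _ (fun p x => `|a p.1 p.2 - A x p.1 p.2| <= e) F FF H.
apply: filterS HF => x Hx.
by apply: mx_norm_le_entries (ltW e0) _ => i j; rewrite !mxE; apply: (Hx (i, j)).
Qed.

Lemma cvg_sum_seq T (F : set_system T) {FF : Filter F} (I : Type) (r : seq I)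
    (f : I -> T -> R) (a : I -> R) :
  (forall i, f i @ F --> a i) ->
  (fun x => \sum_(i <- r) f i x) @ F --> \sum_(i <- r) a i.
Proof.
move=> fa; elim: r => [|i r IH].
  rewrite big_nil; under eq_fun do rewrite big_nil.
  exact: cvg_cst.
rewrite big_cons; under eq_fun do rewrite big_cons.
exact: cvgD.
Qed.

Lemma cvg_mulmx T (F : set_system T) {FF : Filter F} k n l
    (A : T -> 'M[R]_(k, n)) (B : T -> 'M[R]_(n, l)) (a : 'M[R]_(k, n)) (b : 'M[R]_(n, l)) :
  A @ F --> a -> B @ F --> b -> (fun x => A x *m B x) @ F --> a *m b.
Proof.
move=> /cvg_entriesP Aa /cvg_entriesP Bb; apply/cvg_entriesP => i j.
rewrite mxE; under eq_fun do rewrite mxE.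
by apply: cvg_sum_seq => p; apply: cvgM.
Qed.

Lemma cvg_row_mx T (F : set_system T) {FF : Filter F} k n l
    (A : T -> 'M[R]_(k, n)) (B : T -> 'M[R]_(k, l)) (a : 'M[R]_(k, n)) (b : 'M[R]_(k, l)) :
  A @ F --> a -> B @ F --> b -> (fun x => row_mx (A x) (B x)) @ F --> row_mx a b.
Proof.
move=> /cvg_entriesP Aa /cvg_entriesP Bb; apply/cvg_entriesP => i j.
rewrite mxE; under eq_fun do rewrite mxE.
by case: (fintype.split j) => p; [exact: Aa|exact: Bb].
Qed.

Lemma cvg_lsubmx T (F : set_system T) {FF : Filter F} k n l
    (A : T -> 'M[R]_(k, n + l)) (a : 'M[R]_(k, n + l)) :
  A @ F --> a -> (fun x => lsubmx (A x)) @ F --> lsubmx a.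
Proof.
move=> /cvg_entriesP Aa; apply/cvg_entriesP => i j.
by rewrite mxE; under eq_fun do rewrite mxE; apply: Aa.
Qed.

Lemma cvg_rsubmx T (F : set_system T) {FF : Filter F} k n l
    (A : T -> 'M[R]_(k, n + l)) (a : 'M[R]_(k, n + l)) :
  A @ F --> a -> (fun x => rsubmx (A x)) @ F --> rsubmx a.
Proof.
move=> /cvg_entriesP Aa; apply/cvg_entriesP => i j.
by rewrite mxE; under eq_fun do rewrite mxE; apply: Aa.
Qed.

Lemma cvg_trmx T (F : set_system T) {FF : Filter F} k n
    (A : T -> 'M[R]_(k, n)) (a : 'M[R]_(k, n)) :
  A @ F --> a -> (fun x => (A x)^T) @ F --> a^T.
Proof.
move=> /cvg_entriesP Aa; apply/cvg_entriesP => i j.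
by rewrite mxE; under eq_fun do rewrite mxE; apply: Aa.
Qed.

Lemma cvg_opnorm T (F : set_system T) {FF : Filter F} k n
    (A : T -> 'M[R]_(k, n)) (a : 'M[R]_(k, n)) :
  A @ F --> a -> (fun x => opnorm (A x)) @ F --> opnorm a.
Proof.
move=> /cvgrPdist_le Aa; apply/cvgrPdist_le => e e0.
have C0 : 0 < (k * n)%:R + 1 :> R by rewrite ltr_wpDl.
have := Aa (e / ((k * n)%:R + 1)); rewrite divr_gt0// => /(_ isT).
apply: filterS => x Ax; rewrite (le_trans (opnorm_dist _ _))//.
rewrite ler_pdivlMr// in Ax; apply: le_trans Ax.
by rewrite mulrC ler_wpM2l// lerDl.
Qed.

Lemma has_jac_near_eq n k (f g : 'rV[R]_n -> 'rV[R]_k) v M :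
  (\forall u \near v, f u = g u) -> has_jac f v M -> has_jac g v M.
Proof.
move=> fg fM e e0; have fgv := nbhs_singleton fg.
apply: (near_imp2 fg (fM e e0)) => u fgu.
by rewrite fgu fgv.
Qed.

Lemma has_jac_lip n k (f : 'rV[R]_n -> 'rV[R]_k) v M : has_jac f v M ->
  \forall u \near v, `|f u - f v| <= (n%:R * `|M| + 1) * `|u - v|.
Proof.
move=> fM; have := fM 1 ltr01; apply: filterS => u.
rewrite mul1r => H; rewrite -(subrK ((u - v) *m M) (f u - f v)).
rewrite (le_trans (ler_normD _ _))// addrC mulrDl mul1r lerD//.
by rewrite (le_trans (mx_norm_mulmx _ _))// mulrAC mulrA.
Qed.

Lemma has_jac_continuous n k (f : 'rV[R]_n -> 'rV[R]_k) v M :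
  has_jac f v M -> {for v, continuous f}.
Proof. by case/has_jac_diff => /differentiable_continuous. Qed.

Lemma has_jac_cst n k (a : 'rV[R]_k) (v : 'rV[R]_n) : has_jac (cst a) v 0.
Proof.
move=> e e0; apply/near_distP; exists 1 => // u _; rewrite /cst subrr mulmx0 subrr normr0.
by rewrite mulr_ge0// ltW.
Qed.

Lemma has_jac_mulmx n k (M : 'M[R]_(n, k)) v : has_jac (fun u => u *m M) v M.
Proof.
move=> e e0; apply/near_distP; exists 1 => // u _; rewrite mulmxBl subrr normr0.
by rewrite mulr_ge0// ltW.
Qed.

Lemma has_jac_id n (v : 'rV[R]_n) : has_jac id v 1%:M.
Proof.
have := has_jac_mulmx 1%:M v; apply: has_jac_near_eq.
by apply/near_distP; exists 1 => // u _; rewrite mulmx1.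
Qed.

Lemma has_jacD n k (f g : 'rV[R]_n -> 'rV[R]_k) v M N :
  has_jac f v M -> has_jac g v N -> has_jac (fun u => f u + g u) v (M + N).
Proof.
move=> fM gN e e0; have e20 : 0 < e / 2 by rewrite divr_gt0.
apply: (near_imp2 (fM _ e20) (gN _ e20)) => u Hf Hg.
have -> : f u + g u - (f v + g v) - (u - v) *m (M + N) =
  (f u - f v - (u - v) *m M) + (g u - g v - (u - v) *m N).
  rewrite mulmxDr; move: (_ *m M) (_ *m N) => A B.
  by apply/matrixP => i j; rewrite !mxE; ring.
by rewrite (le_trans (ler_normD _ _))// (splitr e) mulrDl lerD.
Qed.

Lemma has_jac_comp n k l (f : 'rV[R]_n -> 'rV[R]_k) (g : 'rV[R]_k -> 'rV[R]_l) v M N :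
  has_jac f v M -> has_jac g (f v) N -> has_jac (fun u => g (f u)) v (M *m N).
Proof.
move=> fM gN e e0.
set C := n%:R * `|M| + 1; set D := k%:R * `|N| + 1.
have C0 : 0 < C by rewrite ltr_wpDl// mulr_ge0.
have D0 : 0 < D by rewrite ltr_wpDl// mulr_ge0.
have e1 : 0 < e / 2 / C by rewrite !divr_gt0.
have e2 : 0 < e / 2 / D by rewrite !divr_gt0.
have gfN := has_jac_continuous fM (gN _ e1).
apply: (near_imp3 (has_jac_lip fM) (fM _ e2) gfN) => u Lf Hf Hg.
have -> : g (f u) - g (f v) - (u - v) *m (M *m N) =
  (g (f u) - g (f v) - (f u - f v) *m N) + (f u - f v - (u - v) *m M) *m N.
  by rewrite (mulmxBl (f u - f v)) addrA subrK mulmxA.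
rewrite (le_trans (ler_normD _ _))// (splitr e) mulrDl lerD//.
  apply: le_trans Hg _; rewrite -mulrA ler_wpM2l ?divr_ge0 ?(ltW e0)//.
  by rewrite ler_pdivrMl.
rewrite (le_trans (mx_norm_mulmx _ _))// mulrCA.
apply: le_trans (ler_wpM2r _ Hf) _; first by rewrite mulr_ge0.
rewrite mulrAC ler_wpM2r// mulrAC ler_pdivrMr// ler_wpM2l ?divr_ge0 ?(ltW e0)//.
by rewrite lerDl.
Qed.

Lemma has_jac_row_mx n k l (f : 'rV[R]_n -> 'rV[R]_k) (g : 'rV[R]_n -> 'rV[R]_l) v M N :
  has_jac f v M -> has_jac g v N ->
  has_jac (fun u => row_mx (f u) (g u)) v (row_mx M N).
Proof.
move=> fM gN e e0; apply: (near_imp2 (fM _ e0) (gN _ e0)) => u Hf Hg.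
rewrite mul_mx_row opp_row_mx add_row_mx opp_row_mx add_row_mx.
by rewrite mx_norm_row_mx ge_max Hf Hg.
Qed.

(** A scalar function is viewed as a 1 x 1 matrix, so that its derivative is a column [g] and the
    product rule is a matrix identity. The quadratic term is small since [s] is Lipschitz at [v] and
    [f] is continuous there. *)
Lemma has_jac_scale n k (s : 'rV[R]_n -> R) (f : 'rV[R]_n -> 'rV[R]_k) v g M :
  has_jac (fun u => (s u)%:M : 'rV_1) v g -> has_jac f v M ->
  has_jac (fun u => s u *: f u) v (g *m f v + s v *: M).
Proof.
move=> sg fM e e0.
set A := `|f v| + 1; set C := `|s v| + 1; set D := n%:R * `|g| + 1.
have A0 : 0 < A by rewrite ltr_wpDl.
have C0 : 0 < C by rewrite ltr_wpDl.
have D0 : 0 < D by rewrite ltr_wpDl// mulr_ge0.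
have e1 : 0 < e / 3 / A by rewrite !divr_gt0.
have e2 : 0 < e / 3 / C by rewrite !divr_gt0.
have e3 : 0 < e / 3 / D by rewrite !divr_gt0.
have fc : \forall u \near v, `|f u - f v| <= e / 3 / D.
  have /cvgrPdist_le := has_jac_continuous fM => /(_ _ e3).
  by apply: filterS => u; rewrite distrC.
have lip := near_imp2 fc (has_jac_lip sg) (fun u => @conj _ _).
apply: (near_imp3 lip (sg _ e1) (fM _ e2)) => u [Lf Ls] Hs Hf.
have -> : s u *: f u - s v *: f v - (u - v) *m (g *m f v + s v *: M) =
  ((s u)%:M - (s v)%:M - (u - v) *m g) *m f v + s v *: (f u - f v - (u - v) *m M)
   + ((s u)%:M - (s v)%:M) *m (f u - f v).
  move: (u - v) => w.
  rewrite mulmxDr -scalemxAr !mulmxBl !mul_scalar_mx mulmxA.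
  move: (w *m g *m f v) (w *m M) => p q.
  by apply/matrixP => i j; rewrite !mxE; ring.
have -> : e * `|u - v| = e / 3 * `|u - v| + e / 3 * `|u - v| + e / 3 * `|u - v|.
  by field.
rewrite (le_trans (ler_normD _ _))// lerD//.
  rewrite (le_trans (ler_normD _ _))// lerD//.
    rewrite (le_trans (mx_norm_mulmx _ _))// mul1r.
    apply: le_trans (ler_wpM2r _ Hs) _ => //.
    rewrite mulrAC ler_wpM2r// mulrAC ler_pdivrMr// ler_wpM2l ?divr_ge0 ?(ltW e0)//.
    by rewrite lerDl.
  rewrite mx_normZ; apply: le_trans (ler_wpM2l _ Hf) _ => //.
  rewrite mulrA ler_wpM2r// mulrC mulrAC ler_pdivrMr//.
  by rewrite ler_wpM2l ?divr_ge0 ?(ltW e0)// lerDl.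
rewrite (le_trans (mx_norm_mulmx _ _))// mul1r.
apply: le_trans (ler_pM _ _ Ls Lf) _ => //.
rewrite -/D (_ : D * _ * _ = e / 3 * `|u - v|)//.
by field; rewrite gt_eqF.
Qed.

End HasJacobian.

(** * Mean value inequalities and limits of C^1 maps *)

Section MeanValue.
Variable R : realType.

Lemma is_derive_distP (g : R -> R) (t d : R) :
  (forall e, 0 < e -> exists2 r, 0 < r &
     forall s, `|s - t| < r -> `|g s - g t - (s - t) * d| <= e * `|s - t|) ->
  is_derive t 1 g d.
Proof.
move=> H.
have : (h^-1 *: ((g \o shift t) (h *: 1) - g t) : R) @[h --> 0^'] --> d.
  apply/cvgrPdist_le => e e0; have [r r0 Hr] := H e e0.
  rewrite near_withinE; apply: (proj2 (near_distP (0 : R^o) _)).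
  exists r => // h; rewrite subr0 => hr h0.
  rewrite /= -[h *: 1]/(h * 1) mulr1; have := Hr (h + t); rewrite addrK => /(_ hr).
  move: (g (h + t) - g t) => X HX.
  have -> : d - h^-1 *: X = - (h^-1 * (X - h * d)).
    by rewrite mulrBr (mulKf h0) opprB.
  by rewrite normrN normrM normfV ler_pdivrMl ?normr_gt0// [leRHS]mulrC.
move=> cd; apply: DeriveDef; first by apply/cvg_ex; exists d.
exact: (cvg_lim (@Rhausdorff _) cd).
Qed.

Lemma is_derive_line n k (f : 'rV[R]_n -> 'rV[R]_k) (a w : 'rV[R]_n) M t j :
  has_jac f (a + t *: w) M ->
  is_derive t 1 (fun s => f (a + s *: w) 0 j) ((w *m M) 0 j).
Proof.
move=> fM; apply: is_derive_distP => e e0.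
have C0 : 0 < `|w| + 1 by rewrite ltr_wpDl.
have /near_distP[r r0 H] := fM (e / (`|w| + 1)) ltac:(by rewrite divr_gt0).
exists (r / (`|w| + 1)) => [|s st]; first by rewrite divr_gt0.
have stE : a + s *: w - (a + t *: w) = (s - t) *: w.
  by rewrite opprD addrACA subrr add0r scalerBl.
have sw : `|(s - t) *: w| <= `|s - t| * (`|w| + 1).
  by rewrite mx_normZ ler_wpM2l// lerDl.
have := H (a + s *: w); rewrite stE => /(_ _)/le_trans-/(_ _) F.
have : `|(f (a + s *: w) - f (a + t *: w) - (s - t) *: w *m M) 0 j| <=
   e / (`|w| + 1) * `|(s - t) *: w|.
  apply: le_trans (le_mx_norm _ _ _) _; apply: F => //.
  by apply: le_lt_trans sw _; rewrite -ltr_pdivlMr.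
rewrite -scalemxAl !mxE => /le_trans; apply.
rewrite mulrAC ler_pdivrMr// -mulrA ler_wpM2l// ltW//.
Qed.

Lemma mean_value_line n k (f : 'rV[R]_n -> 'rV[R]_k) (J : R -> 'M[R]_(n, k)) a b j :
  (forall t, 0 <= t <= 1 -> has_jac f (a + t *: (b - a)) (J t)) ->
  exists2 t, 0 <= t <= 1 & f b 0 j - f a 0 j = ((b - a) *m J t) 0 j.
Proof.
move=> H; pose g (t : R) : R := f (a + t *: (b - a)) 0 j.
have dg (t : R) : 0 <= t <= 1 -> is_derive t 1 g (((b - a) *m J t) 0 j).
  by move=> t01; apply: is_derive_line; apply: H.
have [|||t t01] := @MVT_segment R g (fun t => ((b - a) *m J t) 0 j) 0 1.
- exact: ler01.
- by move=> t; rewrite in_itv /= => /andP[t0 t1]; apply: dg; rewrite !ltW.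
- apply: derivable_within_continuous => t; rewrite in_itv /= => t01.
  by have /(@ex_derive) := dg t t01.
rewrite /g subr0 mulr1 scale1r scale0r addr0 (addrC a) subrK => E.
by exists t.
Qed.

(** The mean value theorem is applied to each coordinate, with its own intermediate point. The
    factor [n] is the price of the max norm in a matrix product. *)
Lemma mean_value_bound n k (f : 'rV[R]_n -> 'rV[R]_k) (J : R -> 'M[R]_(n, k)) a b C :
  (forall t, 0 <= t <= 1 -> has_jac f (a + t *: (b - a)) (J t) /\ `|J t| <= C) ->
  `|f b - f a| <= n%:R * (C * `|b - a|).
Proof.
move=> H.
have C0 : 0 <= C by have [_] := H 0 ltac:(by rewrite lexx ler01); apply: le_trans.
apply: mx_norm_le_entries => [|i j]; first by rewrite !mulr_ge0.
rewrite {i}ord1; have [t t01 E] := mean_value_line j (fun t t01 => proj1 (H t t01)).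
rewrite !mxE E; apply: le_trans (le_mx_norm _ _ _) _.
apply: le_trans (mx_norm_mulmx _ _) _; rewrite ler_wpM2l// mulrC.
by rewrite ler_wpM2r//; have [] := H t t01.
Qed.

Lemma mean_value_near n k (f : 'rV[R]_n -> 'rV[R]_k) (J : R -> 'M[R]_(n, k)) a b M C :
  (forall t, 0 <= t <= 1 -> has_jac f (a + t *: (b - a)) (J t) /\ `|J t - M| <= C) ->
  `|f b - f a - (b - a) *m M| <= n%:R * (C * `|b - a|).
Proof.
move=> H.
have -> : f b - f a - (b - a) *m M = (f b + b *m (- M)) - (f a + a *m (- M)).
  rewrite mulmxBl !mulmxN; move: (_ *m M) (a *m M) => A B.
  by apply/matrixP => i j; rewrite !mxE; ring.
apply: (mean_value_bound (J := fun t => J t - M)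
  (f := fun u => f u + u *m (- M))) => t t01.
have [fJ JC] := H t t01; split => //.
by apply: has_jacD => //; apply: has_jac_mulmx.
Qed.

(** [J] is a given function rather than [jacobian f], so that the derivatives of iterates can be
    defined by recursion. At a single [v] nothing forces [J] to be the derivative nearby; this comes
    from using the property on open sets. *)
Definition C1_at n k (f : 'rV[R]_n -> 'rV[R]_k) J v :=
  has_jac f v (J v) /\ {for v, continuous J}.

Lemma ball_segment n (p a b : 'rV[R]_n) r t : `|a - p| < r -> `|b - p| < r ->
  0 <= t <= 1 -> `|a + t *: (b - a) - p| < r.
Proof.
move=> ar br /andP[t0 t1].
have -> : a + t *: (b - a) - p = (1 - t) *: (a - p) + t *: (b - p).
  by apply/matrixP => i j; rewrite !mxE; ring.
rewrite (le_lt_trans (ler_normD _ _))// !mx_normZ !ger0_norm ?subr_ge0//.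
have [t1'|t1'] := ltrP t 1.
  apply: (@lt_le_trans _ _ ((1 - t) * r + t * r)); last by rewrite -mulrDl subrK mul1r.
  by apply: ltr_leD; [rewrite ltr_pM2l// subr_gt0|rewrite ler_wpM2l// ltW].
have -> : t = 1 by apply/eqP; rewrite eq_le t1.
by rewrite subrr mul0r add0r mul1r.
Qed.

(** Differentiation of a limit: the increment of [f] is compared with that of one fixed [f_ p],
    whose linearization is known. *)
Lemma C1_limit n k (U : set 'rV[R]_n) (f_ : nat -> 'rV[R]_n -> 'rV[R]_k)
    (J_ : nat -> 'rV[R]_n -> 'M[R]_(n, k)) f :
  open U -> (forall i v, U v -> C1_at (f_ i) (J_ i) v) ->
  (forall v, U v -> (fun i => f_ i v) @ \oo --> f v) ->
  (forall e, 0 < e -> exists N, forall i j v, (N <= i)%N -> (N <= j)%N -> U v ->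
     `|J_ i v - J_ j v| <= e) ->
  exists J, forall v, U v -> C1_at f J v.
Proof.
move=> oU fJ ff JC.
pose J v : 'M[R]_(n, k) := lim (J_ i v @[i --> \oo]).
have JJ v : U v -> J_ i v @[i --> \oo] --> J v.
  move=> Uv; apply: cauchy_cvg; apply: cauchy_exP => e e0.
  have [N HN] := JC (e / 2) ltac:(by rewrite divr_gt0).
  exists (J_ N v); exists N => // i /= Ni.
  rewrite /= -ball_normE /=; apply: le_lt_trans (HN N i v _ _ _) _ => //.
  by rewrite ltr_pdivrMr// ltr_pMr// ltr1n.
have JCl e : 0 < e -> exists N, forall i v, (N <= i)%N -> U v -> `|J v - J_ i v| <= e.
  move=> e0; have [N HN] := JC e e0; exists N => i v Ni Uv.
  have cv : `|J_ j v - J_ i v| @[j --> \oo] --> `|J v - J_ i v|.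
    by apply: cvg_norm; apply: cvgB (JJ v Uv) _; apply: cvg_cst.
  apply: (cvgr_to_le cv).
  by exists N => // j /= Nj; apply: HN.
exists J => v Uv; split; last first.
  apply/continuous_distP => e e0; have e30 : 0 < e / 3 by rewrite divr_gt0.
  have [N HN] := JCl _ e30; have [_ /continuous_distP/(_ _ e30)[d d0 Hd]] := fJ N v Uv.
  have /near_distP[r r0 Hr] := open_nbhs_nbhs (conj oU Uv).
  exists (Num.min d r) => [|u]; first by rewrite lt_min d0.
  rewrite lt_min => /andP[ud ur].
  have -> : J u - J v = (J u - J_ N u) + (J_ N u - J_ N v) + (J_ N v - J v).
    by rewrite !addrA !subrK.
  have -> : e = e / 3 + e / 3 + e / 3 by field.
  rewrite (le_trans (ler_normD _ _))// lerD//; last by rewrite distrC; apply: HN.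
  by rewrite (le_trans (ler_normD _ _))// lerD ?Hd//; apply: HN => //; apply: Hr.
move=> e e0; set e' := e / 3 / (n%:R + 1).
have n0 : 0 < n%:R + 1 :> R by rewrite ltr_wpDl.
have e'0 : 0 < e' by rewrite !divr_gt0.
have [N HN] := JC _ e'0; have [N' HN'] := JCl _ e'0.
pose p := maxn N N'.
have [/(_ (e / 3))] := fJ p v Uv; rewrite divr_gt0// => /(_ isT)/near_distP[d d0 Hd] _.
have /near_distP[r r0 Hr] := open_nbhs_nbhs (conj oU Uv).
apply/near_distP; exists (Num.min d r) => [|u]; first by rewrite lt_min d0.
rewrite lt_min => /andP[ud ur].
(* The bound is uniform in [j], hence it passes to the limit [j --> \oo] with [p] fixed. *)
have step j : (N <= j)%N -> `|(f_ j u - f_ p u) - (f_ j v - f_ p v)| <= e / 3 * `|u - v|.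
  move=> Nj; have := @mean_value_bound n k (fun w => f_ j w + (- 1%R) *: f_ p w)
    (fun t => J_ j (v + t *: (u - v)) + - J_ p (v + t *: (u - v))) v u e'.
  rewrite !scaleN1r => H; apply: (le_trans (H _)).
    move=> t t01; have Ut : U (v + t *: (u - v)).
      by apply: Hr; apply: ball_segment => //; rewrite subrr normr0.
    split; last by apply: HN => //; rewrite leq_maxl.
    have [fj _] := fJ j _ Ut; have [fp _] := fJ p _ Ut.
    apply: has_jacD => //.
    have := has_jac_comp fp (has_jac_mulmx (- 1%:M) _).
    rewrite mulmxN mulmx1; apply: has_jac_near_eq.
    by apply/near_distP; exists 1 => // w _; rewrite mulmxN mulmx1 scaleN1r.
  rewrite mulrA ler_wpM2r// /e' mulrCA ler_piMr ?divr_ge0 ?ltW//.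
  by rewrite ltr_pdivrMr// mul1r ltrDl.
have lim1 : `|(f_ j u - f_ p u) - (f_ j v - f_ p v)| @[j --> \oo] -->
    `|(f u - f_ p u) - (f v - f_ p v)|.
  apply: cvg_norm; apply: cvgB; (apply: cvgB; last exact: cvg_cst).
    by apply: ff; apply: Hr.
  exact: ff.
have A : `|(f u - f_ p u) - (f v - f_ p v)| <= e / 3 * `|u - v|.
  by apply: (cvgr_to_le lim1); exists N => // j /= Nj; apply: step.
have -> : f u - f v - (u - v) *m J v = ((f u - f_ p u) - (f v - f_ p v)) +
   (f_ p u - f_ p v - (u - v) *m J_ p v) + (u - v) *m (J_ p v - J v).
  rewrite mulmxBr; move: ((u - v) *m J_ p v) (_ *m J v) => X Y.
  by apply/matrixP => i j; rewrite !mxE; ring.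
have -> : e * `|u - v| = e / 3 * `|u - v| + e / 3 * `|u - v| + e / 3 * `|u - v|.
  by field.
rewrite (le_trans (ler_normD _ _))// lerD//.
  by rewrite (le_trans (ler_normD _ _))// lerD// Hd.
rewrite (le_trans (mx_norm_mulmx _ _))// mulrCA mulrC ler_wpM2r//.
have := HN' p v (leq_maxr _ _) Uv; rewrite distrC => /(ler_wpM2l (ler0n R n))/le_trans; apply.
by rewrite /e' mulrCA ler_piMr ?divr_ge0 ?ltW// ltr_pdivrMr// mul1r ltrDl.
Qed.

End MeanValue.

(** * Analytic functions *)

Section PowerSeries.
Variable R : realType.

Lemma sum_geometric_le (x : R) k N : 0 <= x <= 1 / 2 ->
  \sum_(k <= j < N) x ^+ j <= 2 * x ^+ k.
Proof.
move=> /andP[x0 x2]; have xk0 : 0 <= x ^+ k by rewrite exprn_ge0.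
have [kN|Nk] := leqP k N; last by rewrite big_geq ?mulr_ge0// ltnW.
rewrite -(subnKC kN); elim: (N - k)%N => [|n IH].
  by rewrite addn0 big_geq ?mulr_ge0.
suff : \sum_(k <= j < k + n.+1) x ^+ j <= 2 * x ^+ k - 2 * x ^+ (k + n.+1).
  by move=> /le_trans; apply; rewrite gerBl mulr_ge0// exprn_ge0.
elim: n.+1 => [|p IHp]; first by rewrite addn0 big_geq// subrr.
rewrite addnS big_nat_recr ?leq_addr//= (le_trans (lerD IHp (lexx _)))//.
have xp0 : 0 <= x ^+ (k + p) by rewrite exprn_ge0.
rewrite [X in _ <= _ - 2 * X]exprS; nra.
Qed.

Lemma cvg_series_term (u : R ^nat) : cvgn (series u) ->
  exists M, forall k, `|u k| <= M.
Proof.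
move=> /cvg_series_cvg_0/cvgP/cvg_seq_bounded[M [_ HM]].
by exists (M + 1) => k; apply: HM => //; rewrite ltrDl.
Qed.

(** Once the coefficients below [k] vanish, the [k]-th term dominates for small [t]: at [t = x * t0]
    the terms after it add up to at most [2 * M * x ^+ k.+1], where [M] bounds the terms at [t0].
    Dividing by [x ^+ k] and letting [x] tend to 0 gives the claim. *)
Lemma power_series_eq0 (c : nat -> R) t0 : 0 < t0 ->
  (forall t, 0 < t <= t0 -> series (fun k => t ^+ k * c k) @ \oo --> (0 : R)) ->
  forall k, c k = 0.
Proof.
move=> t0_gt0 cvg0 k; elim/ltn_ind: k => k IH.
have [M HM] : exists M, forall k, `|t0 ^+ k * c k| <= M.
  apply: cvg_series_term; apply: cvgP (cvg0 t0 _).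
  by rewrite t0_gt0 lexx.
have M0 : 0 <= M by apply: le_trans (HM 0%N).
have key x : 0 < x <= 1 / 2 -> `|t0 ^+ k * c k| <= 2 * M * x.
  move=> /andP[x0 x2].
  have xt : 0 < x * t0 <= t0 by rewrite mulr_gt0//= ger_pMl//; lra.
  have xk0 : 0 < x ^+ k by rewrite exprn_gt0.
  rewrite -(ler_pM2r xk0).
  have cv : `|(x * t0) ^+ k * c k - series (fun k => (x * t0) ^+ k * c k) N| @[N --> \oo]
       --> `|(x * t0) ^+ k * c k - 0|.
    by apply: cvg_norm; apply: cvgB (cvg0 _ xt); apply: cvg_cst.
  have -> : `|t0 ^+ k * c k| * x ^+ k = `|(x * t0) ^+ k * c k - 0|.
    by rewrite subr0 exprMn -mulrA [RHS]normrM (ger0_norm (ltW xk0)) mulrC.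
  apply: (cvgr_to_le cv); exists k.+1 => // N /= kN.
  rewrite /series /= (big_cat_nat (leq0n k.+1) kN) /= big_nat_recr//=
    big_nat_cond big1 ?add0r; last first.
    by move=> i /andP[/andP[_ ik] _]; rewrite IH// mulr0.
  rewrite opprD addrA subrr add0r normrN (le_trans (ler_norm_sum _ _ _))//.
  apply: (@le_trans _ _ (\sum_(k.+1 <= j < N) M * x ^+ j)).
    apply: ler_sum => j _; rewrite exprMn -mulrA normrM mulrC.
    by rewrite (ger0_norm (exprn_ge0 j (ltW x0))) ler_wpM2r ?exprn_ge0 ?(ltW x0).
  rewrite -mulr_sumr (_ : 2 * M * x * x ^+ k = M * (2 * x ^+ k.+1)) ?ler_wpM2l//; last first.
    by rewrite exprS; ring.
  by rewrite sum_geometric_le// ltW.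
have : `|t0 ^+ k * c k| <= 0.
  apply/ler_addgt0Pr => e e0; rewrite add0r.
  set x := Num.min (1 / 2) (e / (2 * M + 1)).
  have M1 : 0 < 2 * M + 1 by rewrite ltr_wpDl// mulr_ge0.
  have x0 : 0 < x by rewrite lt_min !divr_gt0.
  apply: le_trans (key x _) _; first by rewrite x0 ge_min lexx.
  apply: (@le_trans _ _ ((2 * M + 1) * x)); first by rewrite ler_wpM2r ?(ltW x0)// lerDl.
  by rewrite mulrC -ler_pdivlMr// ge_min lexx orbT.
by rewrite normr_le0 mulf_eq0 expf_eq0 (gt_eqF t0_gt0) andbF => /eqP.
Qed.

Lemma C1_atD n k (f g : 'rV[R]_n -> 'rV[R]_k) M N v : C1_at f M v -> C1_at g N v ->
  C1_at (fun u => f u + g u) (fun u => M u + N u) v.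
Proof.
move=> [fM cM] [gN cN]; split; first exact: has_jacD.
exact: (cvgD cM cN).
Qed.

Lemma C1_at_mulmx n k (M : 'M[R]_(n, k)) v : C1_at (fun u => u *m M) (cst M) v.
Proof. by split; [exact: has_jac_mulmx|exact: cst_continuous]. Qed.

Lemma C1_at_cst n k (a : 'rV[R]_k) (v : 'rV[R]_n) : C1_at (cst a) (cst 0) v.
Proof. by split; [exact: has_jac_cst|exact: cst_continuous]. Qed.

Lemma C1_at_comp n k l (f : 'rV[R]_n -> 'rV[R]_k) (g : 'rV[R]_k -> 'rV[R]_l) M N v :
  C1_at f M v -> C1_at g N (f v) ->
  C1_at (fun u => g (f u)) (fun u => M u *m N (f u)) v.
Proof.
move=> [fM cM] [gN cN]; split; first exact: has_jac_comp.
exact: (cvg_mulmx cM (continuous_comp (has_jac_continuous fM) cN)).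
Qed.

Lemma C1_at_row_mx n k l (f : 'rV[R]_n -> 'rV[R]_k) (g : 'rV[R]_n -> 'rV[R]_l) M N v :
  C1_at f M v -> C1_at g N v ->
  C1_at (fun u => row_mx (f u) (g u)) (fun u => row_mx (M u) (N u)) v.
Proof.
move=> [fM cM] [gN cN]; split; first exact: has_jac_row_mx.
exact: (cvg_row_mx cM cN).
Qed.

Lemma has_jac_scalar_continuous n (s : 'rV[R]_n -> R) g v :
  has_jac (fun u => (s u)%:M : 'rV_1) v g -> {for v, continuous s}.
Proof.
move=> /has_jac_continuous/cvg_entriesP/(_ 0 0); rewrite mxE eqxx mulr1n.
by under eq_fun do rewrite mxE eqxx mulr1n.
Qed.

Lemma C1_at_scale n k (s : 'rV[R]_n -> R) (f : 'rV[R]_n -> 'rV[R]_k) g M v :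
  C1_at (fun u => (s u)%:M : 'rV_1) g v -> C1_at f M v ->
  C1_at (fun u => s u *: f u) (fun u => g u *m f u + s u *: M u) v.
Proof.
move=> [sg cg] [fM cM]; split; first exact: has_jac_scale.
have cs := has_jac_scalar_continuous sg.
apply: (cvgD _ (cvgZ cs cM)).
exact: (cvg_mulmx cg (has_jac_continuous fM)).
Qed.

Lemma C1_at_near_eq n k (f g : 'rV[R]_n -> 'rV[R]_k) M N v :
  (\forall u \near v, f u = g u) -> (\forall u \near v, M u = N u) ->
  C1_at f M v -> C1_at g N v.
Proof.
move=> fg MN [fM cM]; split.
  by rewrite -(nbhs_singleton MN); apply: has_jac_near_eq fM.
change (N @ v --> N v); rewrite -(nbhs_singleton MN).
exact: cvg_trans (near_eq_cvg MN) cM.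
Qed.

(** The bounds of a monomial of degree [k] and of its derivative, in a form stable under products.
    Multiplying the derivative by [rho] avoids the exponent [k - 1], which would be wrong for
    [k = 0]. *)
Definition mono_bound n k (f : 'rV[R]_n -> R) := exists J : 'rV[R]_n -> 'M[R]_(n, 1),
  (forall v, C1_at (fun u => (f u)%:M : 'rV_1) J v) /\
  forall rho v, `|v| <= rho -> `|f v| <= rho ^+ k /\ `|J v| * rho <= k%:R * rho ^+ k.

Lemma eq_mono_bound n k (f g : 'rV[R]_n -> R) :
  f =1 g -> mono_bound k f -> mono_bound k g.
Proof. by move=> /funext ->. Qed.

Lemma mono_bound1 n : @mono_bound n 0 (fun=> 1).
Proof.
exists (cst 0); split; first by move=> v; apply: C1_at_cst.
by move=> rho v _; rewrite expr0 normr1 normr0 !mul0r.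
Qed.

Lemma mono_boundM n k l (f g : 'rV[R]_n -> R) :
  mono_bound k f -> mono_bound l g -> mono_bound (k + l) (fun u => f u * g u).
Proof.
move=> [J [fJ Jb]] [K [gK Kb]].
exists (fun u => J u *m (g u)%:M + f u *: K u); split => [v|rho v vr].
  apply: C1_at_near_eq (C1_at_scale (fJ v) (gK v)).
    by apply/near_distP; exists 1 => // u _; rewrite scale_scalar_mx.
  by apply/near_distP; exists 1.
have r0 : 0 <= rho by apply: le_trans vr.
have [fr Jr] := Jb _ _ vr; have [gr Kr] := Kb _ _ vr.
rewrite exprD natrD mulrDl; split; first by rewrite normrM ler_pM.
apply: (@le_trans _ _ ((`|J v| * `|g v| + `|f v| * `|K v|) * rho)).
  rewrite ler_wpM2r// (le_trans (ler_normD _ _))// lerD ?mx_normZ//.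
  by rewrite mul_mx_scalar mx_normZ mulrC.
rewrite mulrDl lerD//.
  by rewrite mulrAC [leRHS]mulrA ler_pM ?mulr_ge0.
by rewrite -mulrA [leRHS]mulrCA ler_pM ?mulr_ge0.
Qed.

Lemma mono_bound_coord n (i : 'I_n) : @mono_bound n 1 (fun u => u 0 i).
Proof.
exists (cst (delta_mx i 0)); split => [v|rho v vr].
  apply: C1_at_near_eq (C1_at_mulmx (delta_mx i 0 : 'M[R]_(n, 1)) v).
    apply/near_distP; exists 1 => // u _; rewrite -colE.
    by apply/matrixP => a b; rewrite !ord1 !mxE eqxx mulr1n.
  by apply/near_distP; exists 1.
have r0 : 0 <= rho by apply: le_trans vr.
rewrite expr1; split; first exact: le_trans (le_mx_norm _ _ _) vr.
rewrite ler_wpM2r//; apply: mx_norm_le_entries => // a b.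
by rewrite mxE; case: (_ && _); rewrite ?normr1 ?normr0.
Qed.

Lemma mono_bound_prod n k (alpha : 'I_n -> 'I_k) (r : seq 'I_n) :
  mono_bound (\sum_(i <- r) alpha i) (fun v => \prod_(i <- r) v 0 i ^+ alpha i).
Proof.
elim: r => [|i r IH].
  rewrite big_nil; apply: eq_mono_bound (mono_bound1 n) => v.
  by rewrite big_nil.
rewrite big_cons.
apply: (@eq_mono_bound _ _ (fun v => v 0 i ^+ alpha i * \prod_(i <- r) v 0 i ^+ alpha i)).
  by move=> v; rewrite big_cons.
apply: mono_boundM IH; elim: (alpha i : nat) => [|p IHp].
  exact: eq_mono_bound (mono_bound1 n).
rewrite -add1n; apply: (@eq_mono_bound _ _ (fun v => v 0 i * v 0 i ^+ p)).
  by move=> v; rewrite add1n exprS.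
by apply: mono_boundM => //; exact: mono_bound_coord.
Qed.

(** The sum of the absolute values of the coefficients is, by [homog_part_const], what multiplies
    [r ^+ k] in the convergent series of the definition of analyticity. *)
Lemma homog_part_C1 n k (a : forall k, {ffun 'I_n -> 'I_k.+1} -> R) :
  exists J : 'rV[R]_n -> 'M[R]_(n, 1),
  (forall v, C1_at (fun u => (homog_part a k u)%:M : 'rV_1) J v) /\
  forall rho v, `|v| <= rho -> `|J v| * rho <=
    (\sum_(alpha : {ffun 'I_n -> 'I_k.+1} | (\sum_i alpha i == k)%N) `|a k alpha|)
      * (k%:R * rho ^+ k).
Proof.
rewrite /homog_part; elim: (index_enum _) => [|al r [J [HJ Jb]]].
  exists (cst 0); split => [v|rho v vr].
    under eq_fun do rewrite big_nil.
    by rewrite -(_ : (0 : 'rV_1) = 0%:M); [exact: C1_at_cst|rewrite raddf0].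
  by rewrite big_nil normr0 !mul0r.
rewrite big_cons; case: ifP => [/eqP alk|alk]; last first.
  by exists J; split=> [v|//]; under eq_fun do rewrite big_cons alk.
have [K [HK Kb]] := mono_bound_prod al (index_enum _).
rewrite alk in Kb.
exists (fun v => a k al *: K v + J v); split => [v|rho v vr].
  have HaK : C1_at (fun u => (a k al * \prod_i u 0 i ^+ al i)%:M : 'rV_1)
      (fun v => a k al *: K v) v.
    have := C1_at_comp (HK v) (C1_at_mulmx (a k al)%:M _).
    apply: C1_at_near_eq; apply/near_distP; exists 1 => // u _.
      by rewrite -scalar_mxM mulrC.
    by rewrite /cst mul_mx_scalar.
  apply: C1_at_near_eq (C1_atD HaK (HJ v)); apply/near_distP; exists 1 => // u _.
  by rewrite big_cons alk eqxx raddfD.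
have r0 : 0 <= rho by apply: le_trans vr.
rewrite mulrDl (le_trans (ler_wpM2r r0 (ler_normD _ _)))// mulrDl lerD ?Jb//.
by rewrite mx_normZ -mulrA ler_wpM2l//; have [] := Kb _ _ vr.
Qed.

Lemma homog_partZ n (a : forall k, {ffun 'I_n -> 'I_k.+1} -> R) k t v :
  homog_part a k (t *: v) = t ^+ k * homog_part a k v.
Proof.
rewrite /homog_part mulr_sumr; apply: eq_bigr => al /eqP alk.
rewrite mulrCA; congr (_ * _).
have -> : t ^+ k = \prod_i t ^+ al i by rewrite prodrXr alk.
by rewrite -big_split/=; apply: eq_bigr => i _; rewrite mxE exprMn.
Qed.

Lemma homog_part_const n (a : forall k, {ffun 'I_n -> 'I_k.+1} -> R) k t :
  homog_part a k (const_mx t) = t ^+ k *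
  \sum_(alpha : {ffun 'I_n -> 'I_k.+1} | (\sum_i alpha i == k)%N) a k alpha.
Proof.
rewrite /homog_part mulr_sumr; apply: eq_bigr => al /eqP alk.
rewrite mulrC; congr (_ * _).
have -> : t ^+ k = \prod_i t ^+ al i by rewrite prodrXr alk.
by apply: eq_bigr => i _; rewrite mxE.
Qed.

(** On the ball of half the radius the derivatives of the homogeneous parts are dominated by the
    terms [h k] of the absolutely convergent series, so [C1_limit] applies to the partial sums. *)
Lemma analytic_C1 n (g : 'rV[R]_n -> R) p : analytic_at g p ->
  exists2 rho, 0 < rho & exists J, forall u, `|u - p| < rho ->
    C1_at (fun u => (g u)%:M : 'rV_1) J u.
Proof.
move=> [r [r0 [a [ca ga]]]].
pose H k := homog_part a k.
pose h k := homog_part (fun k alpha => `|a k alpha|) k (const_mx r).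
have /choice[K HK] k := homog_part_C1 k a.
set rho := r / 2; have rho0 : 0 < rho by rewrite divr_gt0.
have Kh k v : `|v| < rho -> `|K k v| <= rho^-1 * h k.
  move=> /ltW vr; have [_ /(_ rho v vr)] := HK k.
  rewrite -ler_pdivlMr// => /le_trans; apply; rewrite mulrC ler_wpM2l ?invr_ge0 ?(ltW rho0)//.
  rewrite /h homog_part_const /= [leLHS]mulrC. rewrite ler_wpM2r ?sumr_ge0//.
  (* Halving the radius gains [2 ^ k], which absorbs the factor [k] of the derivative. *)
  rewrite /rho expr_div_n mulrCA ler_piMr ?exprn_ge0 ?(ltW r0)//.
  rewrite ler_pdivrMr ?exprn_gt0// mul1r -natrX ler_nat.
  by rewrite ltnW// ltn_expl.
pose f_ N (v : 'rV[R]_n) : 'rV[R]_1 := (series (H ^~ v) N)%:M.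
pose J_ N v := series (K ^~ v) N.
have C1f N v : C1_at (f_ N) (J_ N) v.
  rewrite /f_ /J_ /series /=; elim: N => [|N IH].
    apply: C1_at_near_eq (C1_at_cst 0 v); apply/near_distP; exists 1 => // u _.
      by rewrite big_geq// raddf0.
    by rewrite big_geq.
  apply: C1_at_near_eq (C1_atD IH (proj1 (HK N) v));
    apply/near_distP; exists 1 => // u _.
    by rewrite [in RHS]big_nat_recr//= raddfD.
  by rewrite [in RHS]big_nat_recr.
pose U := [set v : 'rV[R]_n | `|v| < rho].
have oU : open U.
  rewrite openE => v Uv; apply: (proj2 (near_distP v _)).
  exists (rho - `|v|); first by rewrite subr_gt0.
  move=> u; rewrite ltrBrDr => uv; apply: le_lt_trans uv.
  by rewrite -{1}(subrK v u) ler_normD.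
have := @C1_limit R n 1 U f_ J_ (fun v => (g (p + v))%:M) oU (fun i v _ => C1f i v).
case.
- move=> v Uv; apply/cvg_entriesP => i j; rewrite !ord1 mxE eqxx mulr1n.
  under eq_fun do rewrite mxE eqxx mulr1n.
  apply: ga; apply: lt_trans Uv _; rewrite /rho ltr_pdivrMr// ltr_pMr// ltr1n//.
- move=> e e0; have er : 0 < e * rho / 2 by rewrite !mulr_gt0.
  have /cvgrPdist_le/(_ _ er)[N _ HN] := ca.
  exists N => i j v; wlog ij : i j / (i <= j)%N.
    move=> W Ni Nj Uv; have [/W|/ltnW/W] := leqP i j; first exact.
    by rewrite distrC; apply.
  move=> Ni Nj Uv; rewrite distrC /J_ sub_series_geq//.
  rewrite (le_trans (ler_norm_sum _ _ _))//.
  apply: (@le_trans _ _ (\sum_(i <= k < j) rho^-1 * h k)).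
    by apply: ler_sum => k _; apply: Kh.
  rewrite -mulr_sumr mulrC ler_pdivrMr//.
  have -> : \sum_(i <= k < j) h k = series h j - series h i by rewrite sub_series_geq.
  have := HN i Ni; have := HN j Nj => /=; rewrite -/h => Hj Hi.
  apply: le_trans (ler_norm _) _.
  rewrite -(subrK (limn (series h)) (series h j)) -addrA.
  rewrite (le_trans (ler_normD _ _))// (splitr (e * rho)) lerD//.
  by rewrite distrC.
move=> J HJ; exists rho => //; exists (fun u => J (u - p)) => u up.
have shiftC1 : C1_at (fun u : 'rV[R]_n => u *m 1%:M + cst (- p) u) (fun=> 1%:M + 0) u.
  exact: C1_atD (C1_at_mulmx _ _) (C1_at_cst _ _).
have Uu : U (u *m 1%:M + cst (- p) u) by rewrite /U /= mulmx1.
apply: C1_at_near_eq (C1_at_comp shiftC1 (HJ _ Uu)); apply/near_distP; exists 1 => // w _.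
  by rewrite /cst mulmx1 addrC subrK.
by rewrite addr0 mul1mx /cst mulmx1.
Qed.

End PowerSeries.

(** * Extending independence of z from a cone to a neighborhood *)

Section AnalyticContinuation.
Variable R : realType.

Definition homog_line n (a : forall k, {ffun 'I_n -> 'I_k.+1} -> R) k
    (u v : 'rV[R]_n) : {poly R} :=
  \sum_(alpha : {ffun 'I_n -> 'I_k.+1} | (\sum_i alpha i == k)%N)
    a k alpha *: \prod_i (u 0 i *: 'X + (v 0 i)%:P) ^+ alpha i.

Lemma horner_homog_line n a k (u v : 'rV[R]_n) s :
  (homog_line a k u v).[s] = homog_part a k (s *: u + v).
Proof.
rewrite /homog_line /homog_part horner_sum; apply: eq_bigr => al _.
rewrite hornerZ horner_prod; congr (_ * _); apply: eq_bigr => i _.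
by rewrite horner_exp hornerD hornerZ hornerX hornerC !mxE mulrC.
Qed.

Lemma poly_eq0_large (p : {poly R}) s0 : (forall s, s0 < s -> p.[s] = 0) -> p = 0.
Proof.
move=> p0; apply/eqP; apply: contraT => pn0.
have := max_poly_roots pn0 (rs := [seq s0 + i.+1%:R | i <- iota 0 (size p)]).
rewrite size_map size_iota ltnn; apply.
  by apply/allP => _ /mapP[i _ ->]; rewrite /root p0// ltrDl ltr0n.
rewrite map_inj_uniq ?iota_uniq// => i j /addrI/eqP.
by rewrite eqr_nat eqSS => /eqP.
Qed.

Definition flat k l (v : 'rV[R]_(k + l)) : 'rV[R]_(k + l) := row_mx (lsubmx v) 0.

Lemma flat_norm k l (v : 'rV[R]_(k + l)) : `|flat v| <= `|v|.
Proof. by rewrite /flat mx_norm_row_mx normr0 max_l// mx_norm_lsubmx. Qed.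

Lemma flatZ k l t (v : 'rV[R]_(k + l)) : flat (t *: v) = t *: flat v.
Proof. by rewrite /flat scale_row_mx scaler0 linearZ. Qed.

Lemma flatD k l (u v : 'rV[R]_(k + l)) : flat (u + v) = flat u + flat v.
Proof. by rewrite /flat add_row_mx addr0 linearD. Qed.

(* If a power series does not depend on the last coordinates on an open cone of
   directions, then neither do its homogeneous parts, which are polynomials. *)
Lemma analytic_flat k l (g : 'rV[R]_(k + l) -> R) p u d :
  analytic_at g p -> 0 < d ->
  (forall v t, `|v - u| < d -> 0 < t <= 1 -> g (p + t *: v) = g (p + t *: flat v)) ->
  exists2 r, 0 < r & forall v, `|v| < r -> g (p + v) = g (p + flat v).
Proof.
move=> [r [r0 [a [_ ga]]]] d0 gcone.
pose P j v := homog_part a j v - homog_part a j (flat v).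
have cvP v t : `|t *: v| < r -> series (fun j => t ^+ j * P j v) @ \oo -->
    g (p + t *: v) - g (p + t *: flat v).
  move=> tv.
  have tfv : `|t *: flat v| < r by rewrite -flatZ (le_lt_trans (flat_norm _)).
  have -> : series (fun j => t ^+ j * P j v) =
      series (fun j => homog_part a j (t *: v)) \-
      series (fun j => homog_part a j (t *: flat v)).
    apply/funext => N; rewrite /series /= -sumrB.
    by apply: eq_bigr => j _; rewrite !homog_partZ -mulrBr.
  exact: cvgB (ga _ tv) (ga _ tfv).
have PZ s w j : P j (s *: w) = s ^+ j * P j w.
  by rewrite /P flatZ !homog_partZ mulrBr.
(* For [v] in the cone, [g] takes the same value at [p + t *: v] and [p + t *: flat v], so the power
   series in [t] with coefficients [P j v] vanishes for small [t > 0]. *)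
have Pcone v j : `|v - u| < d -> P j v = 0.
  move=> vu; have v1 : 0 < `|v| + 1 by rewrite ltr_wpDl.
  apply: (@power_series_eq0 R (fun j => P j v) (Num.min 1 (r / 2 / (`|v| + 1)))).
    by rewrite lt_min ltr01 !divr_gt0.
  move=> t /andP[t0]; rewrite le_min => /andP[t1 tr].
  rewrite -[X in _ --> X](subrr (g (p + t *: v))) [X in _ --> _ - X](gcone v t) ?t0//.
  apply: cvP; rewrite mx_normZ (gtr0_norm t0).
  apply: (@le_lt_trans _ _ (t * (`|v| + 1))); first by rewrite ler_pM2l// lerDl.
  rewrite ler_pdivlMr// in tr; apply: le_lt_trans tr _.
  by rewrite ltr_pdivrMr// ltr_pMr// ltr1n.
have P0 v j : P j v = 0.
  pose q := homog_line a j u v - homog_line a j (flat u) (flat v).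
  have qE s : q.[s] = P j (s *: u + v).
    by rewrite /q hornerD hornerN !horner_homog_line /P flatD flatZ.
  have -> : P j v = q.[0] by rewrite qE scale0r add0r.
  suff -> : q = 0 by rewrite horner0.
  (* For large [s] the point [s *: u + v] is a multiple of [u + s^-1 *: v], which lies in the cone.
     By homogeneity [q] vanishes at all large [s], hence everywhere, in particular at 0. *)
  apply: (@poly_eq0_large q (`|v| / d)) => s sv.
  have s0 : 0 < s by apply: le_lt_trans sv; rewrite divr_ge0// ltW.
  have sE : s *: u + v = s *: (u + s^-1 *: v).
    by rewrite scalerDr scalerA mulfV ?gt_eqF// scale1r.
  rewrite qE sE PZ Pcone ?mulr0// addrC addKr mx_normZ gtr0_norm ?invr_gt0//.
  by rewrite ltr_pdivrMr// in sv; rewrite ltr_pdivrMl.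
exists r => // v vr; apply/eqP; rewrite -subr_eq0; apply/eqP.
have := cvP v 1; rewrite !scale1r => /(_ vr) => c1.
have c0 : series (fun j => 1 ^+ j * P j v) @ \oo --> (0 : R).
  rewrite (_ : series _ = fun=> 0); first exact: cvg_cst.
  by apply/funext => N; rewrite /series /= big1// => j _; rewrite P0 mulr0.
exact: cvg_unique c1 c0.
Qed.

End AnalyticContinuation.

(** * Bump functions *)

Section Bump.
Variable R : realType.

(** Squaring makes the positive part continuously differentiable, and C^1 is all the regularity
    asked of a cut-off here. *)
Definition sqpos (t : R) : R := Num.max 0 t ^+ 2.

Lemma sqpos_taylor x y : `|sqpos y - sqpos x - (y - x) * (2 * Num.max 0 x)| <= (y - x) ^+ 2.
Proof.
have := sqr_ge0 (y - x); rewrite /sqpos !expr2.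
have [x0|x0] := leP 0 x; have [y0|y0] := leP 0 y => yx0;
  rewrite ler_norml; apply/andP; split; nra.
Qed.

Lemma sqpos_C1 n (s : 'rV[R]_n -> R) J v :
  C1_at (fun u => (s u)%:M : 'rV_1) J v ->
  C1_at (fun u => (sqpos (s u))%:M : 'rV_1) (fun u => (2 * Num.max 0 (s u)) *: J u) v.
Proof.
move=> [sJ cJ].
pose B (w : 'rV[R]_1) : 'rV[R]_1 := (sqpos (w 0 0))%:M.
have BJ (w : 'rV[R]_1) : has_jac B w (2 * Num.max 0 (w 0 0))%:M.
  move=> e e0; apply/near_distP; exists e => // u uw.
  have -> : B u - B w - (u - w) *m (2 * Num.max 0 (w 0 0))%:M =
    (sqpos (u 0 0) - sqpos (w 0 0) - (u 0 0 - w 0 0) * (2 * Num.max 0 (w 0 0)))%:M.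
    rewrite /B mul_mx_scalar; apply/matrixP => i j.
    by rewrite !ord1 !mxE eqxx !mulr1n [in RHS]mulrC.
  apply: mx_norm_le_entries => [|i j]; first by rewrite mulr_ge0// ltW.
  rewrite !ord1 mxE eqxx mulr1n (le_trans (sqpos_taylor _ _))//.
  have uwE : `|u 0 0 - w 0 0| <= `|u - w|.
    by have := le_mx_norm (u - w) 0 0; rewrite !mxE.
  rewrite -real_normK ?num_real// expr2 ler_pM// ltW//.
  exact: le_lt_trans uwE uw.
have cs := has_jac_scalar_continuous sJ; split.
  have := has_jac_comp sJ (BJ _); rewrite mul_mx_scalar mxE eqxx mulr1n.
  by apply: has_jac_near_eq; apply/near_distP; exists 1 => // u _; rewrite /B mxE eqxx mulr1n.
apply: (cvgZ _ cJ); apply: (cvgM (cvg_cst _)).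
have cmax : {for s v, continuous (Num.max 0 : R -> R)}.
  apply/cvgrPdist_le => e e0; near=> t.
  have : `|s v - t| <= e by near: t; apply: cvgr_dist_le.
  rewrite !ler_norml; have [x0|x0] := leP 0 (s v); have [y0|y0] := leP 0 t; lra.
exact: (continuous_comp cs cmax).
Unshelve. all: by end_near. Qed.

Definition sqdist n (p u : 'rV[R]_n) : R := \sum_i (u 0 i - p 0 i) ^+ 2.

Lemma sqdist_C1 n (p : 'rV[R]_n) :
  exists J, forall v, C1_at (fun u => (sqdist p u)%:M : 'rV_1) J v.
Proof.
rewrite /sqdist; elim: (index_enum _) => [|i r [J HJ]].
  exists (cst 0) => v; apply: C1_at_near_eq (C1_at_cst 0 v);
    apply/near_distP; exists 1 => // u _.
  by rewrite big_nil raddf0.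
have [K [HK _]] := mono_bound_coord R i.
have HKp v : C1_at (fun u => (u 0 i - p 0 i)%:M : 'rV_1) (fun u => K u + 0) v.
  apply: C1_at_near_eq (C1_atD (HK v) (C1_at_cst (- p 0 i)%:M v));
    apply/near_distP; exists 1 => // u _.
  by rewrite raddfD.
exists (fun u => ((K u + 0) *m (u 0 i - p 0 i)%:M + (u 0 i - p 0 i) *: (K u + 0)) + J u) => v.
apply: C1_at_near_eq (C1_atD (C1_at_scale (HKp v) (HKp v)) (HJ v));
  apply/near_distP; exists 1 => // u _.
by rewrite scale_scalar_mx big_cons -raddfD.
Qed.

Lemma sqdist_norm n (p u : 'rV[R]_n) : `|u - p| ^+ 2 <= sqdist p u.
Proof.
have -> : sqdist p u = enorm (u - p) ^+ 2.
  by rewrite enorm_sqr big_ord1; apply: eq_bigr => i _; rewrite !mxE.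
by rewrite lerXn2r ?nnegrE ?enorm_ge0// mx_norm_le_enorm.
Qed.

Lemma bump_sum n (rho : 'rV[R]_n -> R) (r : seq 'rV[R]_n) :
  (forall p, p \in r -> 0 < rho p) ->
  exists s J, [/\ forall v, C1_at (fun u => (s u)%:M : 'rV_1) J v,
    forall u, 0 <= s u,
    forall p u, p \in r -> sqdist p u < rho p ^+ 2 / 2 -> 1 <= s u &
    forall u, (forall p, p \in r -> rho p < `|u - p|) -> s u = 0 /\ J u = 0].
Proof.
elim: r => [_|p r IH r0].
  exists (fun=> 0), (cst 0); split => // v.
  apply: C1_at_near_eq (C1_at_cst 0 v); apply/near_distP; exists 1 => // u _.
  by rewrite raddf0.
have [q qr|s [J [HJ s0 s1 sz]]] := IH; first by apply: r0; rewrite inE qr orbT.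
have [K HK] := sqdist_C1 p.
have rp : 0 < rho p by apply: r0; rewrite inE eqxx.
(* With this [k] the argument [2 - k * sqdist p u] is at least 1 where the squared distance is at
   most half of [rho p ^+ 2], and at most 0 outside the ball of radius [rho p]. *)
pose k := 2 / rho p ^+ 2; have k0 : 0 < k by rewrite divr_gt0// exprn_gt0.
have Hl v : C1_at (fun u => (2 - k * sqdist p u)%:M : 'rV_1) (fun u => 0 + K u *m (- k)%:M) v.
  apply: C1_at_near_eq (C1_atD (C1_at_cst 2%:M v) (C1_at_comp (HK v) (C1_at_mulmx (- k)%:M _)));
    apply/near_distP; exists 1 => // u _.
  by rewrite -scalar_mxM -raddfD /= mulrN mulrC.
exists (fun u => sqpos (2 - k * sqdist p u) + s u),
  (fun u => (2 * Num.max 0 (2 - k * sqdist p u)) *: (0 + K u *m (- k)%:M) + J u); split.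
- move=> v; apply: C1_at_near_eq (C1_atD (sqpos_C1 (Hl v)) (HJ v));
    apply/near_distP; exists 1 => // u _.
  by rewrite -raddfD.
- by move=> u; rewrite addr_ge0 ?sqr_ge0.
- move=> q u; rewrite inE => /orP[/eqP->|qr] qu; last first.
    by rewrite (le_trans (s1 q u qr qu))// lerDr sqr_ge0.
  rewrite -[leLHS]addr0 lerD// /sqpos.
  have : k * sqdist p u <= 1.
    rewrite /k mulrAC ler_pdivrMr ?exprn_gt0// mul1r.
    by move: qu; rewrite ltr_pdivlMr// mulrC => /ltW.
  move=> ku; rewrite max_r; last by lra.
  by rewrite expr2; nra.
- move=> u Hu; have [q qr|-> ->] := sz u; first by apply: Hu; rewrite inE qr orbT.
  suff m0 : Num.max 0 (2 - k * sqdist p u) = 0.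
    by rewrite /sqpos m0 expr0n mulr0 scale0r !addr0.
  rewrite max_l// subr_le0 /k mulrAC ler_pdivlMr ?exprn_gt0// ler_wpM2l//.
  apply: le_trans (sqdist_norm _ _).
  rewrite lerXn2r ?nnegrE ?(ltW rp)//.
  by apply/ltW/Hu; rewrite inE eqxx.
Qed.

Lemma bump_function n (K N : set 'rV[R]_n) : compact K -> open N -> K `<=` N ->
  exists chi J (C : set 'rV[R]_n), [/\ forall v, C1_at (fun u => (chi u)%:M : 'rV_1) J v,
    forall u, 0 <= chi u <= 1,
    compact C /\ C `<=` N,
    forall u, ~ C u -> chi u = 0 /\ J u = 0 &
    forall u, K u -> \forall v \near u, chi v = 1].
Proof.
move=> cK oN KN.
have /choice[rho Hrho] (p : 'rV[R]_n) : exists r : R, 0 < r /\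
    (K p -> forall u, `|u - p| <= r -> N u).
  have [Kp|nKp] := pselect (K p); last by exists 1; split.
  have /near_distP[r r0 Hr] := open_nbhs_nbhs (conj oN (KN p Kp)).
  exists (r / 2); split => [|_ u ur]; first by rewrite divr_gt0.
  by apply: Hr; apply: le_lt_trans ur _; rewrite ltr_pdivrMr// ltr_pMr// ltr1n.
pose V p := [set u : 'rV[R]_n | sqdist p u < rho p ^+ 2 / 2].
have oV p : open (V p).
  have [J HJ] := sqdist_C1 p.
  rewrite openE => u Vu; have [/has_jac_scalar_continuous cs _] := HJ u.
  exact: (cvgr_lt _ cs _ Vu).
have sq0 p : sqdist p p = 0 by rewrite /sqdist big1// => i _; rewrite subrr expr0n.
have : cover_compact K by rewrite -compact_cover.
move=> /(_ _ K V (fun p _ => oV p)) [|D DK KD].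
  by move=> p Kp; exists p => //; rewrite /V /= sq0 divr_gt0// exprn_gt0; have [] := Hrho p.
have [p _|s [J [HJ s0 s1 sz]]] := @bump_sum n rho (finmap.enum_fset D).
  by have [] := Hrho p.
have K1 v : C1_at (fun u => (1 - s u)%:M : 'rV_1) (fun u => 0 + J u *m (- 1)%:M) v.
  apply: C1_at_near_eq (C1_atD (C1_at_cst 1%:M v) (C1_at_comp (HJ v) (C1_at_mulmx (- 1)%:M _)));
    apply/near_distP; exists 1 => // u _.
  by rewrite -scalar_mxM -raddfD /= mulrN1.
pose J1 u := (2 * Num.max 0 (1 - s u)) *: (0 + J u *m (- 1)%:M).
pose B p := [set u : 'rV[R]_n | `|u - p| <= rho p].
(* This profile of [s] stays between 0 and 1, vanishes with [s], and is constantly 1 where [s >= 1].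
   The support lies in a finite union of closed balls contained in [N]. *)
exists (fun u => 1 - sqpos (1 - s u)), (fun u => 0 + J1 u *m (- 1)%:M),
  (\big[setU/set0]_(p <- finmap.enum_fset D) B p); split.
- move=> v; apply: C1_at_near_eq (C1_atD (C1_at_cst 1%:M v)
     (C1_at_comp (sqpos_C1 (K1 v)) (C1_at_mulmx (- 1)%:M _)));
    apply/near_distP; exists 1 => // u _.
  by rewrite -scalar_mxM -raddfD /= mulrN1.
- move=> u; have := s0 u; rewrite /sqpos; have [/= x0|x0] := leP 0 (1 - s u); nra.
- split.
    apply: bigsetU_compact => p _; apply: bounded_closed_compact.
      exists (`|p| + rho p); split; first exact: num_real.
      move=> x xr u /= up; apply: le_trans (ltW xr).
      rewrite -[u](subrK p) addrC (le_trans (ler_normD _ _))// lerD//.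
    have -> : B p = (fun u : 'rV[R]_n => `|u - p|) @^-1` [set x : R | x <= rho p].
      by [].
    apply: closed_comp; last exact: closed_le.
    move=> u _; apply/continuous_distP => e e0; exists e => // v vu.
    by have := ler_dist_dist (v - p) (u - p); rewrite opprB addrA subrK => /le_trans;
      apply; exact: ltW.
  move=> u; rewrite -bigcup_seq => -[p pD]; have [_ H] := Hrho p; apply: H.
  by have := DK p pD; rewrite inE.
- move=> u Cu; have [p pD|su Ju] := sz u.
    rewrite ltNge; apply: contra_notN Cu => up.
    by rewrite -bigcup_seq; exists p.
  by rewrite /J1 su Ju /sqpos subr0 max_r// expr1n subrr mul0mx addr0 scaler0 mul0mx addr0.
- move=> u Ku; have [p pD Vu] := KD u Ku.
  have := open_nbhs_nbhs (conj (oV p) Vu); apply: filterS => v Vv.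
  by rewrite /sqpos max_l ?expr0n ?subr0// subr_le0; apply: s1 pD Vv.
Qed.

End Bump.

(** * Invariant sections *)

Section Compactness.
Variable R : realType.

(** A Lebesgue number, obtained from the near-covering form of compactness with the radius as the
    second variable. *)
Lemma compact_uniform_near (V : normedModType R) (K : set V) (P : V -> Prop) :
  compact K -> (forall w, K w -> \forall u \near w, P u) ->
  exists2 e, 0 < e & forall w u, K w -> `|u - w| < e -> P u.
Proof.
move=> /compact_near_coveringP cK KP.
have H : \forall e \near (0 : R)^'+, K `<=` [set w | forall u, `|u - w| < e -> P u].
  apply: cK => w Kw; have /near_distP[r r0 Hr] := KP w Kw.
  have r20 : 0 < r / 2 by rewrite divr_gt0.
  exists ([set w' | `|w' - w| < r / 2], [set e | e < r / 2]).
    split; first exact: near_dist_lt.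
    exact: nbhs_right_lt.
  move=> [w' e] /= [ww' er] u uw'; apply: Hr.
  rewrite -(subrK w' u) -addrA (le_lt_trans (ler_normD _ _))//.
  by rewrite (splitr r) ltrD// (lt_trans uw').
have [e [e0 He]] : exists e, 0 < e /\ K `<=` [set w | forall u, `|u - w| < e -> P u].
  near (0 : R)^'+ => e; exists e; split; first by near: e; exact: nbhs_right_gt.
  by near: e.
by exists e => // w u Kw; apply: He.
Unshelve. all: by end_near. Qed.

Lemma compact_bound (V : topologicalType) k n (C : set V) (f : V -> 'M[R]_(k, n)) :
  compact C -> (forall u, C u -> {for u, continuous f}) ->
  exists2 b, 0 <= b & forall u, C u -> `|f u| <= b.
Proof.
move=> cC fc.
have : compact (f @` C).
  apply: continuous_compact => //; apply: continuous_in_subspaceT => u /set_mem.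
  exact: fc.
move=> /compact_bounded[M [_ HM]]; exists (`|M| + 1); first by rewrite addr_ge0.
by move=> u Cu; apply: (HM (`|M| + 1)); rewrite ?ltr_pwDr ?ler_norm//; exists u.
Qed.

Lemma lsubmx_continuous k l (w : 'rV[R]_(k + l)) :
  {for w, continuous (@lsubmx R 1 k l)}.
Proof.
apply/continuous_distP => e e0; exists e => // u uw.
by rewrite -linearB (le_trans (mx_norm_lsubmx _))// ltW.
Qed.

(** Derivatives act on row vectors here, hence are transposes of the matrices [Dmx]; this is the
    operator norm of the linear map they stand for. *)
Definition opn k n (A : 'M[R]_(k, n)) := opnorm A^T.

Lemma opn_ge0 k n (A : 'M[R]_(k, n)) : 0 <= opn A.
Proof. exact: opnorm_ge0. Qed.

Lemma opnM k n l (A : 'M[R]_(k, n)) (B : 'M[R]_(n, l)) : opn (A *m B) <= opn A * opn B.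
Proof. by rewrite /opn trmx_mul mulrC opnormM. Qed.

Lemma opnD k n (A B : 'M[R]_(k, n)) : opn (A + B) <= opn A + opn B.
Proof. by rewrite /opn raddfD ler_opnormD. Qed.

Lemma opnZ k n a (A : 'M[R]_(k, n)) : opn (a *: A) <= `|a| * opn A.
Proof. by rewrite /opn linearZ opnormZ. Qed.

Lemma mx_norm_tr k n (A : 'M[R]_(k, n)) : `|A^T| = `|A|.
Proof.
apply/eqP; rewrite eq_le; apply/andP; split; apply: mx_norm_le_entries => // i j.
  by rewrite mxE le_mx_norm.
by have := le_mx_norm A^T j i; rewrite mxE.
Qed.

Lemma norm_le_opn k n (A : 'M[R]_(k, n)) : `|A| <= opn A.
Proof. by rewrite -mx_norm_tr mx_norm_le_opnorm. Qed.

Lemma opn_le_norm k n (A : 'M[R]_(k, n)) : opn A <= (n * k)%:R * `|A|.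
Proof. by rewrite -mx_norm_tr opnorm_le_mx_norm. Qed.

Lemma mx_norm_usubmx k l n (A : 'M[R]_(k + l, n)) : `|usubmx A| <= `|A|.
Proof. by apply: mx_norm_le_entries => // i j; rewrite mxE le_mx_norm. Qed.

Lemma mx_norm_dsubmx k l n (A : 'M[R]_(k + l, n)) : `|dsubmx A| <= `|A|.
Proof. by apply: mx_norm_le_entries => // i j; rewrite mxE le_mx_norm. Qed.

Lemma cvg_opn T (F : set_system T) {FF : Filter F} k n
    (A : T -> 'M[R]_(k, n)) (a : 'M[R]_(k, n)) :
  A @ F --> a -> (fun x => opn (A x)) @ F --> opn a.
Proof. by move=> Aa; apply: cvg_opnorm; apply: cvg_trmx. Qed.

Lemma cvg_dsubmx T (F : set_system T) {FF : Filter F} k l n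
    (A : T -> 'M[R]_(k + l, n)) (a : 'M[R]_(k + l, n)) :
  A @ F --> a -> (fun x => dsubmx (A x)) @ F --> dsubmx a.
Proof.
move=> /cvg_entriesP Aa; apply/cvg_entriesP => i j.
by rewrite mxE; under eq_fun do rewrite mxE; apply: Aa.
Qed.

End Compactness.

(** * Convergence of the derivatives of the iterates *)

Section FiberContraction.
Variable R : realType.

Lemma geometric_small (q a b : R) : 0 <= q < 1 -> 0 < a ->
  exists k0, forall k, (k0 <= k)%N -> q ^+ k * b <= a.
Proof.
move=> /andP[q0 q1] a0.
have cv : (fun k => q ^+ k * b) @ \oo --> (0 * b : R).
  apply: cvgM; last exact: cvg_cst.
  by apply: cvg_expr; rewrite ger0_norm.
rewrite mul0r in cv; have /cvgrPdist_le/(_ a a0)[k _ Hk] := cv.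
exists k => l kl; have := Hk l kl; rewrite /= sub0r normrN; apply: le_trans.
exact: ler_norm.
Qed.

Variables (n m : nat) (C : set 'rV[R]_n) (G : 'rV[R]_n -> 'rV[R]_n).
Variables (Phi : nat -> 'rV[R]_n -> 'M[R]_(n, m)) (Jpsi : 'rV[R]_n -> 'M[R]_(n, m)).
Hypothesis Phi_out : forall k u, ~ C u -> Phi k.+1 u = Jpsi u.

(** The recursion is followed along [u], [G u], and so on. It ends at index [k1] or when the orbit
    leaves [C], where the derivative is that of [psi]; meanwhile a bound [M >= 4 * C0] reproduces
    itself, as [C0 + 3 / 4 * M <= M]. *)
Lemma fiber_bounded k1 C0 b0 b1 :
  (forall u, C u -> opn (Phi k1 (G u)) <= b0) ->
  (forall u, C u -> opn (Jpsi (G u)) <= b1) ->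
  (forall k u, (k1 <= k)%N -> C u -> opn (Phi k.+1 u) <= C0 + 3 / 4 * opn (Phi k (G u))) ->
  exists M, forall k u, (k1 <= k)%N -> C u -> opn (Phi k (G u)) <= M.
Proof.
move=> H0 H1 HC; exists (Num.max (Num.max b0 b1) (4 * C0)) => k u k1k.
rewrite -(subnKC k1k); elim: (k - k1)%N u => [|j IH] u Cu.
  by rewrite addn0 le_max le_max H0.
rewrite addnS; have [CGu|nC] := pselect (C (G u)); last first.
  by rewrite Phi_out// le_max le_max H1// orbT.
apply: le_trans (HC _ _ (leq_addr j k1) CGu) _.
have := IH _ CGu; set x := opn _; set M := Num.max _ (4 * C0).
have : 4 * C0 <= M by rewrite le_max lexx orbT.
by lra.
Qed.

(** The error of one step is small for large indices but not summable. It is therefore held below a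
    fixed [e / 8] while the contraction acts [j0] times on the initial bound [2 * M]. *)
Lemma fiber_cauchy k1 M :
  (forall k u, (k1 <= k)%N -> C u -> opn (Phi k (G u)) <= M) ->
  (forall e, 0 < e -> exists k0, forall k l u, (k0 <= k)%N -> (k0 <= l)%N -> C u ->
    opn (Phi k.+1 u - Phi l.+1 u) <= e + 3 / 4 * opn (Phi k (G u) - Phi l (G u))) ->
  forall e, 0 < e -> exists k0, forall k l u, (k0 <= k)%N -> (k0 <= l)%N ->
    `|Phi k u - Phi l u| <= e.
Proof.
move=> HM HC e e0; have e8 : 0 < e / 8 by rewrite divr_gt0.
have [k0 Hk0] := HC _ e8; pose k2 := maxn k0 k1.
(* Errors [e / 8] under a contraction 3/4 accumulate to at most [4 * (e / 8) = e / 2]. *)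
have step j k l u : (k2 <= k)%N -> (k2 <= l)%N -> C u ->
    opn (Phi (k + j)%N (G u) - Phi (l + j)%N (G u)) <= (3 / 4) ^+ j * (2 * M) + e / 2.
  move=> + + +; elim: j u => [|j IH] u kk kl Cu.
    rewrite !addn0 expr0 mul1r (le_trans (opnD _ _))//.
    have k1k : (k1 <= k)%N by apply: leq_trans kk; rewrite leq_maxr.
    have k1l : (k1 <= l)%N by apply: leq_trans kl; rewrite leq_maxr.
    have -> : opn (- Phi l (G u)) = opn (Phi l (G u)).
      apply/eqP; rewrite eq_le -scaleN1r; apply/andP; split.
        by rewrite (le_trans (opnZ _ _))// normrN1 mul1r.
      rewrite -{1}[Phi l _]opprK -(scaleN1r (- _)) -scaleN1r.
      by rewrite (le_trans (opnZ _ _))// normrN1 mul1r scaleN1r.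
    have := HM k u k1k Cu; have := HM l u k1l Cu; lra.
  have M0 : 0 <= M by apply: le_trans (HM k1 u (leqnn _) Cu); exact: opn_ge0.
  rewrite !addnS; have [CGu|nC] := pselect (C (G u)); last first.
    rewrite !Phi_out// subrr; apply: (@le_trans _ _ 0).
      by rewrite (le_trans (opn_le_norm _))// normr0 mulr0.
    by rewrite addr_ge0 ?mulr_ge0 ?exprn_ge0 ?divr_ge0// ltW.
  have k0k : (k0 <= k + j)%N by apply: leq_trans (leq_trans kk (leq_addr _ _)); rewrite leq_maxl.
  have k0l : (k0 <= l + j)%N by apply: leq_trans (leq_trans kl (leq_addr _ _)); rewrite leq_maxl.
  apply: le_trans (Hk0 _ _ _ k0k k0l CGu) _.
  have := IH _ kk kl CGu; rewrite exprS -(mulrA (3 / 4)).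
  by set x := opn _; set y := _ ^+ j * _; lra.
have [j0 Hj0] : exists j0, (3 / 4) ^+ j0 * (2 * M) <= e / 8.
  by have [|j0 H] := @geometric_small (3 / 4) _ (2 * M) _ e8; [lra|exists j0; apply: H].
(* One step is spent at [u] and [j0] steps at its backward images; the remaining indices are still
   at least [k2]. *)
exists (k2 + j0).+1 => -[|k] [|l] // u; rewrite !ltnS => kk ll.
apply: le_trans (norm_le_opn _) _.
have [Cu|nC] := pselect (C u); last first.
  by rewrite !Phi_out// subrr (le_trans (opn_le_norm _))// normr0 mulr0 ltW.
have k0k : (k0 <= k)%N.
  by apply: leq_trans kk; apply: leq_trans (leq_addr _ _); rewrite leq_maxl.
have k0l : (k0 <= l)%N.
  by apply: leq_trans ll; apply: leq_trans (leq_addr _ _); rewrite leq_maxl.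
apply: le_trans (Hk0 _ _ _ k0k k0l Cu) _.
have jk : (j0 <= k)%N by apply: leq_trans kk; rewrite leq_addl.
have jl : (j0 <= l)%N by apply: leq_trans ll; rewrite leq_addl.
have := step j0 (k - j0)%N (l - j0)%N u; rewrite !subnK// => /(_ _ _ Cu).
rewrite !leq_subRL// (addnC j0) => /(_ kk ll).
by set x := opn _; lra.
Qed.

End FiberContraction.

(** * The cut-off graph transform and its derivative *)

Section GraphTransform.
Variables (R : realType) (n m : nat).
Variables (G : 'rV[R]_n -> 'rV[R]_n) (JG : 'rV[R]_n -> 'M[R]_(n, n)) (N : set 'rV[R]_n).
Variables (D : set 'rV[R]_(n + m)) (dl : 'rV[R]_(n + m) -> 'rV[R]_m).
Variable Jdl : 'rV[R]_(n + m) -> 'M[R]_(n + m, m).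
Hypothesis GC1 : forall u, N u -> C1_at G JG u.
Hypothesis dlC1 : forall w, D w -> C1_at dl Jdl w.

(* The bump [chi] cuts off the graph transform by [psi] where [G], the inverse
   of the base map, is not under control. *)
Definition graph_tr (chi : 'rV[R]_n -> R) (psi phi : 'rV[R]_n -> 'rV[R]_m) u :=
  (1 - chi u) *: psi u + chi u *: dl (row_mx (G u) (phi (G u))).

Definition graph_tr_jac (chi : 'rV[R]_n -> R) Jchi (psi : 'rV[R]_n -> 'rV[R]_m)
    (Jpsi : 'rV[R]_n -> 'M[R]_(n, m)) (phi : 'rV[R]_n -> 'rV[R]_m)
    (Jphi : 'rV[R]_n -> 'M[R]_(n, m)) u : 'M[R]_(n, m) :=
  (- Jchi u *m psi u + (1 - chi u) *: Jpsi u) +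
  (Jchi u *m dl (row_mx (G u) (phi (G u))) +
   chi u *: (row_mx (JG u) (JG u *m Jphi (G u)) *m Jdl (row_mx (G u) (phi (G u))))).

(** Isolates the one term that contains the difference [P1 - P2] of the previous derivatives. The
    others contain differences of [dl] or of [Jdl] along two graphs, which uniform convergence makes
    small. *)
Lemma graph_tr_jac_sub (E : 'M[R]_(n, m)) (L : 'M[R]_(n, 1)) (d1 d2 : 'rV[R]_m) (a : R)
    (A : 'M[R]_n) (P1 P2 : 'M[R]_(n, m)) (X1 X2 : 'M[R]_(n + m, m)) :
  (E + (L *m d1 + a *: (A *m usubmx X1)) + a *: (A *m (P1 *m dsubmx X1))) -
  (E + (L *m d2 + a *: (A *m usubmx X2)) + a *: (A *m (P2 *m dsubmx X2))) =
  (L *m (d1 - d2) + a *: (A *m usubmx (X1 - X2)) + a *: (A *m (P1 *m dsubmx (X1 - X2)))) +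
  a *: (A *m ((P1 - P2) *m dsubmx X2)).
Proof.
have -> : usubmx (X1 - X2) = usubmx X1 - usubmx X2 by apply/matrixP => i j; rewrite !mxE.
have -> : dsubmx (X1 - X2) = dsubmx X1 - dsubmx X2 by apply/matrixP => i j; rewrite !mxE.
rewrite (mulmxBl P1) !mulmxBr.
move: (L *m d1) (L *m d2) (A *m usubmx X1) (A *m usubmx X2) => l1 l2 u1 u2.
move: (A *m (P1 *m dsubmx X1)) (A *m (P2 *m dsubmx X2)) (A *m (P1 *m dsubmx X2)) => p1 p2 p3.
by apply/matrixP => i j; rewrite !mxE; ring.
Qed.

(** Since [C] is closed, around a point outside it the transform coincides with [psi]; thus [G] and
    [dl] are differentiated only over [C], where they are C^1. *)
Lemma graph_tr_C1 chi Jchi psi Jpsi phi Jphi (C : set 'rV[R]_n) :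
  (forall u, C1_at (fun u => (chi u)%:M : 'rV_1) Jchi u) ->
  (forall u, C1_at psi Jpsi u) -> (forall u, C1_at phi Jphi u) ->
  compact C -> C `<=` N -> (forall u, ~ C u -> chi u = 0 /\ Jchi u = 0) ->
  (forall u, C u -> D (row_mx (G u) (phi (G u)))) ->
  forall u, C1_at (graph_tr chi psi phi) (graph_tr_jac chi Jchi psi Jpsi phi Jphi) u.
Proof.
move=> chiC1 psiC1 phiC1 cC CN chi0 CD u.
have chiC1' : C1_at (fun u => (1 - chi u)%:M : 'rV_1) (fun u => - Jchi u) u.
  apply: C1_at_near_eq (C1_atD (C1_at_cst 1%:M u)
    (C1_at_comp (chiC1 u) (C1_at_mulmx (- 1)%:M _))); apply/near_distP; exists 1 => // v _.
    by rewrite -scalar_mxM -raddfD /= mulrN1.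
  by rewrite mul_mx_scalar scaleN1r add0r.
have [Cu|nCu] := pselect (C u); last first.
  have clC : closed C by apply: compact_closed => //; exact: norm_hausdorff.
  have nC : \forall v \near u, ~ C v.
    by apply: open_nbhs_nbhs; split => //; apply: closed_openC.
  apply: C1_at_near_eq (psiC1 u); move: nC; apply: filterS => v /chi0[c0 J0].
    by rewrite /graph_tr c0 subr0 scale1r scale0r addr0.
  by rewrite /graph_tr_jac c0 J0 oppr0 !mul0mx subr0 scale1r scale0r add0r !addr0.
have Nu := CN u Cu.
apply: C1_atD; first exact: (C1_at_scale chiC1' (psiC1 u)).
apply: (C1_at_scale (chiC1 u)).
have GphiC1 := C1_at_row_mx (GC1 Nu) (C1_at_comp (GC1 Nu) (phiC1 (G u))).
exact: (C1_at_comp GphiC1 (dlC1 (CD u Cu))).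
Qed.

End GraphTransform.

(** * Invariant C^1 sections under domination on a compact set *)

Section InvariantSection.
Variables (R : realType) (n m : nat).
Variables (G : 'rV[R]_n -> 'rV[R]_n) (JG : 'rV[R]_n -> 'M[R]_(n, n)) (N : set 'rV[R]_n).
Variables (D K : set 'rV[R]_(n + m)) (dl : 'rV[R]_(n + m) -> 'rV[R]_m).
Variable Jdl : 'rV[R]_(n + m) -> 'M[R]_(n + m, m).
Variables (c : R) (B : 'rV[R]_n -> R).
Hypothesis c0 : 0 < c.
Hypothesis openN : open N.
Hypothesis openD : open D.
Hypothesis GC1 : forall u, N u -> C1_at G JG u.
Hypothesis dlC1 : forall w, D w -> C1_at dl Jdl w.
Hypothesis ND : forall u z, N u -> `|z| <= 2 * c -> D (row_mx (G u) z).
Hypothesis dl_le : forall w, D w -> `|dl w| <= c.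
Hypothesis dl_lip : forall u z z', N u -> `|z| <= 2 * c -> `|z'| <= 2 * c ->
  `|dl (row_mx (G u) z) - dl (row_mx (G u) z')| <= 1 / 4 * `|z - z'|.
Hypothesis cK : compact K.
Hypothesis KD : K `<=` D.
Hypothesis K_le : forall w, K w -> `|rsubmx w| <= c.
Hypothesis Kback : forall w, K w -> N (lsubmx w) /\
  exists w', [/\ K w', G (lsubmx w) = lsubmx w' & rsubmx w = dl w'].
(** The bound is evaluated at [G u], because the derivative of [G] at [u] is multiplied by that of
    [dl] over [G u]. *)
Hypothesis JG_le : forall u, N u -> opn (JG u) <= B (G u).
Hypothesis Bcont : forall w, D w -> {for lsubmx w, continuous B}.
Hypothesis K_dom : forall w, K w -> B (lsubmx w) * opn (dsubmx (Jdl w)) <= 1 / 2.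

Let K2 : set 'rV[R]_n := lsubmx @` K.

Let K2_compact : compact K2.
Proof.
apply: continuous_compact => //; apply: continuous_in_subspaceT => w _.
exact: lsubmx_continuous.
Qed.

Let K2N : K2 `<=` N.
Proof. by move=> _ [w Kw <-]; have [] := Kback Kw. Qed.

Let norm_z_le (u v : 'rV[R]_m) : `|u - v| <= c -> `|v| <= c -> `|u| <= 2 * c.
Proof.
by move=> uv vc; have := ler_normD (u - v) v; rewrite subrK; lra.
Qed.

Let le2c (z : 'rV[R]_m) : `|z| <= c -> `|z| <= 2 * c.
Proof. by move=> zc; have := c0; lra. Qed.

(** Iterates of the cut-off zero section: each application contracts the distance to [K] by 1/4
    along backward orbits. Finitely many suffice, so each iterate is C^1 without any uniform bound
    on derivatives. *)
Lemma approx_section e : 0 < e -> exists psi Jpsi,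
  [/\ forall u, C1_at psi Jpsi u, forall u, `|psi u| <= c &
      forall w, K w -> `|rsubmx w - psi (lsubmx w)| <= e].
Proof.
move=> e0; have [chi [Jchi [C [chiC1 chi01 [cC CN] chi0 chi1]]]] :=
  bump_function K2_compact openN K2N.
pose T := graph_tr G dl chi (cst 0).
have TE phi u : T phi u = chi u *: dl (row_mx (G u) (phi (G u))).
  by rewrite /T /graph_tr scaler0 add0r.
have Tle phi : (forall u, `|phi u| <= c) -> forall u, `|T phi u| <= c.
  move=> phic u; rewrite TE mx_normZ.
  have /andP[x0 x1] := chi01 u; rewrite ger0_norm//.
  have [Cu|/chi0[-> _]] := pselect (C u); last by rewrite mul0r ltW.
  apply: le_trans (dl_le (ND (CN u Cu) (le2c (phic (G u))))).
  by rewrite ler_piMl.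
have iterC1 k : exists J, (forall u, C1_at (iter k T (cst 0)) J u) /\
    forall u, `|iter k T (cst 0) u| <= c.
  elim: k => [|k [J [HJ Hc]]] /=.
    by exists (cst 0); split => u; [exact: C1_at_cst|rewrite normr0 ltW].
  eexists; split; last exact: Tle.
  apply: (graph_tr_C1 GC1 dlC1 chiC1 (fun u => C1_at_cst 0 u) HJ cC CN chi0).
  by move=> u Cu; apply: ND; [exact: CN|exact: le2c].
have approx k w : K w -> `|rsubmx w - iter k T (cst 0) (lsubmx w)| <= (1 / 4) ^+ k * (2 * c).
  elim: k w => [|k IH] w Kw.
    by rewrite /= subr0 expr0 mul1r le2c// K_le.
  have [Nw [w' [Kw' Gw zw]]] := Kback Kw.
  have -> : iter k.+1 T (cst 0) (lsubmx w) =
      dl (row_mx (G (lsubmx w)) (iter k T (cst 0) (lsubmx w'))).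
    rewrite /= TE Gw; have -> := nbhs_singleton (chi1 (lsubmx w) _).
      by rewrite scale1r.
    by exists w.
  have [J [_ Hc]] := iterC1 k.
  have := dl_lip Nw (le2c (K_le Kw')) (le2c (Hc (lsubmx w'))).
  rewrite {1}Gw hsubmxK zw => /le_trans; apply.
  by rewrite exprS -[leRHS]mulrA ler_wpM2l ?IH// divr_ge0.
have [k Hk] : exists k, (1 / 4) ^+ k * (2 * c) <= e.
  by have [|k Hk] := @geometric_small R (1 / 4) e (2 * c) _ e0; [lra|exists k; apply: Hk].
have [J [HJ Hc]] := iterC1 k.
exists (iter k T (cst 0)), J; split => // w Kw.
exact: le_trans (approx k w Kw) Hk.
Qed.

Let theta w := B (lsubmx w) * opn (dsubmx (Jdl w)).

Let theta_near w : K w -> \forall w' \near w, D w' /\ theta w' < 3 / 4.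
Proof.
move=> Kw; have Dw := KD Kw.
have cB : {for w, continuous (B \o lsubmx)}.
  exact: (continuous_comp (lsubmx_continuous (w := w)) (Bcont Dw)).
have [_ cJ] := dlC1 Dw.
have ct : {for w, continuous theta}.
  exact: (cvgM cB (cvg_opn (cvg_dsubmx cJ))).
have tw : theta w < 3 / 4 by apply: le_lt_trans (K_dom Kw) _; lra.
apply: (near_imp2 (open_nbhs_nbhs (conj openD Dw)) (cvgr_lt _ ct _ tw)) => w' Dw' tw'.
by split.
Qed.

(* The domination is assumed on [K] only, so that the second cut-off has to be
   chosen after a section close to [K] is known. *)
Lemma approx_section_neighborhood : exists e psi Jpsi (N' : set 'rV[R]_n),
  [/\ 0 < e /\ 3 * e <= c, forall u, C1_at psi Jpsi u /\ `|psi u| <= c,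
      open N' /\ K2 `<=` N',
      forall u, N' u -> N u /\ `|dl (row_mx (G u) (psi (G u))) - psi u| <= 3 / 2 * e &
      forall u z, N' u -> `|z - psi (G u)| <= 3 * e ->
        B (G u) * opn (dsubmx (Jdl (row_mx (G u) z))) <= 3 / 4].
Proof.
have [e1 e10 He1] := compact_uniform_near cK theta_near.
(* The points used later lie within [3 * e] of a point of the graph of [psi] that is within [2 * e]
   of [K]: hence 5. The bound [3 * e <= c] keeps this tube in the strip of height [2 * c]. *)
pose e := Num.min (e1 / 5) (c / 3).
have e0 : 0 < e by rewrite lt_min !divr_gt0.
have ee1 : 5 * e <= e1 by rewrite mulrC -ler_pdivlMr// ge_min lexx.
have ec : 3 * e <= c by rewrite mulrC -ler_pdivlMr// ge_min lexx orbT.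
have [psi [Jpsi [psiC1 psic psiK]]] := approx_section e0.
pose r u := row_mx (G u) (psi (G u)).
pose Pr u := [/\ N u, (exists2 w, K w & `|r u - w| < 2 * e) &
   `|dl (r u) - psi u| <= 3 / 2 * e].
exists e, psi, Jpsi, (interior [set u | Pr u]); split => //.
- split; first exact: open_interior.
  move=> _ [w Kw <-]; have [Nw [w' [Kw' Gw zw]]] := Kback Kw.
  have Dr : D (r (lsubmx w)) by apply: ND => //; apply: le2c.
  have [rJ _] := C1_at_row_mx (GC1 Nw) (C1_at_comp (GC1 Nw) (psiC1 (G (lsubmx w)))).
  have cr : {for lsubmx w, continuous r} := has_jac_continuous rJ.
  have cdl : {for lsubmx w, continuous (dl \o r)}.
    apply: (continuous_comp cr); have [dJ _] := dlC1 Dr.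
    exact: has_jac_continuous dJ.
  have cpsi : {for lsubmx w, continuous psi}.
    by have [pJ _] := psiC1 (lsubmx w); exact: has_jac_continuous pJ.
  have rw' : `|r (lsubmx w) - w'| <= e.
    rewrite -[w']hsubmxK /r Gw opp_row_mx add_row_mx subrr mx_norm_row_mx normr0.
    by rewrite max_r// distrC psiK.
  (* The fibre contraction contributes [e / 4] and the distance of [psi] to [K] contributes [e]. The
     margin up to [3 / 2 * e] pays for two continuity errors [e / 8]. *)
  have dlw : `|dl (r (lsubmx w)) - psi (lsubmx w)| <= 5 / 4 * e.
    have := dl_lip Nw (le2c (psic (G (lsubmx w)))) (le2c (K_le Kw')).
    have -> : row_mx (G (lsubmx w)) (rsubmx w') = w' by rewrite Gw hsubmxK.
    rewrite -zw => L1; have := psiK w Kw => L2.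
    have := psiK w' Kw'; rewrite -Gw distrC => L3.
    rewrite -(subrK (rsubmx w) (dl _)) -addrA (le_trans (ler_normD _ _))//.
    lra.
  have e8 : 0 < e / 8 by rewrite divr_gt0.
  have /cvgrPdistC_lt/(_ _ e8) near1 := cr.
  have /cvgrPdistC_lt/(_ _ e8) near2 := cdl.
  have /cvgrPdistC_lt/(_ _ e8) near3 := cpsi.
  have near12 := near_imp2 near1 near2 (fun u => @conj _ _).
  apply: (near_imp3 (open_nbhs_nbhs (conj openN Nw)) near12 near3) => u Nu [r1 r2] r3.
  split=> //.
    exists w' => //; rewrite -(subrK (r (lsubmx w)) (r u)) -addrA.
    by rewrite (le_lt_trans (ler_normD _ _))//; lra.
  have -> : dl (r u) - psi u = (dl (r u) - dl (r (lsubmx w))) +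
      (dl (r (lsubmx w)) - psi (lsubmx w)) - (psi u - psi (lsubmx w)).
    by rewrite addrA subrK opprB addrA subrK.
  rewrite (le_trans (ler_normB _ _))//.
  move: (ler_normD (dl (r u) - dl (r (lsubmx w))) (dl (r (lsubmx w)) - psi (lsubmx w))).
  by move: r2 => /=; lra.
- by move=> u /interior_subset[].
- move=> u z /interior_subset[Nu [w Kw rw] _] zpsi.
  have [] := He1 w (row_mx (G u) z) Kw.
    apply: lt_le_trans ee1; rewrite -(subrK (r u) (row_mx _ _)) -addrA.
    rewrite (le_lt_trans (ler_normD _ _))//.
    have : `|row_mx (G u) z - r u| <= 3 * e.
      by rewrite opp_row_mx add_row_mx subrr mx_norm_row_mx normr0 max_r.
    by lra.
  by rewrite /theta row_mxKl => _ /ltW.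
Qed.

Theorem invariant_section : exists phi Jphi,
  [/\ forall u, C1_at phi Jphi u,
      forall w, K w -> rsubmx w = phi (lsubmx w) &
      forall u, K2 u -> \forall v \near u, N v /\ phi v = dl (row_mx (G v) (phi (G v)))].
Proof.
have [e [psi [Jpsi [N' [[e0 ec] psiC1 [oN' K2N'] N'P N'theta]]]]] :=
  approx_section_neighborhood.
have [chi [Jchi [C [chiC1 chi01 [cC CN'] chi0 chi1]]]] := bump_function K2_compact oN' K2N'.
have CN u : C u -> N u by move=> /CN'/N'P[].
pose T := graph_tr G dl chi psi.
pose close phi := forall u, `|phi u - psi u| <= 3 * e.
have close2c phi : close phi -> forall u, `|phi u| <= 2 * c.
  move=> cl u; apply: (norm_z_le (v := psi u)); last by have [] := psiC1 u.
  exact: le_trans (cl u) ec.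
have Tout phi u : ~ C u -> T phi u = psi u.
  by move=> /chi0[c0' _]; rewrite /T /graph_tr c0' subr0 scale1r scale0r addr0.
(* The contraction reduces [3 * e] to [3 / 4 * e], and the transform moves [psi] by at most
   [3 / 2 * e], so the tube of radius [3 * e] is preserved. *)
have Tclose phi : close phi -> close (T phi).
  move=> cl u; have [Cu|nC] := pselect (C u); last first.
    by rewrite Tout// subrr normr0 mulr_ge0// ltW.
  have -> : T phi u - psi u = chi u *: (dl (row_mx (G u) (phi (G u))) - psi u).
    rewrite /T /graph_tr; move: (dl _) => a.
    by apply/matrixP => i j; rewrite !mxE; ring.
  have /andP[x0 x1] := chi01 u; rewrite mx_normZ ger0_norm//.
  apply: le_trans (ler_piMl _ x1) _ => //.
  have [Nu dpsi] := N'P u (CN' u Cu).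
  have := dl_lip Nu (close2c _ cl (G u)) (le2c (proj2 (psiC1 (G u)))).
  have := cl (G u) => + L.
  rewrite -(subrK (dl (row_mx (G u) (psi (G u)))) (dl _)) -addrA.
  move=> H; apply: le_trans (ler_normD _ _) _; lra.
have Tcontr phi phi' a : close phi -> close phi' -> 0 <= a ->
    (forall u, `|phi u - phi' u| <= a) -> forall u, `|T phi u - T phi' u| <= 1 / 4 * a.
  move=> cl cl' a0 H u; have [Cu|nC] := pselect (C u); last first.
    by rewrite !Tout// subrr normr0 mulr_ge0// divr_ge0.
  have -> : T phi u - T phi' u =
      chi u *: (dl (row_mx (G u) (phi (G u))) - dl (row_mx (G u) (phi' (G u)))).
    by rewrite /T /graph_tr scalerBr opprD addrACA subrr add0r.
  have /andP[x0 x1] := chi01 u; rewrite mx_normZ ger0_norm//.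
  apply: le_trans (ler_piMl _ x1) _ => //.
  apply: le_trans (dl_lip (CN u Cu) (close2c _ cl (G u)) (close2c _ cl' (G u))) _.
  by rewrite ler_wpM2l ?divr_ge0.
pose phi k := iter k T psi.
have phiclose k : close (phi k).
  elim: k => [u|k IH]; last exact: Tclose.
  by rewrite /= subrr normr0 mulr_ge0// ltW.
have phicauchy k j u : `|phi (k + j)%N u - phi k u| <= (1 / 4) ^+ k * (3 * e).
  elim: k u => [|k IH] u; first by rewrite add0n expr0 mul1r; apply: phiclose.
  have -> : (1 / 4) ^+ k.+1 * (3 * e) = 1 / 4 * ((1 / 4) ^+ k * (3 * e)).
    by rewrite exprS -!mulrA.
  have a0 : 0 <= (1 / 4) ^+ k * (3 * e).
    by rewrite mulr_ge0 ?exprn_ge0 ?divr_ge0 ?mulr_ge0// ltW.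
  exact: (Tcontr _ _ _ (phiclose (k + j)%N) (phiclose k) a0 IH).
pose phis u : 'rV[R]_m := lim (phi k u @[k --> \oo]).
have phicvg u : phi k u @[k --> \oo] --> phis u.
  apply: cauchy_cvg; apply: cauchy_exP => r r0.
  have r20 : 0 < r / 2 by rewrite divr_gt0.
  have [|k0 Hk0] := @geometric_small R (1 / 4) (r / 2) (3 * e) _ r20; first by lra.
  exists (phi k0 u); exists k0 => // k /= k0k.
  rewrite /= -ball_normE /= distrC -(subnKC k0k); apply: le_lt_trans (phicauchy _ _ _) _.
  by apply: le_lt_trans (Hk0 k0 (leqnn _)) _; rewrite ltr_pdivrMr// ltr_pMr// ltr1n.
have phis_dist k u : `|phis u - phi k u| <= (1 / 4) ^+ k * (3 * e).
  have cv : `|phi j u - phi k u| @[j --> \oo] --> `|phis u - phi k u|.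
    by apply: cvg_norm; apply: cvgB; [exact: phicvg|exact: cvg_cst].
  apply: (cvgr_to_le cv); exists k => // j /= kj.
  by rewrite -(subnKC kj); apply: phicauchy.
have phis_close : close phis.
  by move=> u; have := phis_dist 0%N u; rewrite expr0 mul1r.
(* The derivatives of the iterates, starting from [Jpsi]; this is where the approximate section has
   to be C^1. *)
pose Phi := fix Phi k := if k is k'.+1 then
  graph_tr_jac G JG dl Jdl chi Jchi psi Jpsi (phi k') (Phi k') else Jpsi.
have phiC1 k : forall u, C1_at (phi k) (Phi k) u.
  elim: k => [|k IH] u /=; first by have [] := psiC1 u.
  apply: (graph_tr_C1 GC1 dlC1 chiC1 (fun u => proj1 (psiC1 u)) IH cC CN chi0).
  by move=> v Cv; apply: ND; [exact: CN|exact: close2c].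
(* Continuity of the limit is settled before its differentiability: it makes [Jdl] along the limit
   graph continuous, hence bounded on [C]. *)
have phis_cont u : {for u, continuous phis}.
  apply/continuous_distP => r r0; have r30 : 0 < r / 3 by rewrite divr_gt0.
  have [|k Hk] := @geometric_small R (1 / 4) (r / 3) (3 * e) _ r30; first by lra.
  have [/has_jac_continuous/continuous_distP/(_ _ r30)[d d0 Hd] _] := phiC1 k u.
  exists d => // v vu; have A := le_trans (phis_dist k v) (Hk k (leqnn k)).
  have B' := le_trans (phis_dist k u) (Hk k (leqnn k)); have C' := Hd v vu.
  have -> : phis v - phis u = (phis v - phi k v) + (phi k v - phi k u) - (phis u - phi k u).
    by rewrite addrA subrK opprB addrA subrK.
  rewrite (le_trans (ler_normB _ _))//.
  by have := ler_normD (phis v - phi k v) (phi k v - phi k u); lra.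
pose X k u := Jdl (row_mx (G u) (phi k (G u))).
pose Xs u := Jdl (row_mx (G u) (phis (G u))).
have Gcont u : C u -> {for u, continuous G}.
  by move=> /CN/GC1[/has_jac_continuous].
have rs_cont u : C u -> {for u, continuous (fun u => row_mx (G u) (phis (G u)))}.
  move=> Cu; apply: (cvg_row_mx (Gcont u Cu)).
  exact: (continuous_comp (Gcont u Cu) (phis_cont (G u))).
have Ds u : C u -> D (row_mx (G u) (phis (G u))).
  by move=> Cu; apply: ND; [exact: CN|exact: close2c].
have Xs_cont u : C u -> {for u, continuous Xs}.
  move=> Cu; have [_ cJ] := dlC1 (Ds u Cu).
  exact: (continuous_comp (rs_cont u Cu) cJ).
(* As [Jdl] is merely continuous, this convergence has no rate. Compactness of [C] is used as a
   near-covering, with [k] near infinity as parameter. *)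
have X_unif r : 0 < r -> exists k0, forall k u, (k0 <= k)%N -> C u -> `|X k u - Xs u| <= r.
  move=> r0; have r20 : 0 < r / 2 by rewrite divr_gt0.
  have H : \forall k \near \oo, C `<=` [set u | `|X k u - Xs u| <= r].
    move/compact_near_coveringP: cC; apply => u0 Cu0.
    have [_ /continuous_distP/(_ _ r20)[d d0 Hd]] := dlC1 (Ds u0 Cu0).
    have d20 : 0 < d / 2 by rewrite divr_gt0.
    have d40 : 0 < d / 4 by rewrite divr_gt0.
    have [|k0 Hk0] := @geometric_small R (1 / 4) (d / 4) (3 * e) _ d40; first by lra.
    have /cvgrPdistC_lt/(_ _ d20) nr := rs_cont u0 Cu0.
    exists ([set u | `|row_mx (G u) (phis (G u)) - row_mx (G u0) (phis (G u0))| < d / 2],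
            [set k | (k0 <= k)%N]).
      by split => //; exists k0.
    move=> [u k] /= [ur kk].
    have ks : `|row_mx (G u) (phi k (G u)) - row_mx (G u) (phis (G u))| <= d / 4.
      rewrite opp_row_mx add_row_mx subrr mx_norm_row_mx normr0 max_r//.
      by rewrite distrC; apply: le_trans (phis_dist k _) (Hk0 k kk).
    have A : `|Xs u - Xs u0| <= r / 2 by apply: Hd; lra.
    have B' : `|X k u - Xs u0| <= r / 2.
      apply: Hd; rewrite -(subrK (row_mx (G u) (phis (G u))) (row_mx _ (phi k _))) -addrA.
      by rewrite (le_lt_trans (ler_normD _ _))//; lra.
    rewrite -(subrK (Xs u0) (X k u)) -addrA (le_trans (ler_normD _ _))//.
    by rewrite (distrC (Xs u0)); lra.
  by have [k0 _ Hk0] := H; exists k0 => k u kk; apply: Hk0.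
have Phi_out k u : ~ C u -> Phi k.+1 u = Jpsi u.
  move=> /chi0[c0' J0]; rewrite /= /graph_tr_jac c0' J0.
  by rewrite oppr0 !mul0mx subr0 scale1r scale0r add0r !addr0.
(* The terms of the recursion that do not contain the previous derivative. *)
pose rest k u := (- Jchi u *m psi u + (1 - chi u) *: Jpsi u) +
  (Jchi u *m dl (row_mx (G u) (phi k (G u))) + chi u *: (JG u *m usubmx (X k u))).
have PhiS k u : Phi k.+1 u =
    rest k u + chi u *: (JG u *m (Phi k (G u) *m dsubmx (X k u))).
  rewrite /= /graph_tr_jac -/(X k u) /rest -!addrA -scalerDr mulmxA -mul_row_col.
  by rewrite vsubmxK.
(* The domination enters here: the previous derivative is multiplied by [JG u] and by the fibre
   derivative over [G u], at a point of the tube. *)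
have dom k u Y : C u -> opn (chi u *: (JG u *m (Y *m dsubmx (X k u)))) <= 3 / 4 * opn Y.
  move=> Cu; have /andP[x0 x1] := chi01 u.
  apply: le_trans (opnZ _ _) _; rewrite ger0_norm//.
  apply: le_trans (ler_piMl (opn_ge0 _) x1) _.
  apply: le_trans (opnM _ _) _.
  apply: le_trans (ler_pM (opn_ge0 _) (opn_ge0 _) (JG_le (CN u Cu)) (opnM _ _)) _.
  rewrite mulrCA mulrC ler_wpM2r ?opn_ge0//.
  exact: N'theta (CN' u Cu) (phiclose k (G u)).
have [bJ bJ0 HbJ] := compact_bound cC (fun u _ => proj2 (chiC1 u)).
have [bP bP0 HbP] := compact_bound cC (fun u _ => proj2 (proj1 (psiC1 u))).
have [bG bG0 HbG] := compact_bound cC (fun u Cu => proj2 (GC1 (CN u Cu))).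
have [bX bX0 HbX] := compact_bound cC Xs_cont.
have [k1 Hk1] := X_unif 1 ltr01.
have dl_phi k u : C u -> `|dl (row_mx (G u) (phi k (G u)))| <= c.
  by move=> Cu; apply: dl_le; apply: ND (CN u Cu) (close2c _ (phiclose k) _).
have rest_le k u : (k1 <= k)%N -> C u ->
    opn (rest k u) <= (m * n)%:R * ((bJ * c + bP) + (bJ * c + n%:R * (bG * (bX + 1)))).
  move=> kk Cu; apply: le_trans (opn_le_norm _) _; rewrite ler_wpM2l//.
  have /andP[x0 x1] := chi01 u.
  apply: le_trans (ler_normD _ _) (lerD _ _); apply: le_trans (ler_normD _ _) (lerD _ _).
  - apply: le_trans (mx_norm_mulmx _ _) _; rewrite mul1r normrN.
    by apply: ler_pM => //; [exact: HbJ|have [] := psiC1 u].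
  - rewrite mx_normZ ger0_norm ?subr_ge0//; apply: le_trans (HbP u Cu).
    by rewrite ler_piMl// gerBl.
  - apply: le_trans (mx_norm_mulmx _ _) _; rewrite mul1r.
    by apply: ler_pM => //; [exact: HbJ|exact: dl_phi].
  - rewrite mx_normZ ger0_norm//; apply: le_trans (ler_piMl _ x1) _ => //.
    apply: le_trans (mx_norm_mulmx _ _) _; rewrite ler_wpM2l//.
    apply: ler_pM => //; first exact: HbG.
    apply: le_trans (mx_norm_usubmx _) _.
    rewrite -(subrK (Xs u) (X k u)) addrC; apply: le_trans (ler_normD _ _) (lerD _ _).
      exact: HbX.
    exact: Hk1.
have [b1 _ Hb1] := compact_bound cC (fun u Cu =>
  continuous_comp (Gcont u Cu) (proj2 (proj1 (psiC1 (G u))))).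
have [b2 _ Hb2] := compact_bound cC (fun u Cu =>
  continuous_comp (Gcont u Cu) (proj2 (phiC1 k1 (G u)))).
have [M HM] : exists M, forall k u, (k1 <= k)%N -> C u -> opn (Phi k (G u)) <= M.
  apply: (@fiber_bounded R n m C G Phi Jpsi Phi_out k1 _ ((m * n)%:R * b2) ((m * n)%:R * b1)).
  - by move=> u Cu; apply: le_trans (opn_le_norm _) _; rewrite ler_wpM2l// Hb2.
  - by move=> u Cu; apply: le_trans (opn_le_norm _) _; rewrite ler_wpM2l// Hb1.
  - move=> k u kk Cu; rewrite PhiS; apply: le_trans (opnD _ _) (lerD _ _).
      exact: rest_le kk Cu.
    exact: dom.
have step_cauchy r : 0 < r -> exists k0, forall k l u, (k0 <= k)%N -> (k0 <= l)%N -> C u ->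
    opn (Phi k.+1 u - Phi l.+1 u) <= r + 3 / 4 * opn (Phi k (G u) - Phi l (G u)).
  (* [q] collects the coefficients of the differences of [dl] and [Jdl] along the two graphs,
     including the bound [M] on the previous derivative. *)
  move=> r0; set q : R := (m * n)%:R * (bJ + n%:R * bG + n%:R * (bG * (m%:R * `|M|))).
  have q0 : 0 <= q by rewrite mulr_ge0// !addr_ge0// !mulr_ge0.
  have q1 : 0 < q + 1 by rewrite ltr_wpDl.
  set eta := r / (q + 1); have eta0 : 0 < eta by rewrite divr_gt0.
  have eta20 : 0 < eta / 2 by rewrite divr_gt0.
  have [k2 Hk2] := X_unif _ eta20.
  have [|k3 Hk3] := @geometric_small R (1 / 4) (eta / 2) (3 * e) _ eta20; first by lra.
  exists (maxn k1 (maxn k2 k3)) => k l u; rewrite !geq_max.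
  move=> /and3P[k1k k2k k3k] /and3P[_ k2l k3l] Cu.
  have dX : `|X k u - X l u| <= eta.
    rewrite -(subrK (Xs u) (X k u)) -addrA (splitr eta).
    apply: le_trans (ler_normD _ _) (lerD (Hk2 k u k2k Cu) _).
    by rewrite distrC; apply: Hk2.
  have dd : `|dl (row_mx (G u) (phi k (G u))) - dl (row_mx (G u) (phi l (G u)))| <= eta.
    apply: le_trans (dl_lip (CN u Cu) (close2c _ (phiclose k) _) (close2c _ (phiclose l) _)) _.
    have A := le_trans (phis_dist k (G u)) (Hk3 k k3k).
    have B' := le_trans (phis_dist l (G u)) (Hk3 l k3l).
    have : `|phi k (G u) - phi l (G u)| <= eta.
      rewrite -(subrK (phis (G u)) (phi k (G u))) -addrA (splitr eta).
      by apply: le_trans (ler_normD _ _) (lerD _ _) => //; rewrite distrC.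
    by have := normr_ge0 (phi k (G u) - phi l (G u)); lra.
  have -> : Phi k.+1 u - Phi l.+1 u =
    (Jchi u *m (dl (row_mx (G u) (phi k (G u))) - dl (row_mx (G u) (phi l (G u)))) +
     chi u *: (JG u *m usubmx (X k u - X l u)) +
     chi u *: (JG u *m (Phi k (G u) *m dsubmx (X k u - X l u)))) +
    chi u *: (JG u *m ((Phi k (G u) - Phi l (G u)) *m dsubmx (X l u))).
    by rewrite !PhiS /rest graph_tr_jac_sub.
  apply: le_trans (opnD _ _) (lerD _ (dom _ _ _ Cu)).
  apply: (@le_trans _ _ (q * eta)); last first.
    by rewrite /eta mulrCA ler_piMr ?(ltW r0)// ler_pdivrMr// mul1r lerDl.
  apply: le_trans (opn_le_norm _) _; rewrite /q -mulrA ler_wpM2l// !mulrDl.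
  have /andP[x0 x1] := chi01 u.
  apply: le_trans (ler_normD _ _) (lerD _ _).
    apply: le_trans (ler_normD _ _) (lerD _ _).
      apply: le_trans (mx_norm_mulmx _ _) _; rewrite mul1r.
      by apply: ler_pM => //; exact: HbJ.
    rewrite mx_normZ ger0_norm//; apply: le_trans (ler_piMl _ x1) _ => //.
    apply: le_trans (mx_norm_mulmx _ _) _; rewrite -mulrA ler_wpM2l//.
    apply: ler_pM => //; first exact: HbG.
    exact: le_trans (mx_norm_usubmx _) dX.
  rewrite mx_normZ ger0_norm//; apply: le_trans (ler_piMl _ x1) _ => //.
  apply: le_trans (mx_norm_mulmx _ _) _; rewrite -!mulrA ler_wpM2l//.
  apply: ler_pM => //; first exact: HbG.
  apply: le_trans (mx_norm_mulmx _ _) _; rewrite ler_wpM2l//.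
  apply: ler_pM => //; last exact: le_trans (mx_norm_dsubmx _) dX.
  apply: le_trans (norm_le_opn _) _; apply: le_trans (HM k u k1k Cu) _.
  exact: ler_norm.
have Phi_cauchy := fiber_cauchy Phi_out HM step_cauchy.
have [|||Jphi HJ] := @C1_limit R n m setT phi Phi phis openT.
- by move=> k u _; apply: phiC1.
- by move=> u _; apply: phicvg.
- by move=> r /Phi_cauchy[k0 H]; exists k0 => k l u kk ll _; apply: H.
have Tphis u : phis u = T phis u.
  have cv1 : phi k.+1 u @[k --> \oo] --> phis u.
    by have := phicvg u; rewrite -(cvg_shiftS (phi ^~ u)).
  have cv2 : phi k.+1 u @[k --> \oo] --> T phis u.
    apply/cvgrPdist_le => r r0.
    have [|k0 Hk0] := @geometric_small R (1 / 4) r (3 * e) _ r0; first by lra.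
    exists k0 => // k /= kk.
    apply: le_trans (Tcontr _ _ ((1 / 4) ^+ k * (3 * e)) phis_close (phiclose k) _ (phis_dist k) u) _.
      by rewrite mulr_ge0 ?exprn_ge0 ?divr_ge0 ?mulr_ge0// ltW.
    have := Hk0 k kk; have : 0 <= (1 / 4 : R) ^+ k * (3 * e).
      by rewrite mulr_ge0 ?exprn_ge0 ?divr_ge0 ?mulr_ge0// ltW.
    by set x := _ ^+ k * _; lra.
  exact: cvg_unique cv1 cv2.
have inv u : chi u = 1 -> phis u = dl (row_mx (G u) (phis (G u))).
  by move=> chiu; rewrite {1}Tphis /T /graph_tr chiu subrr scale0r add0r scale1r.
exists phis, Jphi; split.
- by move=> u; apply: HJ.
- move=> w Kw; apply/eqP; rewrite -subr_eq0 -normr_le0.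
  apply/ler_addgt0Pr => r r0; rewrite add0r.
  have [|k Hk] := @geometric_small R (1 / 4) r (4 * c) _ r0; first by lra.
  (* At the [k]-th backward image in [K] the distance to the graph is at most [3 * c], and each step
     forward contracts it by 1/4. *)
  apply: le_trans (Hk k (leqnn k)); elim: k w Kw {Hk} => [|k IH] w Kw.
    rewrite expr0 mul1r (le_trans (ler_normB _ _))//.
    have := close2c _ phis_close (lsubmx w); have := K_le Kw; lra.
  have [Nw [w' [Kw' Gw zw]]] := Kback Kw.
  have K2w : K2 (lsubmx w) by exists w.
  rewrite inv ?(nbhs_singleton (chi1 _ K2w))// Gw zw -{1}[w']hsubmxK.
  have := dl_lip Nw (le2c (K_le Kw')) (close2c _ phis_close (lsubmx w')).
  rewrite Gw => /le_trans; apply.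
  by rewrite exprS -[leRHS]mulrA ler_wpM2l ?divr_ge0// IH.
- move=> u Ku; apply: (near_imp2 (chi1 u Ku) (open_nbhs_nbhs (conj oN' (K2N' u Ku)))) => v chiv N'v.
  by split; [have [] := N'P v N'v|exact: inv].
Qed.

End InvariantSection.

(** * Planar maps *)

Section PlanarInverse.
Variable R : realType.

Lemma ord2P (i : 'I_2) : i = 0 \/ i = 1.
Proof. by case: i => [[|[|//]]] p; [left|right]; apply/val_inj. Qed.

Lemma row2E (v : 'rV[R]_2) : row2 (v 0 0) (v 0 1) = v.
Proof.
apply/rowP => i; rewrite mxE; have [->//|i0] := eqVneq i 0.
by congr (v 0 _); apply/val_inj; case: i i0 => [[|[|]]].
Qed.

Lemma row2_0 (x y : R) : row2 x y 0 0 = x.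
Proof. by rewrite mxE eqxx. Qed.

Lemma row2_1 (x y : R) : row2 x y 0 1 = y.
Proof. by rewrite mxE. Qed.

Lemma row2B (x y x' y' : R) : row2 x y - row2 x' y' = row2 (x - x') (y - y').
Proof. by apply/rowP => i; rewrite !mxE; case: ifP. Qed.

Lemma row2_norm (x y : R) : `|row2 x y| = Num.max `|x| `|y|.
Proof.
apply/eqP; rewrite eq_le; apply/andP; split.
  apply: mx_norm_le_entries => [|i j]; first by rewrite le_max normr_ge0.
  by rewrite mxE le_max; case: ifP => _; rewrite lexx ?orbT.
have := le_mx_norm (row2 x y) 0 0; have := le_mx_norm (row2 x y) 0 1.
by rewrite row2_0 row2_1 ge_max => -> ->.
Qed.

Lemma row2_mul (x y : R) k (M : 'M[R]_(2, k)) j :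
  (row2 x y *m M) 0 j = x * M 0 j + y * M 1 j.
Proof.
rewrite mxE big_ord_recl big_ord1 row2_0; congr (_ + _ * M _ _); last exact/val_inj.
by rewrite -[RHS](row2_1 x y); congr (row2 x y 0 _); apply/val_inj.
Qed.

Lemma has_jac_unique n k (f : 'rV[R]_n -> 'rV[R]_k) v M N :
  has_jac f v M -> has_jac f v N -> M = N.
Proof. by move=> /has_jac_diff[_ <-] /has_jac_diff[_ <-]. Qed.

Variables (P : 'rV[R]_2 -> 'rV[R]_2) (JP : 'rV[R]_2 -> 'M[R]_2) (r : R).
Let S := [set v : 'rV[R]_2 | `|v| < r].
Hypothesis PC1 : forall v, S v -> C1_at P JP v.
Hypothesis P1E : forall v, P v 0 1 = v 0 0.
Hypothesis JP10 : forall v, S v -> JP v 1 0 != 0.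

Let openS : open S.
Proof.
rewrite openE => v Sv; apply: (proj2 (near_distP v _)).
exists (r - `|v|); first by rewrite subr_gt0.
move=> u; rewrite ltrBrDr => uv; apply: le_lt_trans uv.
by rewrite -{1}(subrK v u) ler_normD.
Qed.

Let S_segment a b t : S a -> S b -> 0 <= t <= 1 -> S (a + t *: (b - a)).
Proof.
move=> Sa Sb t01; rewrite /S /= -[X in `|X|]subr0.
by apply: ball_segment t01; rewrite subr0.
Qed.

(** Equal images have equal first coordinates in the source, by [P1E]. On the vertical segment the
    mean value theorem applies to the first component, whose [y]-derivative is [JP v 1 0]. *)
Lemma planar_inj v w : S v -> S w -> P v = P w -> v = w.
Proof.
move=> Sv Sw Pvw.
have vw0 : v 0 0 = w 0 0 by rewrite -!P1E Pvw.
have [t t01] := @mean_value_line R 2 2 P (fun t => JP (v + t *: (w - v))) v w 0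
  (fun t t01 => proj1 (PC1 (S_segment Sv Sw t01))).
have wvE : w - v = row2 0 (w 0 1 - v 0 1).
  by rewrite -{1}(row2E v) -{1}(row2E w) row2B vw0 subrr.
rewrite Pvw subrr {1}wvE row2_mul mul0r add0r => /esym/eqP.
rewrite mulf_eq0 (negPf (JP10 _)); last by apply: S_segment.
rewrite orbF subr_eq0 => /eqP wv.
by rewrite -(row2E v) -(row2E w) vw0 wv.
Qed.

Lemma planar_JP v : S v -> JP v 0 1 = 1 /\ JP v 1 1 = 0.
Proof.
move=> Sv; have [PJ _] := PC1 Sv.
have H1 := has_jac_comp PJ (has_jac_mulmx (delta_mx 1 0 : 'M[R]_(2, 1)) (P v)).
have H2 := has_jac_mulmx (delta_mx 0 0 : 'M[R]_(2, 1)) v.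
have : JP v *m delta_mx 1 0 = delta_mx 0 0 :> 'M[R]_(2, 1).
  apply: has_jac_unique H1 _; apply: has_jac_near_eq H2.
  apply/near_distP; exists 1 => // u _; rewrite -!colE.
  by apply/rowP => i; rewrite !ord1 !mxE P1E.
rewrite -colE => /matrixP E.
by have := E 0 0; have := E 1 0; rewrite !mxE.
Qed.

(** The explicit inverse makes its continuity in [v] a matter of the entries. *)
Lemma planar_invmx v : S v -> JP v \in unitmx /\
  invmx (JP v) = \matrix_(i, j) (if i == 0 then (if j == 0 then 0 else (JP v 1 0)^-1)
                                 else (if j == 0 then 1 else - JP v 0 0 / JP v 1 0)).
Proof.
move=> Sv; have [J01 J11] := planar_JP Sv; have J10 := JP10 Sv.
set K := \matrix_(i, j) _.
have JK : JP v *m K = 1%:M.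
  apply/matrixP => i j; rewrite mxE big_ord_recl big_ord1 !mxE /=.
  have -> : lift ord0 ord0 = 1 :> 'I_2 by apply/val_inj.
  case: (ord2P i) => ->; case: (ord2P j) => -> /=; rewrite ?J01 ?J11 /=.
  - by rewrite mulr0 mulr1 add0r.
  - by rewrite mul1r mulNr addrN.
  - by rewrite mulr0 mul0r addr0.
  - by rewrite mul0r addr0 mulfV.
have [Ju _] := mulmx1_unit JK; split => //.
by rewrite -[RHS](mulKmx Ju) JK mulmx1.
Qed.

Lemma planar_opn_inv_gt0 v : S v -> 0 < opn (invmx (JP v)).
Proof.
move=> Sv; rewrite lt_def opn_ge0 andbT; have [Ju _] := planar_invmx Sv.
apply/eqP => o0; have := norm_le_opn (invmx (JP v)); rewrite o0 normr_le0 => /eqP i0.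
have := mulmxV Ju; rewrite i0 mulmx0 => /matrixP/(_ 0 0).
by rewrite !mxE eqxx => /eqP; rewrite eq_sym oner_eq0.
Qed.

Lemma planar_invmx_cont v : S v -> {for v, continuous (fun v => invmx (JP v))}.
Proof.
move=> Sv; have [_ /cvg_entriesP cJ] := PC1 Sv.
pose K (u : 'rV[R]_2) : 'M[R]_2 := \matrix_(i, j) (if i == 0 then (if j == 0 then 0 else (JP u 1 0)^-1)
  else (if j == 0 then 1 else - JP u 0 0 / JP u 1 0)).
have cK : {for v, continuous K}.
  apply/(@cvg_entriesP R _ (nbhs v)) => i j; rewrite mxE; under eq_fun do rewrite mxE.
  have cV : {for v, continuous (fun u => (JP u 1 0)^-1)}.
    exact: (cvgV (JP10 Sv) (cJ 1 0)).
  have cN : {for v, continuous (fun u => - JP u 0 0 / JP u 1 0)}.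
    exact: (cvgM (cvgN (cJ 0 0)) cV).
  by case: (i == 0); case: (j == 0); [exact: cvg_cst|exact: cV|exact: cvg_cst|exact: cN].
have E : \forall u \near v, K u = invmx (JP u).
  have := open_nbhs_nbhs (conj openS Sv); apply: filterS => u Su.
  by have [_ ->] := planar_invmx Su.
change ((fun v => invmx (JP v)) @ v --> invmx (JP v)); rewrite -(nbhs_singleton E).
exact: cvg_trans (near_eq_cvg E) cK.
Qed.

(** The second coordinate of the target prescribes [x], and the intermediate value theorem provides
    [y]. The preimage is found within [e] of [v0], which also gives continuity of the inverse. *)
Lemma planar_local_surj v0 e : S v0 -> 0 < e ->
  \forall u \near P v0, exists v, [/\ S v, `|v - v0| <= e & P v = u].
Proof.
move=> Sv0 e0; have [PJ _] := PC1 Sv0; set d := JP v0 1 0.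
have d0 : 0 < `|d| by rewrite normr_gt0 JP10.
have d20 : 0 < `|d| / 2 by rewrite divr_gt0.
have /near_distP[r1 r10 Hr1] := PJ _ d20.
have /near_distP[r2 r20 Hr2] := open_nbhs_nbhs (conj openS Sv0).
set e' := Num.min e (Num.min (r1 / 2) (r2 / 2)).
have e'0 : 0 < e' by rewrite !lt_min e0 !divr_gt0.
have e'e : e' <= e by rewrite ge_min lexx.
have e'r1 : e' < r1.
  apply: (@le_lt_trans _ _ (r1 / 2)); first by rewrite !ge_min lexx orbT.
  by rewrite ltr_pdivrMr// ltr_pMr// ltr1n.
have e'r2 : e' < r2.
  apply: (@le_lt_trans _ _ (r2 / 2)); first by rewrite !ge_min lexx !orbT.
  by rewrite ltr_pdivrMr// ltr_pMr// ltr1n.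
pose x0 := P v0 0 1; pose y0 := v0 0 1.
have v0E : v0 = row2 x0 y0 by rewrite /x0 P1E row2E.
have near_v0 x y : `|x - x0| <= e' -> `|y - y0| <= e' -> `|row2 x y - v0| <= e'.
  by move=> xe ye; rewrite {1}v0E row2B row2_norm ge_max xe ye.
have S_near x y : `|x - x0| <= e' -> `|y - y0| <= e' -> S (row2 x y).
  by move=> xe ye; apply: Hr2; apply: le_lt_trans (near_v0 x y xe ye) _.
have xx : `|x0 - x0| <= e' by rewrite subrr normr0 ltW.
have vert s : `|s| <= e' ->
    `|P (row2 x0 (y0 + s)) 0 0 - P v0 0 0 - s * d| <= `|d| / 2 * `|s|.
  move=> se; have yy : `|y0 + s - y0| <= e' by rewrite addrC addKr.
  have := Hr1 (row2 x0 (y0 + s)) (le_lt_trans (near_v0 _ _ xx yy) e'r1).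
  have -> : row2 x0 (y0 + s) - v0 = row2 0 s.
    by rewrite {1}v0E row2B subrr addrC addKr.
  rewrite row2_norm normr0 max_r// => H; apply: le_trans H.
  have <- : (P (row2 x0 (y0 + s)) - P v0 - row2 0 s *m JP v0) 0 0 =
      P (row2 x0 (y0 + s)) 0 0 - P v0 0 0 - s * d.
    have : (row2 0 s *m JP v0) 0 0 = s * d by rewrite row2_mul mul0r add0r.
    by move: (_ *m _) => Z ZE; rewrite !mxE ZE.
  exact: le_mx_norm.
have Pcont w : S w -> {for w, continuous (fun u => P u 0 0)}.
  move=> /PC1[/has_jac_continuous/cvg_entriesP cP _]; exact: cP.
have cx s : {for x0, continuous (fun x => row2 x (y0 + s))}.
  apply/(@cvg_entriesP R _ (nbhs x0)) => i j; rewrite mxE; under eq_fun do rewrite mxE.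
  by case: (j == 0); [exact: cvg_id|exact: cvg_cst].
have cPs s : `|s| <= e' -> {for x0, continuous (fun x => P (row2 x (y0 + s)) 0 0)}.
  move=> se; have Ss : S (row2 x0 (y0 + s)) by apply: S_near => //; rewrite addrC addKr.
  exact: (continuous_comp (cx s) (Pcont _ Ss)).
have ep : `|e'| <= e' by rewrite gtr0_norm.
have em : `|- e'| <= e' by rewrite normrN gtr0_norm.
(* Multiplication by the sign of the [y]-derivative lets one argument serve both monotonicity
   directions. *)
pose sg : R := Num.sg d.
have sgd : sg * d = `|d| by rewrite normrEsg.
have sg1 : `|sg| = 1 by rewrite normr_sg -normr_gt0 d0.
have sg2 : sg * sg = 1.
  by rewrite -expr2 sqr_sg -normr_gt0 d0.
have vert_sg s : `|s| <= e' ->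
    `|sg * (P (row2 x0 (y0 + s)) 0 0 - P v0 0 0) - s * `|d| | <= `|d| / 2 * `|s|.
  move=> se; apply: le_trans (vert s se).
  have -> : sg * (P (row2 x0 (y0 + s)) 0 0 - P v0 0 0) - s * `|d| =
    sg * (P (row2 x0 (y0 + s)) 0 0 - P v0 0 0 - s * d) by rewrite -sgd; ring.
  by rewrite normrM sg1 mul1r.
have de' := mulr_gt0 d0 e'0.
(* At the ends of the vertical segment the linear term [e' * |d|] beats the error, at most half of
   it. These strict inequalities persist when [x] and the target vary slightly. *)
have top : 0 < sg * (P (row2 x0 (y0 + e')) 0 0 - P v0 0 0).
  have := vert_sg e' ep; rewrite (gtr0_norm e'0) ler_norml => /andP[+ _].
  by move: de'; set X := _ * (_ - _); nra.
have bot : sg * (P (row2 x0 (y0 - e')) 0 0 - P v0 0 0) < 0.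
  have := vert_sg (- e') em; rewrite normrN (gtr0_norm e'0) ler_norml => /andP[_ +].
  by move: de'; set X := _ * (_ - _); nra.
have cu0 : {for P v0, continuous (fun u : 'rV[R]_2 => u 0 0)} by exact: coord_continuous.
have cu1 : {for P v0, continuous (fun u : 'rV[R]_2 => u 0 1)} by exact: coord_continuous.
have cdiff s : `|s| <= e' -> {for P v0, continuous (fun u : 'rV[R]_2 =>
    sg * (P (row2 (u 0 1) (y0 + s)) 0 0 - u 0 0))}.
  move=> se; have c1 := continuous_comp cu1 (cPs s se).
  exact: (cvgM (cvg_cst sg) (cvgB c1 cu0)).
have ctop := cdiff _ ep; have cbot := cdiff _ em.
have /cvgrPdistC_lt/(_ _ e'0) nx := cu1.
have ntop : nbhs (P v0) [set u : 'rV[R]_2 |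
    0 < sg * (P (row2 (u 0 1) (y0 + e')) 0 0 - u 0 0)] by exact: (cvgr_gt _ ctop _ top).
have nbot : nbhs (P v0) [set u : 'rV[R]_2 |
    sg * (P (row2 (u 0 1) (y0 - e')) 0 0 - u 0 0) < 0] by exact: (cvgr_lt _ cbot _ bot).
apply: (near_imp3 nx ntop nbot) => u ux utop ubot.
have ux' : `|u 0 1 - x0| <= e' by exact: ltW.
have le_e' s : s \in `[y0 - e', y0 + e'] -> `|s - y0| <= e'.
  by rewrite in_itv /= ler_norml => /andP[s1 s2]; apply/andP; split; lra.
have cIVT : {within `[y0 - e', y0 + e'], continuous (fun s => sg * P (row2 (u 0 1) s) 0 0)}.
  apply: continuous_in_subspaceT => s; rewrite inE /= => /le_e' sy.
  have cr : {for s, continuous (fun s => row2 (u 0 1) s)}.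
    apply/(@cvg_entriesP R _ (nbhs s)) => i j; rewrite mxE; under eq_fun do rewrite mxE.
    by case: (j == 0); [exact: cvg_cst|exact: cvg_id].
  exact: (cvgM (cvg_cst sg) (continuous_comp cr (Pcont _ (S_near _ _ ux' sy)))).
have [||s s_in sE] := @IVT R _ (y0 - e') (y0 + e') (sg * u 0 0) _ cIVT.
- lra.
- move: utop ubot; rewrite /= !mulrBr => utop ubot.
  by rewrite ge_min le_max; apply/andP; split; apply/orP; [left|right]; lra.
exists (row2 (u 0 1) s); split.
- exact: S_near (le_e' _ s_in).
- exact: le_trans (near_v0 _ _ ux' (le_e' _ s_in)) e'e.
have E0 : P (row2 (u 0 1) s) 0 0 = u 0 0.
  by rewrite -[LHS]mul1r -sg2 -mulrA sE mulrA sg2 mul1r.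
by rewrite -(row2E (P _)) P1E E0 row2_0 row2E.
Qed.

(** Meaningful on the image of [S] only; elsewhere it takes the default value 0. *)
Definition planar_inv (u : 'rV[R]_2) : 'rV[R]_2 := xget 0 [set v | S v /\ P v = u].

Lemma planar_invK v : S v -> planar_inv (P v) = v.
Proof.
move=> Sv; rewrite /planar_inv; case: xgetP => [w _ [Sw /planar_inj]|H].
  exact.
by case: (H v).
Qed.

Lemma planar_image_open : open (P @` S).
Proof.
rewrite openE => _ [v Sv <-].
have := planar_local_surj Sv ltr01; apply: filterS => u [w [Sw _ <-]].
by exists w.
Qed.

(** The linearization error of the inverse is that of [P] multiplied by the inverse matrix;
    continuity of the inverse makes the error of [P] small relative to [w - v]. *)
Lemma planar_inv_C1 v : S v ->
  C1_at planar_inv (fun u => invmx (JP (planar_inv u))) (P v).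
Proof.
move=> Sv; have cG : {for P v, continuous planar_inv}.
  apply/continuous_distP => e e0.
  have /near_distP[d d0 Hd] := planar_local_surj Sv e0.
  exists d => // u /Hd[w [Sw wv <-]].
  by rewrite !planar_invK.
have GPv := planar_invK Sv.
split; last first.
  have cK : {for planar_inv (P v), continuous (fun v => invmx (JP v))}.
    by rewrite GPv; exact: planar_invmx_cont.
  exact: (continuous_comp cG cK).
rewrite GPv; have [Ju _] := planar_invmx Sv; set K := invmx _.
have [PJ _] := PC1 Sv => e e0.
pose q := 2 * `|K| + 1.
have q1 : 0 < q by rewrite ltr_wpDl// mulr_ge0.
(* The first bound absorbs half of [w - v], so that it is at most [2 * q] times the increment of
   [P]; the second then yields [e]. *)
pose e1 := Num.min (1 / 2 / q) (e / (2 * q * q)).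
have e10 : 0 < e1 by rewrite lt_min !divr_gt0// !mulr_gt0.
have e1q : e1 * q <= 1 / 2 by rewrite -ler_pdivlMr// ge_min lexx.
have e1e : e1 * (2 * q * q) <= e by rewrite -ler_pdivlMr ?mulr_gt0// ge_min lexx orbT.
have /near_distP[r1 r10 Hr1] := PJ _ e10.
have /cvgrPdistC_lt/(_ _ r10) nG := cG.
have nS : \forall u \near P v, (P @` S) u.
  by apply: open_nbhs_nbhs; split; [exact: planar_image_open|exists v].
apply: (near_imp2 nG nS) => _ /[swap] -[w Sw <-]; rewrite GPv planar_invK// => wv.
have := Hr1 w wv; set E := P w - P v - _ => HE.
have EK : w - v - (P w - P v) *m K = - (E *m K).
  by rewrite /E (mulmxBl (P w - P v)) /K mulmxK// opprB.
have EKle : `|E *m K| <= q * (e1 * `|w - v|).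
  apply: le_trans (mx_norm_mulmx _ _) _; rewrite mulrCA mulrC ler_pM//.
  by rewrite /q; lra.
have PKle : `|(P w - P v) *m K| <= q * `|P w - P v|.
  apply: le_trans (mx_norm_mulmx _ _) _; rewrite mulrCA mulrC ler_wpM2r//.
  by rewrite /q; lra.
have wvle : `|w - v| <= 2 * q * `|P w - P v|.
  have : `|w - v| <= `|(P w - P v) *m K| + `|E *m K|.
    rewrite -{1}(subrK ((P w - P v) *m K) (w - v)) EK addrC.
    by rewrite (le_trans (ler_normD _ _))// normrN.
  have := ler_wpM2r (normr_ge0 (w - v)) e1q; lra.
rewrite EK normrN (le_trans EKle)//.
apply: (@le_trans _ _ (q * (e1 * (2 * q * `|P w - P v|)))).
  by rewrite !ler_wpM2l// ltW.
have := ler_wpM2r (normr_ge0 (P w - P v)) e1e; lra.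
Qed.

End PlanarInverse.

(** * Vector-valued analytic maps and neighborhoods of closed balls *)

Section VectorAnalytic.
Variable R : realType.

Lemma C1_at_lsubmx n k l (f : 'rV[R]_n -> 'rV[R]_(k + l)) J v :
  C1_at f J v -> C1_at (fun u => lsubmx (f u)) (fun u => lsubmx (J u)) v.
Proof.
move=> [fJ cJ]; split; last exact: (cvg_lsubmx cJ).
move=> e e0; have := fJ e e0; apply: filterS => u; apply: le_trans.
by rewrite -!linearB mulmx_lsub -linearB mx_norm_lsubmx.
Qed.

Lemma C1_at_rsubmx n k l (f : 'rV[R]_n -> 'rV[R]_(k + l)) J v :
  C1_at f J v -> C1_at (fun u => rsubmx (f u)) (fun u => rsubmx (J u)) v.
Proof.
move=> [fJ cJ]; split; last exact: (cvg_rsubmx cJ).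
move=> e e0; have := fJ e e0; apply: filterS => u; apply: le_trans.
by rewrite -!linearB mulmx_rsub -linearB mx_norm_rsubmx.
Qed.

Lemma near_forall (V : normedModType R) (I : finType) (v : V) (P : I -> V -> Prop) :
  (forall i, \forall u \near v, P i u) -> \forall u \near v, forall i, P i u.
Proof. exact: filter_forall. Qed.

Lemma C1_at_coords n k (f : 'rV[R]_n -> 'rV[R]_k) (J : 'I_k -> 'rV[R]_n -> 'M[R]_(n, 1)) v :
  (forall i, C1_at (fun u => (f u 0 i)%:M : 'rV_1) (J i) v) ->
  C1_at f (fun u => \matrix_(a, i) J i u a 0) v.
Proof.
move=> H; split; last first.
  apply/(@cvg_entriesP R _ (nbhs v)) => a i; rewrite mxE; under eq_fun do rewrite mxE.
  by have [_ /cvg_entriesP/(_ a 0)] := H i.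
move=> e e0.
apply: filterS (near_forall (fun i => proj1 (H i) e e0)) => u Hu.
apply: mx_norm_le_entries => [|a i].
  by rewrite mulr_ge0// ltW.
rewrite {a}ord1; apply: le_trans (Hu i); apply: le_trans (le_mx_norm _ 0 0).
rewrite !mxE eqxx !mulr1n le_eqVlt; apply/orP; left; apply/eqP.
by congr (`|_ - _|); apply: eq_bigr => b _; rewrite !mxE.
Qed.

(** Continuity of [J] carries over to [jacobian f] because the two agree on a whole neighborhood. *)
Lemma near_C1_jacobian n k (f : 'rV[R]_n -> 'rV[R]_k) J (p : 'rV[R]_n) :
  (\forall u \near p, C1_at f J u) -> \forall u \near p, C1_at f (jacobian f) u.
Proof.
move=> /near_distP[d d0 Hd]; apply/near_distP; exists d => // u up.
have Hu : \forall v \near u, C1_at f J v.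
  apply/near_distP; exists (d - `|u - p|) => [|v vu]; first by rewrite subr_gt0.
  apply: Hd; rewrite -(subrK u v) -addrA (le_lt_trans (ler_normD _ _))//.
  by rewrite -ltrBrDr.
have Ju : \forall v \near u, J v = jacobian f v.
  by apply: filterS Hu => v [/has_jac_diff[_ ->]].
have := nbhs_singleton Hu; apply: C1_at_near_eq Ju.
by apply/near_distP; exists 1.
Qed.

Lemma analytic_vector_C1 n k (f : 'rV[R]_n -> 'rV[R]_k) (p : 'rV[R]_n) :
  (forall i, analytic_at (fun v => f v 0 i) p) ->
  \forall u \near p, C1_at f (jacobian f) u.
Proof.
move=> fa; have H i : exists J, \forall u \near p, C1_at (fun u => (f u 0 i)%:M : 'rV_1) J u.
  have [rho rho0 [J HJ]] := analytic_C1 (fa i).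
  by exists J; apply/near_distP; exists rho.
have /choice[J HJ] := H.
apply: near_C1_jacobian; apply: filterS (near_forall HJ) => u.
exact: C1_at_coords.
Qed.

Lemma has_jac_dir0 n k (f : 'rV[R]_n -> 'rV[R]_k) v M e d j : has_jac f v M -> 0 < d ->
  (forall s : R, `|s| < d -> f (v + s *: e) 0 j = f v 0 j) -> (e *m M) 0 j = 0.
Proof.
move=> fM d0 H; apply/eqP; rewrite -normr_le0; apply/ler_addgt0Pr => r r0; rewrite add0r.
have e1 : 0 < `|e| + 1 by rewrite ltr_wpDl.
have re : 0 < r / (`|e| + 1) by rewrite divr_gt0.
have /near_distP[q q0 Hq] := fM _ re.
pose s := Num.min (d / 2) (q / 2 / (`|e| + 1)).
have s0 : 0 < s by rewrite lt_min !divr_gt0.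
have sd : s < d.
  by apply: (@le_lt_trans _ _ (d / 2)); rewrite ?ge_min ?lexx// ltr_pdivrMr// ltr_pMr// ltr1n.
have se : `|s *: e| <= s * (`|e| + 1) by rewrite mx_normZ gtr0_norm// ler_wpM2l ?(ltW s0)// lerDl.
have sq : s * (`|e| + 1) <= q / 2 by rewrite -ler_pdivlMr// ge_min lexx orbT.
have vs : v + s *: e - v = s *: e by rewrite addrC addKr.
have := Hq (v + s *: e); rewrite vs => Hs.
have : `|(f (v + s *: e) - f v - s *: e *m M) 0 j| <= r / (`|e| + 1) * `|s *: e|.
  apply: le_trans (le_mx_norm _ _ _) _; apply: Hs => //.
  apply: le_lt_trans se _; apply: le_lt_trans sq _.
  by rewrite ltr_pdivrMr// ltr_pMr// ltr1n.
have Hs0 : f (v + s *: e) 0 j = f v 0 j by apply: H; rewrite gtr0_norm.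
rewrite -scalemxAl; move: (e *m M) => Z; rewrite 4!mxE Hs0.
rewrite subrr sub0r normrN mxE.
rewrite normrM (gtr0_norm s0) mx_normZ (gtr0_norm s0) mulrCA ler_pM2l// => /le_trans; apply.
by rewrite mulrAC ler_pdivrMr// ler_wpM2l ?(ltW r0)// lerDl.
Qed.

Lemma dsubmx_rsubmx k l p q (A : 'M[R]_(k + l, p + q)) : dsubmx (rsubmx A) = drsubmx A.
Proof. by apply/matrixP => i j; rewrite !mxE. Qed.

Lemma near_neq0 (V : normedModType R) (g : V -> R) (w : V) :
  {for w, continuous g} -> g w != 0 -> \forall u \near w, g u != 0.
Proof.
move=> gc gw; have g0 : 0 < `|g w| / 2 by rewrite divr_gt0// normr_gt0.
have /cvgrPdist_lt/(_ _ g0) := gc; apply: filterS => u gu.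
apply/eqP => gu0; move: gu; rewrite gu0 subr0.
by move: g0; set x := `|_|; lra.
Qed.

(** A Lebesgue number for the ball, together with the radial projection, which moves a point [u]
    outside the ball by exactly its norm minus [c]. *)
Lemma near_closed_ball n (c : R) (P : 'rV[R]_n -> Prop) :
  (forall w, `|w| <= c -> \forall u \near w, P u) -> 0 < c ->
  exists2 rho, 0 < rho & forall u, `|u| < c + rho -> P u.
Proof.
move=> HP c0.
have cB : compact [set w : 'rV[R]_n | `|w| <= c].
  apply: bounded_closed_compact.
    by exists c; split; [exact: num_real|move=> x cx w /= wc; apply: le_trans (ltW cx)].
  have -> : [set w : 'rV[R]_n | `|w| <= c] = Num.norm @^-1` [set x : R | x <= c] by [].
  apply: closed_comp; last exact: closed_le.
  by move=> u _; apply: norm_continuous.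
have [e e0 He] := compact_uniform_near cB HP.
exists e => // u uce; have [uc|cu] := leP `|u| c.
  by apply: (He u) => //; rewrite subrr normr0.
have u0 : 0 < `|u| by apply: lt_trans cu.
apply: (He ((c / `|u|) *: u)) => /=.
  by rewrite mx_normZ ger0_norm ?divr_ge0 ?(ltW c0)// mulfVK// gt_eqF.
rewrite -{1}(scale1r u) -scalerBl mx_normZ ger0_norm; last first.
  by rewrite subr_ge0 ler_pdivrMr// mul1r ltW.
by rewrite mulrBl mul1r mulfVK ?gt_eqF// ltrBlDl.
Qed.

End VectorAnalytic.

(** * Toy model maps *)

Section HenonNearCube.
Variables (R : realType) (m : nat) (c eta : R) (h : henon R m).
Hypothesis c0 : 0 < c.
Hypothesis eta0 : 0 < eta.
Hypothesis hh : henon_like c (- c) c eta h.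
Hypothesis toy : toy_model c h.

Let F := hmap h.
Let JF := jacobian F.
Let j0 : 'I_(2 + m) := lshift m 0.
Let j1 : 'I_(2 + m) := lshift m 1.

Lemma cubeE (w : 'rV[R]_(2 + m)) : cube c w <-> `|w| <= c.
Proof.
split=> [[wx wy wz]|wc].
  rewrite -[w]hsubmxK mx_norm_row_mx ge_max; apply/andP; split.
    rewrite -(row2E (lsubmx w)) row2_norm ge_max !ler_norml.
    by move: wx wy; rewrite !in_itv /= /px /py /pxy => -> ->.
  apply: mx_norm_le_entries => [|i j]; first exact: ltW.
  by have := wz j; rewrite ord1 in_itv /= /pz ler_norml.
split.
- by rewrite in_itv /= -ler_norml /px /pxy mxE (le_trans (le_mx_norm _ _ _)).
- by rewrite in_itv /= -ler_norml /py /pxy mxE (le_trans (le_mx_norm _ _ _)).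
- by move=> i; rewrite in_itv /= -ler_norml /pz mxE (le_trans (le_mx_norm _ _ _)).
Qed.

Lemma hmap_j0 w : F w 0 j0 = hf h (px w) - heps h w.
Proof. by rewrite /F /hmap /pt row_mxEl row2_0. Qed.

Lemma hmap_j1 w : F w 0 j1 = w 0 j0.
Proof. by rewrite /F /hmap /pt row_mxEl row2_1 /px /pxy mxE. Qed.

Lemma hmap_rsubmx w : rsubmx (F w) = hdelta h w.
Proof. by rewrite /F /hmap /pt row_mxKr. Qed.

Lemma hmap_C1_near w : cube c w -> \forall u \near w, C1_at F JF u.
Proof.
by case: hh => _ /(_ w) Fan _ _ _ cw; apply: analytic_vector_C1 => i; exact: Fan.
Qed.

Lemma hmap_C1 w : cube c w -> C1_at F JF w.
Proof. by move=> /hmap_C1_near/nbhs_singleton. Qed.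

Lemma jac_j1 w a : C1_at F JF w -> JF w a j1 = (a == j0)%:R.
Proof.
move=> [FJ _].
have H1 := has_jac_comp FJ (has_jac_mulmx (delta_mx j1 0 : 'M[R]_(2 + m, 1)) (F w)).
have H2 := has_jac_mulmx (delta_mx j0 0 : 'M[R]_(2 + m, 1)) w.
have : JF w *m delta_mx j1 0 = delta_mx j0 0 :> 'M[R]_(2 + m, 1).
  apply: has_jac_unique H1 _; apply: has_jac_near_eq H2.
  apply/near_distP; exists 1 => // u _; rewrite -!colE.
  by apply/rowP => i; rewrite !ord1 [LHS]mxE [RHS]mxE hmap_j1.
by rewrite -colE => /matrixP/(_ a 0); rewrite !mxE eqxx andbT.
Qed.

(* Along the z-axes the first coordinate of [F] varies as [- heps h], whose
   derivative vanishes on the cube. *)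
Lemma jac_z_j0_cube w j : cube c w -> JF w (rshift 2 j) j0 = 0.
Proof.
move=> cw; have [FJ _] := hmap_C1 cw.
pose e : 'rV[R]_(2 + m) := row_mx 0 (delta_mx 0 j).
have eE : e = delta_mx 0 (rshift 2 j).
  apply/rowP => i; rewrite /e; case: (split_ordP i) => k ->.
    by rewrite row_mxEl !mxE eq_lrshift.
  by rewrite row_mxEr !mxE eq_rshift.
have dF : is_derive (0 : R) (1 : R) (fun s : R => F (w + s *: e) 0 j0) ((e *m JF w) 0 j0).
  by apply: is_derive_line; rewrite scale0r addr0.
suff : - (e *m JF w) 0 j0 = 0.
  by rewrite eE -rowE mxE => /eqP; rewrite oppr_eq0 => /eqP.
rewrite -[RHS](toy cw j) -/e; apply/esym.
have [dex dval] := dF.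
have cv : h1^-1 *: (((fun s : R => F (w + s *: e) 0 j0) \o shift 0) (h1 *: 1) -
    F (w + 0 *: e) 0 j0) @[h1 --> (0 : R)^'] --> (e *m JF w) 0 j0.
  by rewrite -dval; exact: dex.
have pxe s : px (w + s *: e) = px w.
  by rewrite /px /pxy linearD linearZ /= /e row_mxKl scaler0 addr0.
have cd : s^-1 *: (((heps h : 'rV[R]_(2 + m) -> R^o) \o shift w) (s *: e) - heps h w)
    @[s --> (0 : R)^'] --> (- (e *m JF w) 0 j0 : R^o).
  have -> : (fun s : R => s^-1 *: (((heps h : 'rV[R]_(2 + m) -> R^o) \o shift w) (s *: e) - heps h w)) =
    (fun s => - (s^-1 *: (((fun s : R => F (w + s *: e) 0 j0) \o shift 0) (s *: 1) -
      F (w + 0 *: e) 0 j0))).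
    apply/funext => s /=; rewrite scale0r !addr0 !hmap_j0 pxe -scalerN; congr (_ *: _).
    by rewrite [s *: 1]mulr1 (addrC w); ring.
  exact: cvgN cv.
exact: (cvg_lim (@norm_hausdorff _ R^o) cd).
Qed.

Lemma hmap_j0_cube w1 w2 : cube c w1 -> cube c w2 -> lsubmx w1 = lsubmx w2 ->
  F w1 0 j0 = F w2 0 j0.
Proof.
move=> /cubeE c1 /cubeE c2 l12.
have seg t : 0 <= t <= 1 -> cube c (w1 + t *: (w2 - w1)).
  move=> /andP[t0 t1]; apply/cubeE.
  have -> : w1 + t *: (w2 - w1) = (1 - t) *: w1 + t *: w2.
    by apply/matrixP => i j; rewrite !mxE; ring.
  rewrite (le_trans (ler_normD _ _))// !mx_normZ !ger0_norm ?subr_ge0//.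
  have : 0 <= 1 - t by rewrite subr_ge0.
  by move=> t1'; have := ler_wpM2l t1' c1; have := ler_wpM2l t0 c2; lra.
have [t t01] := @mean_value_line _ _ _ F (fun t => JF (w1 + t *: (w2 - w1))) w1 w2 j0
  (fun t t01 => proj1 (hmap_C1 (seg t t01))).
move=> E; apply/esym/eqP; rewrite -subr_eq0 E; apply/eqP.
have l0 : lsubmx (w2 - w1) = 0 by rewrite linearB /= l12 subrr.
have wE : w2 - w1 = row_mx 0 (rsubmx (w2 - w1)) by rewrite -{1}[w2 - w1]hsubmxK l0.
rewrite {1}wE mxE big_split_ord /= big1 ?add0r; last first.
  by move=> i _; rewrite row_mxEl mxE mul0r.
rewrite big1// => i _; rewrite jac_z_j0_cube ?mulr0//; exact: seg.
Qed.

(** At a boundary point independence of [z] is known only inside the cube, but the directions into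
    the cube contain an open cone around [- p / 2]; [analytic_flat] extends it to all directions. *)
Lemma jac_z_j0_near p : cube c p -> \forall u \near p, forall j, JF u (rshift 2 j) j0 = 0.
Proof.
move=> cp; have pc := (cubeE p).1 cp.
have c20 : 0 < c / 2 by rewrite divr_gt0.
have Fan : analytic_at (fun w => F w 0 j0) p by case: hh => _ /(_ p cp) + _ _ _; exact.
have [v t vu t01|r r0 Hr] := @analytic_flat R 2 m (fun w => F w 0 j0) p (- (1 / 2) *: p) (c / 2) Fan c20.
  have Hc (x : 'rV[R]_(2 + m)) : `|x| <= (1 - t / 2) * c + t * (c / 2) -> cube c x.
    by move=> xc; apply/cubeE; apply: le_trans xc _; lra.
  (* For [q] within [c / 2] of [- p / 2] the norm is at most [(1 - t / 2) * c + t * (c / 2) = c]. *)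
  have pv (q : 'rV[R]_(2 + m)) : p + t *: q = (1 - t / 2) *: p + t *: (q - - (1 / 2) *: p).
    by apply/matrixP => i j; rewrite !mxE; field.
  case/andP: t01 => t0 t1.
  have t2 : 0 <= 1 - t / 2 by lra.
  have cv : cube c (p + t *: v).
    apply: Hc; rewrite pv (le_trans (ler_normD _ _))// !mx_normZ (ger0_norm t2) (gtr0_norm t0).
    by rewrite lerD// ler_wpM2l// ltW.
  have cfv : cube c (p + t *: flat v).
    apply/cubeE; rewrite -[p + _]hsubmxK mx_norm_row_mx ge_max; apply/andP; split.
      have -> : lsubmx (p + t *: flat v) = lsubmx (p + t *: v).
        by rewrite !linearD !linearZ /= /flat row_mxKl.
      by apply: le_trans (mx_norm_lsubmx _) _; apply/cubeE.
    have -> : rsubmx (p + t *: flat v) = rsubmx p.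
      by rewrite linearD linearZ /= /flat row_mxKr scaler0 addr0.
    exact: le_trans (mx_norm_rsubmx _) pc.
  apply: hmap_j0_cube => //.
  by rewrite !linearD !linearZ /= /flat row_mxKl.
have r20 : 0 < r / 2 by rewrite divr_gt0.
apply: (near_imp2 (hmap_C1_near cp) (near_dist_lt p r20)) => u [FJ _] up j.
have -> : JF u (rshift 2 j) j0 = ((delta_mx 0 (rshift 2 j) : 'rV_(2 + m)) *m JF u) 0 j0.
  by rewrite -rowE [RHS]mxE.
apply: (has_jac_dir0 FJ r20) => s sr.
set e : 'rV[R]_(2 + m) := delta_mx 0 (rshift 2 j).
have e1 : `|e| <= 1.
  by apply: mx_norm_le_entries => // a b; rewrite mxE; case: (_ && _); rewrite ?normr1 ?normr0.
have fe : flat e = 0.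
  apply/rowP => i; rewrite /flat /e; case: (split_ordP i) => k ->.
    by rewrite row_mxEl !mxE eq_lrshift.
  by rewrite row_mxEr !mxE.
have up' : `|u - p| < r by apply: lt_trans up _; rewrite ltr_pdivrMr// ltr_pMr// ltr1n.
have := Hr (u - p) up'; rewrite (addrC p) subrK => ->.
have -> : u + s *: e = p + (u + s *: e - p) by rewrite (addrC p) subrK.
rewrite Hr; last first.
  rewrite addrAC (le_lt_trans (ler_normD _ _))// (splitr r) ltrD// mx_normZ.
  by apply: le_lt_trans sr; rewrite ler_piMr.
by rewrite addrAC flatD flatZ fe scaler0 addr0.
Qed.

(** The planar components do not depend on [z], so the determinant factors over the blocks. If this
    entry were 0, a row of the planar block would vanish, against positivity of the determinant. *)
Lemma jac_j1_j0_neq0 w : cube c w -> JF w j1 j0 != 0.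
Proof.
move=> cw; have C1w := hmap_C1 cw.
case: hh => _ _ [_ /(_ w cw)] + _ _; rewrite /Dmx det_tr -/F -/JF => det_gt0.
apply/eqP => J0; move: det_gt0.
have Jz : dlsubmx (JF w) = 0.
  apply/matrixP => i j; rewrite [LHS]mxE [LHS]mxE [RHS]mxE.
  case: (ord2P j) => ->; first exact: jac_z_j0_cube.
  by rewrite (jac_j1 _ C1w) /j0 eq_rlshift.
rewrite -[JF w]submxK Jz det_ublock (expand_det_row _ 1) big1 ?mul0r ?ltxx// => j _.
have -> : ulsubmx (JF w) 1 j = JF w j1 (lshift m j) by rewrite [LHS]mxE [LHS]mxE.
case: (ord2P j) => ->; first by rewrite J0 mul0r.
by rewrite (jac_j1 _ C1w) /j0 /j1 eq_lshift mul0r.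
Qed.

Lemma eps_delta_le w : cube c w ->
  [/\ enorm (hdelta h w) <= eta, opnorm (Dmx (hdelta h) w) <= eta &
      opnorm (Dmx (fun w => (heps h w)%:M : 'rV_1) w) <= eta].
Proof.
move=> cw; case: hh => _ _ _ + _; rewrite /eps_delta_norm ge_max => /andP[].
move=> /ereal_supP He /ereal_supP Hd.
have := He _ (ex_intro2 _ _ w cw erefl); rewrite lee_fin ge_max => /andP[_ epsw].
have := Hd _ (ex_intro2 _ _ w cw erefl); rewrite lee_fin ge_max => /andP[d1 d2].
by split.
Qed.

Lemma hdelta_C1 w : C1_at F JF w -> C1_at (hdelta h) (fun u => rsubmx (JF u)) w.
Proof.
move=> /C1_at_rsubmx; apply: C1_at_near_eq; apply/near_distP; exists 1 => // u _.
by rewrite hmap_rsubmx.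
Qed.

Lemma rsubmx_jac_le w : cube c w -> opn (rsubmx (JF w)) <= eta.
Proof.
move=> cw; have [_ + _] := eps_delta_le cw.
by have [/has_jac_diff[_ dJ] _] := hdelta_C1 (hmap_C1 cw); rewrite /Dmx dJ.
Qed.

(** Up to sign this entry is the [y]-derivative of [heps h]. The latter is differentiable as the
    difference of [hf h (px w)], which does not involve [y], and the first component of [F]. *)
Lemma jac_j1_j0_le w : cube c w -> `|JF w j1 j0| <= eta.
Proof.
move=> cw; have [FJ _] := hmap_C1 cw.
have [_ _ deps] := eps_delta_le cw.
have wx : px w \in `[- c, c] by case: cw.
have [Jf Hf] : exists Jf, has_jac (fun u : 'rV[R]_1 => (hf h (u 0 0))%:M : 'rV_1) (const_mx (px w)) Jf.
  case: hh => -[fan _] _ _ _ _; have [rho rho0 [J HJ]] := analytic_C1 (fan _ wx).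
  by exists (J (const_mx (px w))); have [] := HJ (const_mx (px w)) _; rewrite // subrr normr0.
pose X : 'M[R]_(2 + m, 1) := delta_mx j0 0.
have pxX u : u *m X = const_mx (px u) :> 'rV_1.
  by rewrite -colE; apply/rowP => i; rewrite !ord1 !mxE /px /pxy mxE.
have Hfx : has_jac (fun u : 'rV[R]_(2 + m) => (hf h (px u))%:M : 'rV_1) w (X *m Jf).
  rewrite -pxX in Hf; have := has_jac_comp (has_jac_mulmx X w) Hf.
  by apply: has_jac_near_eq; apply/near_distP; exists 1 => // u _; rewrite pxX mxE.
have HF0 := has_jac_comp FJ (has_jac_mulmx (- delta_mx j0 0 : 'M[R]_(2 + m, 1)) (F w)).
have Heps : has_jac (fun u => (heps h u)%:M : 'rV_1) w
    (X *m Jf + JF w *m (- delta_mx j0 0 : 'M[R]_(2 + m, 1))).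
  apply: has_jac_near_eq (has_jacD Hfx HF0); apply/near_distP; exists 1 => // u _.
  rewrite mulmxN -colE; apply/rowP => i.
  have E : (col j0 (F u)) 0 0 = hf h (px u) - heps h u by rewrite [LHS]mxE hmap_j0.
  rewrite !ord1 [LHS]mxE [X in _ + X]mxE E !mxE eqxx !mulr1n; ring.
have [_ dE] := has_jac_diff Heps.
have : `|jacobian (fun u => (heps h u)%:M : 'rV_1) w j1 0| <= eta.
  apply: le_trans deps; rewrite /Dmx.
  by have := entry_le_opnorm (jacobian (fun u => (heps h u)%:M : 'rV_1) w)^T 0 j1; rewrite mxE.
rewrite dE mulmxN -colE mxE (_ : (X *m Jf) j1 0 = 0).
  by rewrite add0r !mxE normrN.
rewrite mxE big_ord1 mxE /j1 /j0 eq_lshift /=.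
by rewrite mul0r.
Qed.

(** All conditions hold near each point of the cube. The bounds are doubled because on the cube
    itself only non-strict bounds by [eta] are available. *)
Lemma henon_near_cube : exists2 rho, 0 < rho & forall u : 'rV[R]_(2 + m), `|u| < c + rho ->
  [/\ C1_at F JF u, forall j, JF u (rshift 2 j) j0 = 0, JF u j1 j0 != 0,
      `|hdelta h u| <= 2 * eta & `|drsubmx (JF u)| <= 2 * eta].
Proof.
apply: near_closed_ball => // w /cubeE cw.
have C1w := hmap_C1 cw; have [_ cJ] := C1w.
have n1 : \forall u \near w, JF u j1 j0 != 0.
  have cJ10 : {for w, continuous (fun u => JF u j1 j0)}.
    by move/cvg_entriesP: cJ; apply.
  exact: (near_neq0 cJ10 (jac_j1_j0_neq0 cw)).
have e2 : eta < 2 * eta by have := eta0; lra.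
have n2 : \forall u \near w, `|hdelta h u| <= 2 * eta.
  have [/has_jac_continuous/continuous_distP/(_ _ eta0)[d d0 Hd] _] := hdelta_C1 C1w.
  apply/near_distP; exists d => // u /Hd Hu.
  have [dw _ _] := eps_delta_le cw.
  have := le_trans (mx_norm_le_enorm _) dw.
  by have := ler_normD (hdelta h u - hdelta h w) (hdelta h w); rewrite subrK; lra.
have n3 : \forall u \near w, `|drsubmx (JF u)| <= 2 * eta.
  move/continuous_distP: cJ => /(_ _ eta0)[d d0 Hd].
  apply/near_distP; exists d => // u /Hd Hu.
  have dr (A : 'M[R]_(2 + m)) : `|drsubmx A| <= `|A|.
    by apply: le_trans (mx_norm_rsubmx _) (mx_norm_dsubmx _).
  have : `|drsubmx (JF w)| <= eta.
    apply: le_trans (rsubmx_jac_le cw); apply: le_trans (norm_le_opn _).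
    by rewrite -dsubmx_rsubmx mx_norm_dsubmx.
  move=> dw; have drB (A A' : 'M[R]_(2 + m)) : drsubmx (A - A') + drsubmx A' = drsubmx A.
    by apply/matrixP => i j; rewrite !mxE subrK.
  rewrite -(drB (JF u) (JF w)) (_ : 2 * eta = eta + eta); last by ring.
  apply: le_trans (ler_normD _ _) (lerD _ dw).
  exact: le_trans (dr _) Hu.
have n45 := near_imp2 (hmap_C1_near cw) (jac_z_j0_near cw) (fun u => @conj _ _).
have n123 := near_imp3 n1 n2 n3 (fun u a b d => And3 a b d).
by apply: (near_imp2 n45 n123) => u [C1u Jz] [J10 d1 d2]; split.
Qed.

End HenonNearCube.

(** * Graphs *)

Section GraphSurface.
Variable R : realType.

(** Linearization with a radius independent of the base point, as needed along whole orbits in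
    [K]. *)
Lemma compact_uniform_has_jac n k (f : 'rV[R]_n -> 'rV[R]_k) J (K : set 'rV[R]_n) tau :
  compact K -> (forall w, K w -> \forall u \near w, C1_at f J u) -> 0 < tau ->
  exists2 r, 0 < r & forall w w', K w -> `|w' - w| < r ->
    `|f w' - f w - (w' - w) *m J w| <= tau * `|w' - w|.
Proof.
move=> /compact_near_coveringP cK KC1 tau0.
have n1 : 0 < n%:R + 1 :> R by rewrite ltr_wpDl.
pose tau' := tau / (n%:R + 1) / 2; have tau'0 : 0 < tau' by rewrite !divr_gt0.
have tau'E : n%:R * (tau' + tau') <= tau.
  rewrite (_ : tau' + tau' = tau / (n%:R + 1)); last by rewrite /tau' -splitr.
  by rewrite mulrCA ler_piMr ?(ltW tau0)// ler_pdivrMr// mul1r lerDl.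
pose Pr (e : R) w := forall w', `|w' - w| < e ->
    `|f w' - f w - (w' - w) *m J w| <= tau * `|w' - w|.
have H : \forall e \near (0 : R)^'+, K `<=` [set w | Pr e w].
  apply: cK => w0 Kw0.
  have /near_distP[r1 r10 Hr1] := KC1 w0 Kw0.
  have [_ /continuous_distP/(_ _ tau'0)[r2 r20 Hr2]] : C1_at f J w0.
    by apply: Hr1; rewrite subrr normr0.
  pose r := Num.min r1 r2; have r0 : 0 < r by rewrite lt_min r10.
  have r20' : 0 < r / 2 by rewrite divr_gt0.
  exists ([set w | `|w - w0| < r / 2], [set e | e < r / 2]).
    split; first exact: (near_dist_lt w0 r20').
    exact: nbhs_right_lt.
  move=> [w e] /= [ww0 er] w' w'w.
  have wr : `|w - w0| < r by apply: lt_trans ww0 _; rewrite ltr_pdivrMr// ltr_pMr// ltr1n.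
  have w'r : `|w' - w0| < r.
    rewrite -(subrK w w') -addrA (le_lt_trans (ler_normD _ _))// (splitr r) ltrD//.
    exact: lt_trans er.
  apply: (@le_trans _ _ (n%:R * ((tau' + tau') * `|w' - w|))); last first.
    by rewrite mulrA ler_wpM2r.
  apply: (mean_value_near (J := fun t => J (w + t *: (w' - w)))) => t t01.
  have := ball_segment wr w'r t01; rewrite lt_min => /andP[t1 t2].
  split; first by have [] := Hr1 _ t1.
  rewrite -(subrK (J w0) (J (w + _))) -addrA (le_trans (ler_normD _ _))// lerD ?Hr2//.
  by rewrite distrC Hr2//; move: wr; rewrite lt_min => /andP[].
have [e [e0 He]] : exists e, 0 < e /\ K `<=` [set w | Pr e w].
  near (0 : R)^'+ => e; exists e; split; first by near: e; exact: nbhs_right_gt.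
  by near: e.
by exists e => // w w' Kw; apply: He.
Unshelve. all: by end_near. Qed.

Lemma is_derive_curve n k (f : 'rV[R]_n -> 'rV[R]_k) (a w : 'rV[R]_n) M :
  has_jac f a M -> is_derive (0 : R) (1 : R) (fun s : R => f (a + s *: w)) (w *m M).
Proof.
move=> fM.
have cd : h^-1 *: (((fun s : R => f (a + s *: w)) \o shift 0) (h *: 1) - f (a + 0 *: w))
    @[h --> (0 : R)^'] --> w *m M.
  apply/cvgrPdist_le => e e0; have w1 : 0 < `|w| + 1 by rewrite ltr_wpDl.
  have ew : 0 < e / (`|w| + 1) by rewrite divr_gt0.
  have /near_distP[r r0 Hr] := fM _ ew.
  rewrite near_withinE; apply: (proj2 (near_distP (0 : R^o) _)).
  exists (r / (`|w| + 1)); first by rewrite divr_gt0.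
  move=> h; rewrite subr0 => hr h0.
  have hw : `|h *: w| <= `|h| * (`|w| + 1) by rewrite mx_normZ ler_wpM2l// lerDl.
  have ah : a + h *: w - a = h *: w by rewrite addrC addKr.
  have := Hr (a + h *: w); rewrite ah => Hh.
  have {}Hh : `|f (a + h *: w) - f a - h *: w *m M| <= e / (`|w| + 1) * `|h *: w|.
    by apply: Hh; apply: le_lt_trans hw _; rewrite -ltr_pdivlMr.
  rewrite /= -[h *: 1]/(h * 1) mulr1 addr0 scale0r addr0 distrC.
  have -> : h^-1 *: (f (a + h *: w) - f a) - w *m M =
      h^-1 *: (f (a + h *: w) - f a - h *: w *m M).
    by rewrite [in RHS]scalerBr -scalemxAl scalerA mulVf// scale1r.
  rewrite mx_normZ normfV ler_pdivrMl ?normr_gt0// (le_trans Hh)//.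
  by rewrite mulrAC ler_pdivrMr// [leRHS]mulrAC [leRHS]mulrC ler_wpM2l// ltW.
apply: DeriveDef; first by apply/cvg_ex; exists (w *m M).
exact: (cvg_lim (@norm_hausdorff _ _) cd).
Qed.

Lemma C1_at_C1_on n k (f : 'rV[R]_n -> 'rV[R]_k) J D :
  (forall w, C1_at f J w) -> C1_on D f.
Proof.
move=> fJ w _; split.
  by apply/near_distP; exists 1 => // u _; have [/has_jac_diff[]] := fJ u.
have -> : jacobian f = J.
  by apply/funext => u; have [/has_jac_diff[]] := fJ u.
by have [] := fJ w.
Qed.

Definition graph n m (phi : 'rV[R]_n -> 'rV[R]_m) : set 'rV[R]_(n + m) :=
  [set w | rsubmx w = phi (lsubmx w)].

(** For [s = -1] the shear flattens the graph, and [s = 1] gives its inverse: one global chart. *)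
Lemma shear_C1 n m (phi : 'rV[R]_n -> 'rV[R]_m) Jphi s : (forall u, C1_at phi Jphi u) ->
  exists J, forall w, C1_at (fun w : 'rV[R]_(n + m) =>
    row_mx (lsubmx w) (rsubmx w + phi (lsubmx w) *m s%:M)) J w.
Proof.
move=> phiC1; eexists => w.
have C1id : C1_at (fun u : 'rV[R]_(n + m) => u *m 1%:M) (cst 1%:M) w by exact: C1_at_mulmx.
have C1l := C1_at_lsubmx C1id; have C1r := C1_at_rsubmx C1id.
have C1p := C1_at_comp (C1_at_comp C1l (phiC1 _)) (C1_at_mulmx s%:M _).
have := C1_at_row_mx C1l (C1_atD C1r C1p).
apply: C1_at_near_eq; apply/near_distP; exists 1 => // u _.
by rewrite mulmx1.
Qed.

Lemma graph_C1_submanifold n m (phi : 'rV[R]_n -> 'rV[R]_m) Jphi :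
  (forall u, C1_at phi Jphi u) -> C1_submanifold (graph phi).
Proof.
move=> phiC1 q Qq.
pose Phi s (w : 'rV[R]_(n + m)) := row_mx (lsubmx w) (rsubmx w + phi (lsubmx w) *m s%:M).
have PhiK s w : Phi (- s) (Phi s w) = w.
  rewrite /Phi row_mxKl row_mxKr -addrA -mulmxDr -raddfD /= addrN.
  by rewrite raddf0 mulmx0 addr0 hsubmxK.
have [J1 HJ1] := shear_C1 (-1) phiC1; have [J2 HJ2] := shear_C1 1 phiC1.
have im : Phi (-1) @` setT = setT.
  by apply/seteqP; split=> // w _; exists (Phi 1 w); [|exact: (PhiK 1 w)].
exists setT, (Phi (-1)); split => //; first exact: openT.
- by rewrite im; exact: openT.
- split; first exact: C1_at_C1_on HJ1.
  exists (Phi 1); split; first exact: C1_at_C1_on HJ2.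
  by move=> w _; rewrite -{1}[1]opprK PhiK.
- move=> w _; rewrite /Phi row_mxKr mul_mx_scalar scaleN1r /graph /=.
  by split=> [->|/eqP]; [rewrite subrr|rewrite subr_eq0 => /eqP].
Qed.

Lemma connected_rV n : connected [set: 'rV[R]_n].
Proof.
have -> : [set: 'rV[R]_n] =
    \bigcup_(v in [set: 'rV[R]_n]) ((fun t : R => t *: v) @` `[0, 1]).
  apply/seteqP; split=> // v _; exists v => //.
  by exists 1; rewrite ?scale1r//= in_itv /= ler01 lexx.
apply: bigcup_connected.
  by exists 0 => v _; exists 0; rewrite ?scale0r//= in_itv /= ler01 lexx.
move=> v _; apply: connected_continuous_connected.
  exact: segment_connected.
apply: continuous_subspaceT => t; apply: cvgZr_tmp; exact: cvg_id.
Qed.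

(** Connectedness renders the word single in the theorem. *)
Lemma graph_connected n m (phi : 'rV[R]_n -> 'rV[R]_m) Jphi :
  (forall u, C1_at phi Jphi u) -> connected (graph phi).
Proof.
move=> phiC1.
have -> : graph phi = (fun u => row_mx u (phi u)) @` setT.
  apply/seteqP; split=> [w Qw|_ [u _ <-]].
    by exists (lsubmx w) => //; rewrite -Qw hsubmxK.
  by rewrite /graph /= row_mxKl row_mxKr.
apply: connected_continuous_connected; first exact: connected_rV.
apply: continuous_subspaceT => u; have [pJ _] := phiC1 u.
exact: has_jac_continuous (has_jac_row_mx (has_jac_id u) pJ).
Qed.

Lemma graph_tangent n m (phi : 'rV[R]_n -> 'rV[R]_m) M (w : 'rV[R]_(n + m)) a :
  has_jac phi (lsubmx w) M -> graph phi w ->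
  tangent_space (graph phi) w (row_mx a (a *m M)).
Proof.
move=> pM Qw; exists (fun s => row_mx (lsubmx w + s *: a) (phi (lsubmx w + s *: a))); split.
- by rewrite scale0r addr0 -Qw hsubmxK.
- apply: (proj2 (near_distP (0 : R^o) _)); exists 1 => // s _.
  by rewrite /graph /= row_mxKl row_mxKr.
- have := is_derive_curve a (has_jac_row_mx (has_jac_id (lsubmx w)) pM).
  by rewrite mul_mx_row mulmx1.
Qed.

End GraphSurface.

(** * Skew products *)

Section SkewProduct.
Variables (R : realType) (m : nat) (c eta rho : R).
Variables (F : 'rV[R]_(2 + m) -> 'rV[R]_(2 + m)).
Variables (P : 'rV[R]_2 -> 'rV[R]_2) (JP : 'rV[R]_2 -> 'M[R]_2).
Variables (dl : 'rV[R]_(2 + m) -> 'rV[R]_m) (Jdl : 'rV[R]_(2 + m) -> 'M[R]_(2 + m, m)).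
Variable mu : 'rV[R]_(2 + m) -> R.
Hypothesis c0 : 0 < c.
Hypothesis rho0 : 0 < rho.
Hypothesis eta0 : 0 < eta.
Hypothesis eta_c : 4 * eta <= c.
Hypothesis eta_m : m%:R * (2 * eta) <= 1 / 4.

Let D := [set w : 'rV[R]_(2 + m) | `|w| < c + rho].
Let S := [set v : 'rV[R]_2 | `|v| < c + rho].
Let Q0 := [set w : 'rV[R]_(2 + m) | `|w| <= c].
Let K := closure (periodic_points Q0 F).

Hypothesis FE : forall w, D w -> F w = row_mx (P (lsubmx w)) (dl w).
Hypothesis PC1 : forall v, S v -> C1_at P JP v.
Hypothesis P1E : forall v, P v 0 1 = v 0 0.
Hypothesis JP10 : forall v, S v -> JP v 1 0 != 0.
Hypothesis JP10_le : forall v, `|v| <= c -> `|JP v 1 0| <= 1.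
Hypothesis dlC1 : forall w, D w -> C1_at dl Jdl w.
Hypothesis dl_le : forall w, D w -> `|dl w| <= 2 * eta.
Hypothesis Jdl_le : forall w, D w -> `|dsubmx (Jdl w)| <= 2 * eta.
Hypothesis muE : forall w, D w -> mu w = (opn (invmx (JP (lsubmx w))))^-1.
Hypothesis K_dom : forall w, K w -> opn (dsubmx (Jdl w)) <= 1 / 2 * mu w.

Let Q0D w : Q0 w -> D w.
Proof. by move=> wc; apply: le_lt_trans wc _; rewrite ltrDl. Qed.

Let DS w : D w -> S (lsubmx w).
Proof. by move=> Dw; apply: le_lt_trans (mx_norm_lsubmx _) Dw. Qed.

Let D_row v z : S v -> `|z| <= c -> D (row_mx v z).
Proof.
move=> Sv zc; rewrite /D /= mx_norm_row_mx gt_max; apply/andP; split=> //.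
by apply: le_lt_trans zc _; rewrite ltrDl.
Qed.

Let openD : open D.
Proof.
rewrite openE => v Sv; apply: (proj2 (near_distP v _)).
exists (c + rho - `|v|); first by rewrite subr_gt0.
move=> u; rewrite ltrBrDr => uv; apply: le_lt_trans uv.
by rewrite -{1}(subrK v u) ler_normD.
Qed.

Let F_cont w : D w -> {for w, continuous F}.
Proof.
move=> Dw; have Sw := DS Dw; have [dJ _] := dlC1 Dw; have [PJ _] := PC1 Sw.
have Jl : has_jac (fun u : 'rV[R]_(2 + m) => lsubmx (u *m 1%:M)) w (lsubmx 1%:M).
  by have [] := C1_at_lsubmx (C1_at_mulmx (1%:M : 'M[R]_(2 + m)) w).
have PJ' : has_jac P (lsubmx (w *m 1%:M)) (JP (lsubmx w)) by rewrite mulmx1.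
have := has_jac_row_mx (has_jac_comp Jl PJ') dJ.
move/has_jac_near_eq => H; apply: (has_jac_continuous (H _ _)).
have := open_nbhs_nbhs (conj openD Dw); apply: filterS => u Du.
by rewrite mulmx1 FE.
Qed.

Let K_Q0 : K `<=` Q0.
Proof.
have clQ0 : closed Q0.
  have -> : Q0 = Num.norm @^-1` [set x : R | x <= c] by [].
  apply: closed_comp; last exact: closed_le.
  by move=> u _; apply: norm_continuous.
move=> w Kw; rewrite ((closure_id Q0).1 clQ0); move: w Kw.
by apply: closure_subset => w [k [k0 _ Hw]]; exact: (Hw 0%N).
Qed.

Let K_compact : compact K.
Proof.
apply: bounded_closed_compact; last exact: closed_closure.
by exists c; split; [exact: num_real|move=> x cx w /K_Q0 wc; apply: le_trans (ltW cx)].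
Qed.

Let KD : K `<=` D.
Proof. by move=> w /K_Q0/Q0D. Qed.

Let per_F w : periodic_points Q0 F w -> periodic_points Q0 F (F w).
Proof.
move=> [k [k0 wk Hw]]; exists k; split => // [|i]; first by rewrite -iterSr iterS wk.
by rewrite -iterSr; apply: Hw.
Qed.

Let K_F w : K w -> K (F w).
Proof.
move=> Kw B /= Bw; have [u [pu Bu]] := Kw _ (F_cont (KD Kw) Bw).
by exists (F u); split; [exact: per_F|].
Qed.

(** A periodic point is the image of its predecessor in the cycle, and the image of the compact [K]
    is closed. *)
Let K_back w : K w -> exists2 w', K w' & F w' = w.
Proof.
move=> Kw; suff : (F @` K) w by case=> w' Kw' <-; exists w'.
have cFK : closed (F @` K).
  apply: compact_closed; first exact: norm_hausdorff.
  apply: continuous_compact K_compact; apply: continuous_in_subspaceT => u.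
  by rewrite inE => /KD; exact: F_cont.
rewrite (closure_id (F @` K)).1//; apply: closure_subset Kw => u pu.
have [k [k0 uk Hu]] := pu; exists (iter k.-1 F u); last by rewrite -iterS prednK.
apply: subset_closure; elim: (k.-1) => [//|j IH].
exact: per_F.
Qed.

Let K_iter n w : K w -> K (iter n F w).
Proof. by move=> Kw; elim: n => // n IH; apply: K_F. Qed.

Let K_z w : K w -> `|rsubmx w| <= 2 * eta.
Proof.
by move=> /K_back[w' Kw' <-]; rewrite FE ?row_mxKr; [exact: dl_le (KD Kw')|exact: KD].
Qed.

Let eta2c : 2 * eta <= c.
Proof. by have := eta0; have := eta_c; lra. Qed.

Let dl_lip v z z' : S v -> `|z| <= c -> `|z'| <= c ->
  `|dl (row_mx v z) - dl (row_mx v z')| <= 1 / 4 * `|z - z'|.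
Proof.
move=> Sv zc zc'.
apply: (@le_trans _ _ (m%:R * (2 * eta * `|z - z'|))); last first.
  by rewrite mulrA ler_wpM2r.
apply: (@mean_value_bound R m m (fun z => dl (row_mx v z))
  (fun t => row_mx 0 1%:M *m Jdl (row_mx v (z' + t *: (z - z')))) z' z) => t t01.
have zt : `|z' + t *: (z - z')| <= c.
  case/andP: t01 => t0 t1.
  have -> : z' + t *: (z - z') = (1 - t) *: z' + t *: z.
    by apply/matrixP => i j; rewrite !mxE; ring.
  rewrite (le_trans (ler_normD _ _))// !mx_normZ !ger0_norm ?subr_ge0//.
  have t1' : 0 <= 1 - t by rewrite subr_ge0.
  by have := ler_wpM2l t1' zc'; have := ler_wpM2l t0 zc; lra.
have Dt := D_row Sv zt; split; last first.
  rewrite -[Jdl _]vsubmxK mul_row_col mul0mx add0r mul1mx.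
  exact: Jdl_le.
have [dJ _] := dlC1 Dt.
exact: (has_jac_comp (has_jac_row_mx (has_jac_cst v _) (has_jac_id _)) dJ).
Qed.

Let mu_gt0 w : D w -> 0 < mu w.
Proof.
move=> Dw; rewrite muE// invr_gt0.
exact: (planar_opn_inv_gt0 PC1 P1E JP10 (DS Dw)).
Qed.

Let mu_expand w (v : 'rV[R]_2) : D w -> mu w * enorm v <= enorm (v *m JP (lsubmx w)).
Proof.
move=> Dw; have [Ju _] := planar_invmx PC1 P1E JP10 (DS Dw).
have := @conorm_mul R 2 (JP (lsubmx w))^T v^T; rewrite unitmx_tr => /(_ Ju).
by rewrite -trmx_mul !enorm_tr /conorm -trmx_inv muE.
Qed.

(** Tested on the vertical vector, which the planar derivative maps to a horizontal vector of length
    at most 1. *)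
Let mu_le1 w : Q0 w -> mu w <= 1.
Proof.
move=> Qw; have Dw := Q0D Qw; have Sw := DS Dw.
have := mu_expand (row2 0 1) Dw.
have [_ J11] := planar_JP PC1 P1E Sw.
have -> : row2 0 1 *m JP (lsubmx w) = row2 (JP (lsubmx w) 1 0) 0.
  by rewrite -[LHS]row2E !row2_mul !mul0r !add0r !mul1r J11.
have en (x y : R) : enorm (row2 x y) = Num.sqrt (x ^+ 2 + y ^+ 2).
  by rewrite /enorm big_ord1 big_ord_recl big_ord1 row2_0 -[in RHS](row2_1 x y);
    congr (Num.sqrt (_ + row2 x y 0 _ ^+ 2)); apply/val_inj.
rewrite !en !expr0n expr1n add0r addr0 sqrtr1 mulr1 sqrtr_sqr => /le_trans; apply.
by apply: JP10_le; apply: le_trans (mx_norm_lsubmx _) Qw.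
Qed.

Let mu_lower : exists2 mu0, 0 < mu0 & forall w, K w -> mu0 <= mu w.
Proof.
have ci w : K w -> {for w, continuous (fun w => invmx (JP (lsubmx w)))}.
  move=> Kw; have cJ := planar_invmx_cont PC1 P1E JP10 (DS (KD Kw)).
  exact: (continuous_comp (lsubmx_continuous (w := w)) cJ).
have [b b0 Hb] := compact_bound K_compact ci.
have q0 : 0 < (2 * 2)%:R * b + 1 :> R by rewrite ltr_wpDl// mulr_ge0.
exists ((2 * 2)%:R * b + 1)^-1 => [|w Kw]; first by rewrite invr_gt0.
have Dw := KD Kw; have mw := mu_gt0 Dw; rewrite (muE Dw) in mw *.
rewrite invr_gt0 in mw; rewrite lef_pV2 ?posrE//.
apply: le_trans (opn_le_norm _) _.
by rewrite -[leLHS]addr0 lerD// ler_wpM2l// Hb.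
Qed.

Let G := planar_inv P (c + rho).

(** [invariant_section] with [2 * eta] as its height: [K] is in the image of [F], so its
    [z]-coordinates obey the bound on [dl], and [4 * eta <= c] keeps twice this height in the
    domain. *)
Let skew_section : exists phi Jphi,
  [/\ forall u, C1_at phi Jphi u,
      forall w, K w -> rsubmx w = phi (lsubmx w) &
      forall w, K w -> \forall v \near lsubmx w, (P @` S) v /\
        phi v = dl (row_mx (G v) (phi (G v)))].
Proof.
have GS u : (P @` S) u -> S (G u) by case=> v Sv <-; rewrite /G (planar_invK PC1 P1E JP10 Sv).
have eta20 : 0 < 2 * eta by rewrite mulr_gt0.
have back w : K w -> exists w', [/\ K w', lsubmx w = P (lsubmx w') & rsubmx w = dl w'].
  move=> /K_back[w' Kw' <-]; exists w'; rewrite FE; last exact: KD.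
  by rewrite row_mxKl row_mxKr.
have oN := planar_image_open PC1 P1E JP10.
have GC1 u : (P @` S) u -> C1_at G (fun u => invmx (JP (G u))) u.
  by case=> v Sv <-; exact: (planar_inv_C1 PC1 P1E JP10 Sv).
have ec := eta_c.
have z4 (z : 'rV[R]_m) : `|z| <= 2 * (2 * eta) -> `|z| <= c.
  by move=> zc; apply: le_trans zc _; lra.
have ND u z : (P @` S) u -> `|z| <= 2 * (2 * eta) -> D (row_mx (G u) z).
  by move=> /GS Su /z4; apply: D_row.
have lip u z z' : (P @` S) u -> `|z| <= 2 * (2 * eta) -> `|z'| <= 2 * (2 * eta) ->
    `|dl (row_mx (G u) z) - dl (row_mx (G u) z')| <= 1 / 4 * `|z - z'|.
  by move=> /GS Su /z4 zc /z4 zc'; apply: dl_lip.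
have Kback w : K w -> (P @` S) (lsubmx w) /\
    exists w', [/\ K w', G (lsubmx w) = lsubmx w' & rsubmx w = dl w'].
  move=> /back[w' [Kw' lw rw]]; have Sw' := DS (KD Kw'); split.
    by exists (lsubmx w').
  by exists w'; split=> //; rewrite lw /G (planar_invK PC1 P1E JP10 Sw').
have Bc w : D w -> {for lsubmx w, continuous (fun v => opn (invmx (JP v)))}.
  by move=> Dw; exact: (cvg_opn (planar_invmx_cont PC1 P1E JP10 (DS Dw))).
have dom w : K w -> opn (invmx (JP (lsubmx w))) * opn (dsubmx (Jdl w)) <= 1 / 2.
  move=> Kw; have Dw := KD Kw; have mw := mu_gt0 Dw.
  have := K_dom Kw; rewrite (muE Dw) in mw *; rewrite invr_gt0 in mw.
  by rewrite ler_pdivlMr// mulrC.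
have [phi [Jphi [H1 H2 H3]]] := invariant_section eta20 oN openD GC1 dlC1 ND dl_le lip
  K_compact KD K_z Kback (fun u _ => lexx (opn (invmx (JP (G u))))) Bc dom.
exists phi, Jphi; split=> // w Kw; apply: H3; by exists w.
Qed.

(** The set [Wss], with [mu] in place of the conorm of [A1]. *)
Definition fast_set (w : 'rV[R]_(2 + m)) : set 'rV[R]_(2 + m) :=
  [set w' | (forall n, Q0 (iter n F w')) /\
     exists C lam : R, 0 < lam < 1 /\
     forall n, enorm (iter n F w' - iter n F w) <=
       C * lam ^+ n * \prod_(i < n) mu (iter i F w)].

Let iter_lsubmx w n : (forall i, Q0 (iter i F w)) ->
  lsubmx (iter n.+1 F w) = P (lsubmx (iter n F w)).
Proof. by move=> Hw; rewrite iterS FE ?row_mxKl//; apply: Q0D. Qed.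

Let prod_mu_gt0 w n : K w -> 0 < \prod_(i < n) mu (iter i F w).
Proof. by move=> Kw; apply: prodr_gt0 => i _; apply: mu_gt0; apply: KD; apply: K_iter. Qed.

Let enorm_lsubmx (w : 'rV[R]_(2 + m)) : enorm (lsubmx w) <= enorm w.
Proof.
rewrite -(ler_pXn2r (n := 2))// ?nnegrE ?enorm_ge0// !enorm_sqr !big_ord1.
rewrite big_split_ord /= -[leLHS]addr0 lerD//.
  by apply: ler_sum => i _; rewrite mxE.
by apply: sumr_ge0 => i _; rewrite sqr_ge0.
Qed.

(* Under the assumption of [fast_set] the planar distances decay faster than
   the planar dynamics allows, unless they vanish. *)
Lemma fast_set_lsubmx w w' : K w -> fast_set w w' -> lsubmx w' = lsubmx w.
Proof.
move=> Kw [Qw' [C [lam [/andP[l0 l1] Hfast]]]].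
have Qw i : Q0 (iter i F w) by apply: K_Q0; apply: K_iter.
apply/eqP; apply: contraT => neq.
pose a n := enorm (lsubmx (iter n F w') - lsubmx (iter n F w)).
pose p n := \prod_(i < n) mu (iter i F w).
have pS n : p n.+1 = p n * mu (iter n F w) by rewrite /p big_ord_recr.
have p0 n : 0 < p n by exact: prod_mu_gt0.
have p1 n : p n <= 1.
  elim: n => [|n IH]; first by rewrite /p big_ord0.
  rewrite pS; apply: le_trans (ler_piMr (ltW (p0 n)) (mu_le1 (Qw n))) IH.
have ale n : a n <= C * lam ^+ n * p n.
  by apply: le_trans (Hfast n); rewrite /a -linearB enorm_lsubmx.
have C0 : 0 <= C.
  have := ale 0%N; rewrite expr0 mulr1 /p big_ord0 mulr1; apply: le_trans.
  exact: enorm_ge0.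
(* By injectivity of [P], projections that differ at time 0 differ at all times. *)
have an0 n : 0 < a n.
  rewrite lt_def enorm_ge0 andbT; apply: contraNneq neq => /enorm_eq0/eqP.
  rewrite subr_eq0; elim: n => [//|n IH /eqP]; rewrite !iter_lsubmx//.
  move=> E; apply: IH; apply/eqP; apply: (planar_inj PC1 P1E JP10 _ _ E).
    by apply: DS; apply: Q0D.
  by apply: DS; apply: Q0D.
have [mu0 mu00 Hmu] := mu_lower.
pose lam' := (1 + lam) / 2.
have l'0 : 0 < lam' by rewrite /lam'; lra.
have ll' : lam < lam' by rewrite /lam'; lra.
(* The Euclidean norm in the plane costs a factor 2, and [2 * tau = (1 - lam') * mu0]. Hence after
   the linearization error the planar distance is still multiplied by at least [lam' * mu]. *)
pose tau := (1 - lam) / 4 * mu0.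
have tau0 : 0 < tau by rewrite mulr_gt0// divr_gt0// subr_gt0.
have cK2 : compact (lsubmx @` K).
  apply: continuous_compact K_compact; apply: continuous_in_subspaceT => u _.
  exact: lsubmx_continuous.
have openS : open S.
  rewrite openE => v Sv; apply: (proj2 (near_distP v _)).
  exists (c + rho - `|v|); first by rewrite subr_gt0.
  move=> u; rewrite ltrBrDr => uv; apply: le_lt_trans uv.
  by rewrite -{1}(subrK v u) ler_normD.
have K2C1 v : (lsubmx @` K) v -> \forall u \near v, C1_at P JP u.
  case=> u Ku <-; have := open_nbhs_nbhs (conj openS (DS (KD Ku))).
  by apply: filterS => x; exact: PC1.
have [r r0 Hr] := compact_uniform_has_jac cK2 K2C1 tau0.
have r20 : 0 < r / 2 by rewrite divr_gt0.
have lam01 : 0 <= lam < 1 by rewrite ltW.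
have [n0 Hn0] := geometric_small C lam01 r20.
have step n : (n0 <= n)%N -> lam' * mu (iter n F w) * a n <= a n.+1.
  move=> nn; have Kn := K_iter (n := n) Kw; have Dn := KD Kn.
  set v := lsubmx (iter n F w); set v' := lsubmx (iter n F w').
  have vv : `|v' - v| < r.
    apply: le_lt_trans (mx_norm_le_enorm _) _; apply: le_lt_trans (ale n) _.
    apply: le_lt_trans (ler_piMr _ (p1 n)) _; first by rewrite mulr_ge0// exprn_ge0// ltW.
    rewrite mulrC; apply: le_lt_trans (Hn0 n nn) _.
    by rewrite ltr_pdivrMr// ltr_pMr// ltr1n.
  have := Hr v v' (ex_intro2 _ _ _ Kn erefl) vv.
  rewrite /a !iter_lsubmx// -/v -/v'; set E := P v' - P v - _ => HE.
  have EE : enorm E <= 2 * tau * a n.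
    apply: le_trans (enorm_le_mx_norm _) _; rewrite mul1n -mulrA ler_wpM2l//.
    by apply: le_trans HE _; rewrite ler_wpM2l ?(ltW tau0)// mx_norm_le_enorm.
  have M1 := mu_expand (v' - v) Dn; rewrite -/v in M1.
  have M2 : enorm ((v' - v) *m JP v) <= enorm (P v' - P v) + enorm E.
    rewrite -[X in enorm X](subrK (P v' - P v)) -(opprB (P v' - P v)) addrC.
    by apply: le_trans (ler_enormD _ _) _; rewrite enormN.
  apply: (@le_trans _ _ (mu (iter n F w) * a n - 2 * tau * a n)); last first.
    by move: M1 M2 EE; rewrite -/(a n); lra.
  rewrite -mulrBl ler_wpM2r ?enorm_ge0//.
  have := ler_wpM2l (_ : 0 <= (1 - lam) / 2) (Hmu _ Kn).
  by rewrite divr_ge0 ?subr_ge0 ?(ltW l1)// => /(_ isT); rewrite /tau /lam'; lra.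
(* Relative to the products of [mu], the planar distance cannot decay faster than [lam' ^+ n],
   whereas the assumption bounds it by [C * lam ^+ n]; for [lam < lam'] these are incompatible. *)
pose b n := a n / p n.
have bS n : (n0 <= n)%N -> lam' * b n <= b n.+1.
  move=> nn; rewrite /b pS ler_pdivlMr ?mulr_gt0 ?mu_gt0//; last by apply: KD; apply: K_iter.
  have -> : lam' * (a n / p n) * (p n * mu (iter n F w)) = lam' * mu (iter n F w) * a n.
    by field; rewrite gt_eqF.
  exact: step.
have b0 : 0 < b n0 by rewrite divr_gt0.
have bgrow k : lam' ^+ k * b n0 <= b (n0 + k)%N.
  elim: k => [|k IH]; first by rewrite expr0 mul1r addn0.
  rewrite addnS; apply: le_trans (bS _ (leq_addr _ _)).
  by rewrite exprS -mulrA ler_wpM2l// ltW.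
have ble n : b n <= C * lam ^+ n by rewrite /b ler_pdivrMr.
have q01 : 0 <= lam / lam' < 1.
  by rewrite divr_ge0 ?(ltW l0) ?(ltW l'0)//= ltr_pdivrMr// mul1r.
have b20 : 0 < b n0 / 2 by rewrite divr_gt0.
have [k Hk] := geometric_small C q01 b20.
have : b n0 <= b n0 / 2.
  apply: le_trans (Hk k (leqnn k)).
  rewrite expr_div_n mulrAC ler_pdivlMr ?exprn_gt0// mulrC.
  apply: le_trans (bgrow k) _; apply: le_trans (ble _) _.
  rewrite exprD mulrCA [leRHS]mulrC ler_piMl ?mulr_ge0 ?exprn_ge0 ?(ltW l0)//.
  by rewrite exprn_ile1 ?(ltW l0) ?(ltW l1).
by move=> bb; exfalso; move: b0 bb; lra.
Qed.

Let enorm_rsubmx (w : 'rV[R]_(2 + m)) : lsubmx w = 0 -> enorm w = enorm (rsubmx w).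
Proof.
move=> lw; congr Num.sqrt; rewrite !big_ord1 big_split_ord /= big1 ?add0r.
  by apply: eq_bigr => i _; rewrite mxE.
move=> i _; have : lsubmx w 0 i = 0 by rewrite lw mxE.
by rewrite mxE => ->; rewrite expr0n.
Qed.

(** On a vertical fibre each step contracts by [3 / 4 * mu]: [1 / 2] from the domination on [K] and
    [1 / 4] from the linearization error, which the choice of [tau] ensures by
    [m * tau <= mu0 / 4]. *)
Lemma fast_set_vertical w : K w -> exists2 r, 0 < r & forall w',
  lsubmx w' = lsubmx w -> `|w' - w| < r -> fast_set w w'.
Proof.
move=> Kw; have [mu0 mu00 Hmu] := mu_lower.
have m1 : 0 < m%:R + 1 :> R by rewrite ltr_wpDl.
pose tau := mu0 / 4 / (m%:R + 1); have tau0 : 0 < tau by rewrite !divr_gt0.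
have KC1 u : K u -> \forall v \near u, C1_at dl Jdl v.
  move=> Ku; have := open_nbhs_nbhs (conj openD (KD Ku)).
  by apply: filterS => v; exact: dlC1.
have [r1 r10 Hr1] := compact_uniform_has_jac K_compact KC1 tau0.
(* The bound [c / 2] keeps the starting point in the cube, since [K] has height at most
   [2 * eta <= c / 2]. *)
exists (Num.min r1 (c / 2)); first by rewrite lt_min r10 divr_gt0.
move=> w' lw; rewrite lt_min => /andP[w'r1 w'c].
pose z n := rsubmx (iter n F w') - rsubmx (iter n F w).
pose p n := \prod_(i < n) mu (iter i F w).
have pS n : p n.+1 = p n * mu (iter n F w) by rewrite /p big_ord_recr.
have inv n : [/\ Q0 (iter n F w'), lsubmx (iter n F w') = lsubmx (iter n F w),
    `|z n| < r1 & enorm (z n) <= enorm (z 0%N) * (3 / 4) ^+ n * p n].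
  elim: n => [|n [Qn ln zn en]].
    split=> //.
    - rewrite /Q0 /= -[w']hsubmxK mx_norm_row_mx ge_max lw.
      rewrite (le_trans (mx_norm_lsubmx _) (K_Q0 Kw)) /=.
      have := ler_normD (rsubmx w' - rsubmx w) (rsubmx w); rewrite subrK.
      have := K_z Kw; have : `|rsubmx w' - rsubmx w| < c / 2.
        by rewrite -linearB; apply: le_lt_trans (mx_norm_rsubmx _) w'c.
      by have := eta_c; lra.
    - by rewrite /z /= -linearB; apply: le_lt_trans (mx_norm_rsubmx _) w'r1.
    - by rewrite expr0 mulr1 /p big_ord0 mulr1.
  have Kn := K_iter (n := n) Kw; have Dn := KD Kn; have Dn' := Q0D Qn.
  have Kn1 := K_iter (n := n.+1) Kw.
  have wE : iter n F w' - iter n F w = row_mx 0 (z n).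
    by rewrite -[LHS]hsubmxK !linearB /= ln subrr.
  have zS : z n.+1 = dl (iter n F w') - dl (iter n F w).
    by rewrite /z !iterS !FE// !row_mxKr.
  have lip : `|z n.+1| <= 1 / 4 * `|z n|.
    rewrite zS -[iter n F w']hsubmxK -[iter n F w]hsubmxK ln.
    apply: dl_lip; first exact: DS.
      exact: le_trans (mx_norm_rsubmx _) Qn.
    exact: le_trans (mx_norm_rsubmx _) (K_Q0 Kn).
  have l1 : lsubmx (iter n.+1 F w') = lsubmx (iter n.+1 F w).
    by rewrite !iterS !FE// !row_mxKl ln.
  split=> //.
  - rewrite /Q0 /= -[X in `|X|]hsubmxK mx_norm_row_mx ge_max; apply/andP; split.
      by rewrite -/(iter n.+1 F w') l1; apply: le_trans (mx_norm_lsubmx _) (K_Q0 Kn1).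
    by rewrite FE// row_mxKr; apply: le_trans (dl_le Dn') eta2c.
  - by apply: le_lt_trans lip _; have := normr_ge0 (z n); move: zn; lra.
  - have := Hr1 _ (iter n F w') Kn; rewrite wE mx_norm_row_mx normr0 max_r//.
    move=> /(_ zn); rewrite -zS; set E := z n.+1 - _ => HE.
    have zM : row_mx 0 (z n) *m Jdl (iter n F w) = z n *m dsubmx (Jdl (iter n F w)).
      by rewrite -{1}[Jdl _]vsubmxK mul_row_col mul0mx add0r.
    have e1 : enorm (z n *m dsubmx (Jdl (iter n F w))) <= 1 / 2 * mu (iter n F w) * enorm (z n).
      rewrite -enorm_tr trmx_mul (le_trans (enorm_mul_opnorm _ _))// enorm_tr.
      by rewrite ler_wpM2r ?enorm_ge0//; apply: K_dom.
    have e2 : enorm E <= 1 / 4 * mu (iter n F w) * enorm (z n).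
      apply: le_trans (enorm_le_mx_norm _) _; rewrite mul1n.
      apply: le_trans (ler_wpM2l (ler0n _ _) HE) _; rewrite mulrA.
      have mt0 : 0 <= m%:R * tau by apply: mulr_ge0 => //; exact: ltW.
      apply: (ler_pM mt0 (normr_ge0 _) _ (mx_norm_le_enorm _)).
      rewrite /tau mulrCA (_ : 1 / 4 * _ = mu (iter n F w) / 4); last by ring.
      apply: (@le_trans _ _ (mu0 / 4)); last by rewrite ler_pM2r ?invr_gt0// Hmu.
      rewrite ler_piMr ?divr_ge0 ?(ltW mu00)// ler_pdivrMr// mul1r.
      by rewrite lerDl.
    have : enorm (z n.+1) <= 3 / 4 * mu (iter n F w) * enorm (z n).
      rewrite -[z n.+1](subrK (row_mx 0 (z n) *m Jdl (iter n F w))) -/E zM.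
      by apply: le_trans (ler_enormD _ _) _; move: e1 e2; lra.
    move=> /le_trans; apply; rewrite pS exprS.
    have -> : enorm (z 0%N) * (3 / 4 * (3 / 4) ^+ n) * (p n * mu (iter n F w)) =
      3 / 4 * mu (iter n F w) * (enorm (z 0%N) * (3 / 4) ^+ n * p n) by ring.
    by rewrite ler_wpM2l// mulr_ge0 ?divr_ge0// ltW// mu_gt0.
split=> [n|]; first by have [] := inv n.
exists (enorm (z 0%N)), (3 / 4); split; first by apply/andP; split; lra.
move=> n; have [_ ln _] := inv n; apply: le_trans.
rewrite enorm_rsubmx ?linearB//= ?ln ?subrr//.
Qed.

Theorem skew_surface : exists Q : set 'rV[R]_(2 + m),
  [/\ C1_submanifold Q, connected Q, K `<=` Q, locally_invariant F K Q &
      forall w, K w -> transverse_at Q (fast_set w) w /\ Q `&` fast_set w = [set w]].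
Proof.
have [phi [Jphi [phiC1 Kphi phi_inv]]] := skew_section.
exists (graph phi); split.
- exact: graph_C1_submanifold phiC1.
- exact: graph_connected phiC1.
- by move=> w /Kphi.
- pose U := interior [set v | (P @` S) v /\ phi v = dl (row_mx (G v) (phi (G v)))].
  have oU : open U := @open_interior _ _.
  (* The invariance equation is needed at the image [P (lsubmx w)], so the neighborhood is a
     preimage. *)
  exists [set w | D w /\ U (P (lsubmx w))]; split.
  + rewrite openE => w [Dw Uw].
    have [PJ _] := PC1 (DS Dw).
    have cP : {for w, continuous (P \o lsubmx)}.
      exact: (continuous_comp (lsubmx_continuous (w := w)) (has_jac_continuous PJ)).
    have nU : \forall u \near w, U (P (lsubmx u)).
      by apply: cP; apply: open_nbhs_nbhs; split.
    by apply: (near_imp2 (open_nbhs_nbhs (conj openD Dw)) nU) => u Du Uu; split.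
  + move=> w Kw; split; last exact: Kphi.
    split; first exact: KD.
    have := phi_inv _ (K_F Kw); rewrite FE ?row_mxKl//; exact: KD.
  + move=> _ [w [[Dw Uw] Qw] <-]; have Sw := DS Dw.
    have [_ phiP] := interior_subset Uw.
    rewrite /graph /= FE// row_mxKl row_mxKr phiP /G (planar_invK PC1 P1E JP10 Sw).
    by rewrite -Qw hsubmxK.
- move=> w Kw; have Qw := Kphi w Kw; split.
    move=> v; have [pJ _] := phiC1 (lsubmx w).
    (* [zeta] is the deviation of [v] from the tangent plane of the graph; it is vertical, hence
       tangent to the disc of [fast_set_vertical]. *)
    pose a := lsubmx v; pose zeta := rsubmx v - a *m Jphi (lsubmx w).
    exists (row_mx a (a *m Jphi (lsubmx w))), (row_mx 0 zeta); split.
    + exact: graph_tangent.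
    + have [r r0 Hr] := fast_set_vertical Kw.
      exists (fun s => w + s *: row_mx 0 zeta); split.
      * by rewrite scale0r addr0.
      * have z1 : 0 < `|zeta| + 1 by rewrite ltr_wpDl.
        apply: (proj2 (near_distP (0 : R^o) _)); exists (r / (`|zeta| + 1)).
          by rewrite divr_gt0.
        move=> s; rewrite subr0 ltr_pdivlMr// => sr; apply: Hr.
          by rewrite linearD linearZ /= row_mxKl scaler0 addr0.
        rewrite addrC addKr mx_normZ mx_norm_row_mx normr0 max_r//.
        by apply: le_lt_trans sr; rewrite ler_wpM2l// lerDl.
      * have := is_derive_curve (row_mx 0 zeta) (has_jac_id w).
        by rewrite mulmx1.
    + by rewrite add_row_mx addr0 /zeta addrC subrK /a hsubmxK.
  apply/seteqP; split=> [w' [Qw' Hw']|_ ->].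
    have lw := fast_set_lsubmx Kw Hw'.
    by rewrite /= -[w']hsubmxK -[w]hsubmxK Qw' Qw lw.
  split=> //; split; first by move=> n; apply: K_Q0; apply: K_iter.
  exists 0, (1 / 2); split; first by apply/andP; split; lra.
  by move=> n; rewrite subrr enorm0 !mul0r.
Qed.

End SkewProduct.

(** * Toy model maps as skew products, and the theorem *)

Section ToyModel.
Variables (R : realType) (m : nat) (h : henon R m).

Lemma map2dE v : map2d h v = lsubmx (hmap h (row_mx v 0)).
Proof. by rewrite /hmap /pt row_mxKl /map2d /px /pxy row_mxKl. Qed.

Lemma map2d_1 v : map2d h v 0 1 = v 0 0.
Proof. exact: row2_1. Qed.

Lemma map2d_C1 J v : C1_at (hmap h) J (row_mx v 0) ->
  C1_at (map2d h) (fun v => ulsubmx (J (row_mx v 0))) v.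
Proof.
pose X : 'M[R]_(2, 2 + m) := row_mx 1%:M 0.
have XE (u : 'rV[R]_2) : u *m X = row_mx u 0 by rewrite mul_mx_row mulmx1 mulmx0.
rewrite -XE => HJ.
have := C1_at_lsubmx (C1_at_comp (C1_at_mulmx X v) HJ).
apply: C1_at_near_eq; apply/near_distP; exists 1 => // u _.
  by rewrite map2dE XE.
rewrite /cst XE /X -{1}[J _]vsubmxK mul_row_col mul1mx mul0mx addr0.
by apply/matrixP => i j; rewrite !mxE.
Qed.

Lemma A1E J w : C1_at (hmap h) J (row_mx (lsubmx w) 0) ->
  A1 h w = (ulsubmx (J (row_mx (lsubmx w) 0)))^T.
Proof. by move=> /map2d_C1[/has_jac_diff[_ dJ] _]; rewrite /A1 /Dmx dJ. Qed.

Lemma D1E J w : has_jac (hdelta h) w J -> D1 h w = (dsubmx J)^T.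
Proof.
move=> dJ; rewrite /D1 /Dmx; congr (_^T).
have : has_jac (hdelta h) (row_mx (pxy w) (pz w)) J by rewrite hsubmxK.
move=> /(has_jac_comp (has_jac_row_mx (has_jac_cst (pxy w) _) (has_jac_id _))).
move=> /has_jac_diff[_ ->].
by rewrite -[J]vsubmxK mul_row_col mul0mx add0r mul1mx !vsubmxK.
Qed.

Lemma conorm_tr n (A : 'M[R]_n) : conorm A^T = (opn (invmx A))^-1.
Proof. by rewrite /conorm -trmx_inv. Qed.

(** The vanishing [z]-derivative is integrated along the segment from [z = 0], the slice in which
    [map2d] is defined; the ball is convex. *)
Lemma hmap_lsubmx J r : (forall w, `|w| < r -> C1_at (hmap h) J w) ->
  (forall w j, `|w| < r -> J w (rshift 2 j) (lshift m 0) = 0) ->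
  forall w, `|w| < r -> lsubmx (hmap h w) = map2d h (lsubmx w).
Proof.
move=> HJ Jz w wr.
have e1 : lsubmx (hmap h w) 0 1 = map2d h (lsubmx w) 0 1.
  by rewrite map2d_1 [LHS]mxE hmap_j1 [RHS]mxE.
rewrite -[LHS]row2E -[RHS]row2E e1 map2dE; congr (row2 _ _).
rewrite [LHS]mxE [RHS]mxE.
have fr : `|row_mx (lsubmx w) 0 : 'rV[R]_(2 + m)| < r.
  exact: le_lt_trans (flat_norm w) wr.
have seg t : 0 <= t <= 1 -> `|row_mx (lsubmx w) 0 + t *: (w - row_mx (lsubmx w) 0)| < r.
  move=> t01; rewrite -[X in `|X|]subr0.
  by apply: ball_segment t01; rewrite subr0.
have [t t01] := mean_value_line (lshift m 0) (fun t t01 => proj1 (HJ _ (seg t t01))).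
have E : w - row_mx (lsubmx w) 0 = row_mx 0 (rsubmx w).
  by rewrite -{1}[w]hsubmxK opp_row_mx add_row_mx subrr subr0.
rewrite {1}E => H; apply/eqP; rewrite -subr_eq0 H mxE big_split_ord /= big1 ?add0r.
  by rewrite big1// => i _; rewrite Jz ?mulr0//; exact: seg.
by move=> i _; rewrite row_mxEl mxE mul0r.
Qed.

End ToyModel.

Theorem lemma7p4 (R : realType) (m : nat) (m_ge1 : (1 <= m)%N)
    (c : R) (c_gt0 : 0 < c) :
  exists eta : R, 0 < eta /\
  forall (ebar : R), 0 < ebar <= eta ->
  forall (h : henon R m), toy_model c h -> I_class c eta ebar h ->
  (ereal_sup [set (opnorm (D1 h w) / conorm (A1 h w))%:E | w in perbar c h]
     <= (1 / 2)%:E)%E ->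
  exists Q : set 'rV[R]_(2 + m),
    [/\ C1_submanifold Q,
        connected Q,
        perbar c h `<=` Q,
        locally_invariant (hmap h) (perbar c h) Q &
        forall w, perbar c h w ->
          transverse_at Q (Wss c h w) w /\ Q `&` Wss c h w = [set w]].
Proof.
have m0 : 0 < m%:R :> R by rewrite ltr0n.
(* The first bound leaves room in the cube for sections of height [4 * eta]. The second makes the
   fibre contraction [m * (2 * eta)] at most 1/4, where [2 * eta] bounds the [z]-derivative near the
   cube and [m] comes from the max norm. *)
pose eta := Num.min (c / 4) (1 / (8 * m%:R)).
have eta0 : 0 < eta by rewrite lt_min !divr_gt0// mulr_gt0.
exists eta; split=> // ebar _ h toy [[a [b [H [a0 b0 H0 _ Hn]]]] _] dom.
have [hh _ _] := Hn 0%N; rewrite a0 b0 H0 in hh.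
have eta_c : 4 * eta <= c by rewrite mulrC -ler_pdivlMr// ge_min lexx.
have eta_m' : eta * (8 * m%:R) <= 1 by rewrite -ler_pdivlMr ?mulr_gt0// ge_min lexx orbT.
have eta_m : m%:R * (2 * eta) <= 1 / 4 by lra.
(* This gives the bound 1 on the [y]-derivative of epsilon, hence [m(A_1) <= 1] on the cube. *)
have eta1 : eta <= 1.
  apply: le_trans eta_m'; rewrite ler_pMr// -natrM -[leLHS]/(1%:R) ler_nat.
  by rewrite muln_gt0.
have [rho rho0 Hrho] := henon_near_cube c_gt0 eta0 hh toy.
set JF := jacobian (hmap h) in Hrho.
pose JP (v : 'rV[R]_2) : 'M[R]_2 := ulsubmx (JF (row_mx v 0)).
have FC1 w : `|w| < c + rho -> C1_at (hmap h) JF w by move=> /Hrho[].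
have flat_lt (v : 'rV[R]_2) r : `|v| < r -> `|row_mx v 0 : 'rV[R]_(2 + m)| < r.
  by rewrite mx_norm_row_mx normr0 max_l.
have FE w : `|w| < c + rho -> hmap h w = row_mx (map2d h (lsubmx w)) (hdelta h w).
  move=> wr; rewrite -[LHS]hsubmxK hmap_rsubmx; congr row_mx.
  by apply: (hmap_lsubmx FC1 _ wr) => u j /Hrho[].
have PC1 v : `|v| < c + rho -> C1_at (map2d h) JP v.
  by move=> vr; apply: map2d_C1; apply: FC1; exact: flat_lt.
have JPE v : JP v 1 0 = JF (row_mx v 0) (lshift m 1) (lshift m 0).
  by rewrite /JP; move: (JF _) => A; rewrite !mxE.
have JP10 v : `|v| < c + rho -> JP v 1 0 != 0.
  by move=> vr; rewrite JPE; have [] := Hrho _ (flat_lt _ _ vr).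
have JP10_le v : `|v| <= c -> `|JP v 1 0| <= 1.
  move=> vc; rewrite JPE; apply: le_trans eta1.
  apply: (jac_j1_j0_le hh); apply/(cubeE c_gt0).
  by rewrite mx_norm_row_mx normr0 max_l.
have dlC1 w : `|w| < c + rho -> C1_at (hdelta h) (fun u => rsubmx (JF u)) w.
  by move=> /FC1/hdelta_C1.
have dl_le w : `|w| < c + rho -> `|hdelta h w| <= 2 * eta by move=> /Hrho[].
have Jdl_le w : `|w| < c + rho -> `|dsubmx (rsubmx (JF w))| <= 2 * eta.
  by move=> wr; rewrite dsubmx_rsubmx; have [] := Hrho w wr.
have muE w : `|w| < c + rho -> conorm (A1 h w) = (opn (invmx (JP (lsubmx w))))^-1.
  move=> wr; rewrite (A1E (FC1 _ (flat_lt _ _ _))) ?conorm_tr//.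
  exact: le_lt_trans (mx_norm_lsubmx _) wr.
have cubeQ : cube c = [set w : 'rV[R]_(2 + m) | `|w| <= c].
  by apply/seteqP; split=> w /(cubeE c_gt0).
have KD w : perbar c h w -> `|w| < c + rho.
  move=> Kw; suff wc : `|w| <= c by apply: le_lt_trans wc _; rewrite ltrDl.
  have clQ : closed [set w : 'rV[R]_(2 + m) | `|w| <= c].
    have -> : [set w : 'rV[R]_(2 + m) | `|w| <= c] = Num.norm @^-1` [set x : R | x <= c] by [].
    apply: closed_comp; last exact: closed_le.
    by move=> u _; apply: norm_continuous.
  apply: clQ; move: Kw; apply: closure_subset => u [k [_ _ /(_ 0%N)]].
  by rewrite cubeQ.
have K_dom w : perbar c h w -> opn (dsubmx (rsubmx (JF w))) <= 1 / 2 * conorm (A1 h w).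
  move=> Kw; have wr := KD w Kw.
  have : opnorm (D1 h w) / conorm (A1 h w) <= 1 / 2.
    by move/ereal_supP: dom => /(_ _ (ex_intro2 _ _ w Kw erefl)); rewrite lee_fin.
  have [dJ _] := dlC1 w wr; rewrite (D1E dJ).
  rewrite ler_pdivrMr// muE// invr_gt0.
  apply: (planar_opn_inv_gt0 PC1 (map2d_1 h) JP10).
  exact: le_lt_trans (mx_norm_lsubmx _) wr.
have WE w : Wss c h w = fast_set c (hmap h) (fun w => conorm (A1 h w)) w.
  by rewrite /Wss /fast_set cubeQ.
have := skew_surface (mu := fun w => conorm (A1 h w)) c_gt0 rho0 eta0 eta_c eta_m FE PC1
  (map2d_1 h) JP10 JP10_le dlC1 dl_le Jdl_le muE.
rewrite -cubeQ => /(_ K_dom)[Q [Q1 Q2 Q3 Q4 Q5]].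
by exists Q; split=> // w Kw; rewrite WE; exact: Q5.
Qed.
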